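(* Let $G$ be a simple strongly even-cycle decomposable graph and let $u$ and $v$ be non-isolated, non-adjacent twin vertices of $G$. Let $H$ be a simple Eulerian graph with an even number of vertices. If $H$ is not a co-claw or $\deg_G(v)\ge 4$, then the twin substitution of $\{u,v\}$ by $H$ in $G$ is strongly even-cycle decomposable.
   Context: All graphs are finite and have at least one vertex. An Eulerian graph is a (not necessarily connected) graph in which every vertex has even degree. A co-claw is the disjoint union of a triangle $K_3$ and one isolated vertex. A graph is even-cycle decomposable if its edge set can be partitioned into (edge sets of) cycles of even length. A subdivision of a graph is obtained by replacing each edge by a path of length at least $1$ with the same ends (so a graph is a subdivision of itself). A graph $G$ is strongly even-cycle decomposable if every subdivision of $G$ with an even number of edges is even-cycle decomposable. Equivalently, for every $\Sigma\subseteq E(G)$ with $|\Sigma|$ even, $E(G)$ can be partitioned into cycles each containing an even number of edges of $\Sigma$. Two distinct vertices $u,v$ of a graph $G$ are twins if no vertex in $V(G)\setminus\{u,v\}$ is adjacent to exactly one of $u$ and $v$. If $u$ and $v$ are twins of $G$ and $H$ is a simple graph, the twin substitution of $\{u,v\}$ by $H$ in $G$ is the graph obtained from the disjoint union of $G-u-v$ and $H$ by adding an edge $xy$ for all $x\in V(H)$ and all neighbors $y\in V(G)\setminus\{u,v\}$ of $v$. *)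

(* Defs.v *)
From mathcomp Require Import all_boot.
Set Implicit Arguments.
Unset Strict Implicit.
Unset Printing Implicit Defensive.

(* Every graph in this development is simple: subdivisions and twin
   substitutions of simple graphs are again simple. *)
Record sgraph := SGraph {
  svertex :> finType;
  sedge : rel svertex;
  sedge_sym : symmetric sedge;
  sedge_irr : irreflexive sedge }.

Definition deg (G : sgraph) (x : G) : nat := #|[set y : G | sedge x y]|.

Definition edges (G : sgraph) : {set {set G}} :=
  [set d | [exists x : G, exists y : G, sedge x y && (d == [set x; y])]].

Definition eulerian (G : sgraph) : Prop := forall x : G, ~~ odd (deg x).

(* The edges {x, s_0}, {s_0, s_1}, ... of the walk x :: s. *)
Definition walk_edges (T : finType) (x : T) (s : seq T) : seq {set T} :=
  pairmap (fun a b => [set a; b]) x s.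

(* C is the edge set of a cycle; its length is then #|C|. *)
Definition is_cycle (G : sgraph) (C : {set {set G}}) : Prop :=
  exists (x : G) (s : seq G),
    [/\ 3 <= size (x :: s), uniq (x :: s), path (@sedge G) x (rcons s x)
      & C = [set d in walk_edges x (rcons s x)]].

Definition even_cycle_decomposable (G : sgraph) : Prop :=
  exists P : {set {set {set G}}},
    partition P (edges G) /\
    forall C, C \in P -> is_cycle C /\ ~~ odd #|C|.

(* f embeds the vertices of G into K, and for every edge xy of G the path
   replacing it runs from f x through the list p x y of its interior vertices
   to f y; values of p at non-edges are irrelevant. *)
Record subdivides_via (G K : sgraph) (f : G -> K) (p : G -> G -> seq K) :
    Prop := SubdividesVia {
  sd_inj : injective f;
  sd_path : forall x y, sedge x y ->
    path (@sedge K) (f x) (rcons (p x y) (f y));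
  sd_uniq : forall x y, sedge x y -> uniq (f x :: rcons (p x y) (f y));
  sd_rev : forall x y, sedge x y -> p y x = rev (p x y);
  sd_interior : forall x y z, sedge x y -> f z \notin p x y;
  sd_disjoint : forall x y x' y' a, sedge x y -> sedge x' y' ->
    a \in p x y -> a \in p x' y' -> [set x; y] = [set x'; y'];
  sd_vertices : forall a : K,
    (exists x, a = f x) \/ (exists x y, sedge x y /\ a \in p x y);
  sd_edges : forall d, d \in edges K ->
    exists x y, sedge x y /\ d \in walk_edges (f x) (rcons (p x y) (f y)) }.

Definition is_subdivision (G K : sgraph) : Prop :=
  exists (f : G -> K) (p : G -> G -> seq K), subdivides_via f p.

Definition strongly_even_cycle_decomposable (G : sgraph) : Prop :=
  forall K : sgraph, is_subdivision G K -> ~~ odd #|edges K| ->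
    even_cycle_decomposable K.

Definition isomorphic (G K : sgraph) : Prop :=
  exists f : G -> K, bijective f /\ forall x y, sedge (f x) (f y) = sedge x y.

Section Complete.
Variable n : nat.
Definition complete_rel : rel 'I_n := fun x y => x != y.
Lemma complete_sym : symmetric complete_rel.
Proof. by move=> x y; rewrite /complete_rel eq_sym. Qed.
Lemma complete_irr : irreflexive complete_rel.
Proof. by move=> x; rewrite /complete_rel eqxx. Qed.
Definition complete : sgraph := SGraph complete_sym complete_irr.
End Complete.

Section DisjointUnion.
Variables G H : sgraph.
Definition dunion_rel : rel (G + H)%type := fun a b =>
  match a, b with
  | inl x, inl y => sedge x y
  | inr x, inr y => sedge x y
  | _, _ => false
  end.
Lemma dunion_sym : symmetric dunion_rel.
Proof. by move=> [x|x] [y|y] //=; rewrite sedge_sym. Qed.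
Lemma dunion_irr : irreflexive dunion_rel.
Proof. by move=> [x|x] /=; rewrite sedge_irr. Qed.
Definition dunion : sgraph := SGraph dunion_sym dunion_irr.
End DisjointUnion.

Definition co_claw : sgraph := dunion (complete 3) (complete 1).

Definition twins (G : sgraph) (u v : G) : Prop :=
  u != v /\ forall w, w != u -> w != v -> sedge w u = sedge w v.

(* Meaningful when u and v are twins, but defined for all u, v. *)
Section TwinSubstitution.
Variables (G : sgraph) (u v : G) (H : sgraph).
Definition twin_subst_rel : rel ({x : G | (x != u) && (x != v)} + H)%type :=
  fun a b =>
  match a, b with
  | inl x, inl y => sedge (val x) (val y)
  | inr x, inr y => sedge x y
  | inl x, inr _ => sedge v (val x)
  | inr _, inl y => sedge v (val y)
  end.
Lemma twin_subst_sym : symmetric twin_subst_rel.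
Proof. by move=> [x|x] [y|y] //=; rewrite sedge_sym. Qed.
Lemma twin_subst_irr : irreflexive twin_subst_rel.
Proof. by move=> [x|x] /=; rewrite sedge_irr. Qed.
Definition twin_substitution : sgraph := SGraph twin_subst_sym twin_subst_irr.
End TwinSubstitution.

(* Main.v *)
(* The proof works with signed graphs: the graph is strongly even-cycle
   decomposable when, for every signature with evenly many odd edges, it splits
   into cycles with evenly many odd edges.

   Let N be the common neighbourhood of the twins, an even set.  Remove even cycles
   from H as long as possible; what remains of H is a cactus of odd cycles.  Any two
   vertices of H span a copy of G, so it suffices to leave two vertices for such a
   copy (possibly with an edge xn replaced by a path from x through H to n) and to
   decompose everything else.  Colour a vertex x of H by the parity of the edges from x
   to N.  Edges to N from equally coloured vertices split into even 4-cycles.  An odd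
   cycle is absorbed together with two differently coloured vertices on it; two
   disjoint odd cycles together with two equally coloured vertices on each; two
   odd cycles that meet in w together with one vertex on each, equally coloured and
   distinct from w.  Removing leaves of the cactus in this way preserves the
   remaining cycles with all their vertices, until at most three cycles are left.
   These are handled by also rerouting an edge of the copy of G along an arc of a
   cycle.  The only obstruction is a triangle
   together with a single further vertex of the other colour when |N| = 2, that is,
   the co-claw. *)
Require Import Defs.
From mathcomp Require Import all_boot zify.
Set Implicit Arguments.
Unset Strict Implicit.
Unset Printing Implicit Defensive.

(** * Walks and cycles *)

(** Each recombination is governed by a single bit. The two arcs that two vertices cut from an odd
    cycle have opposite parities, so exchanging them flips the parity of the cycle under
    construction and one of the two choices is right; the parity of the complementary cycle then
    follows from the colours. The parity of the last piece, the copy of $G$, is never computed: the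
    total is even and everything removed is even. The price is that the copy must be decomposable
    under every signature, but this also allows an edge $xn$ to carry the parity of a longer path,
    which afterwards replaces the edge in its cycle.

    $|N|$ is even because $G$ itself, with no odd edge, splits into cycles. The tight case is one
    remaining cycle of a single colour, since vertices for the copy of $G$ must survive. From four
    vertices on, both arcs between two of its vertices can have inner vertices. A triangle lacks
    this room, and when moreover all triangles formed by one of its edges and a vertex of $N$ are
    odd, the proof uses four vertices of $N$ or three further vertices of $H$. *)

Lemma set2_eq (T : finType) (a b a' b' : T) : [set a; b] = [set a'; b'] ->
  (a, b) = (a', b') \/ (a, b) = (b', a').
Proof.
move=> e; have : a \in [set a'; b'] by rewrite -e !inE eqxx.
have : b \in [set a'; b'] by rewrite -e !inE eqxx orbT.
have : a' \in [set a; b] by rewrite e !inE eqxx.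
have : b' \in [set a; b] by rewrite e !inE eqxx orbT.
rewrite !inE.
by move=> /orP[]/eqP ? /orP[]/eqP ? /orP[]/eqP ? /orP[]/eqP ?;
  (left; congruence) || (right; congruence).
Qed.

Section Walks.
Variable T : finType.
Implicit Types (x y z : T) (p q s c : seq T) (l : seq {set T}).

(** On lists of one or two vertices this yields a degenerate or a doubled edge, hence the bound
    [2 < size c] wherever a genuine cycle is meant. *)
Definition cedges c : seq {set T} :=
  if c is x :: s then walk_edges x (rcons s x) else [::].

Lemma walk_edges_cat x p q :
  walk_edges x (p ++ q) = walk_edges x p ++ walk_edges (last x p) q.
Proof. exact: pairmap_cat. Qed.

Lemma walk_edges_rcons x p y :
  walk_edges x (rcons p y) = rcons (walk_edges x p) [set last x p; y].
Proof. by rewrite -cats1 walk_edges_cat cats1. Qed.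

Lemma cedges_cons x s :
  cedges (x :: s) = rcons (walk_edges x s) [set last x s; x].
Proof. exact: walk_edges_rcons. Qed.

Lemma walk_edges_rev x p :
  perm_eq (walk_edges (last x p) (rev (belast x p))) (walk_edges x p).
Proof.
elim: p x => [|y p IH] x //=.
rewrite rev_cons walk_edges_rcons -cats1.
have -> : last (last y p) (rev (belast y p)) = y.
  by case: p {IH} => //= z p; rewrite rev_cons last_rcons.
by rewrite setUC perm_catC /= perm_cons; apply: IH.
Qed.

Lemma perm_cedges_rot n c : perm_eq (cedges (rot n c)) (cedges c).
Proof.
have rot1E d : perm_eq (cedges (rot 1 d)) (cedges d).
  case: d => [|x [|y s]] //; rewrite rot1_cons rcons_cons cedges_cons.
  by rewrite last_rcons /= -cats1 perm_catC.
elim: n => [|n IH]; first by rewrite rot0.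
case: (leqP (size c) n) => hn; first by rewrite rot_oversize // ltnW.
by rewrite -add1n rotD ?add1n //; apply: perm_trans IH.
Qed.

Lemma perm_cedges_rev c : perm_eq (cedges (rev c)) (cedges c).
Proof.
case: c => [|x s]; first by [].
apply: perm_trans (_ : perm_eq _ (cedges (rotr 1 (rev (x :: s))))) _.
  by rewrite perm_sym; apply: perm_cedges_rot.
rewrite rev_cons rotr1_rcons /= -rev_cons.
have := walk_edges_rev x (rcons s x).
by rewrite last_rcons belast_rcons.
Qed.

Lemma walk_edges_split x s y z : [set y; z] \in walk_edges x s ->
  exists s1 a b s2, [/\ x :: s = s1 ++ a :: b :: s2 &
    (a, b) = (y, z) \/ (a, b) = (z, y)].
Proof.
elim: s x => [|w s IH] x //=; rewrite in_cons => /orP[/eqP/esym/set2_eq h|/IH].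
  by exists [::], x, w, s.
move=> [s1 [a [b [s2 [e h]]]]]; exists (x :: s1), a, b, s2.
by rewrite e.
Qed.

Lemma mem_walk_edges x s d y : d \in walk_edges x s -> y \in d -> y \in x :: s.
Proof.
elim: s x => [|w s IH] x //=; rewrite in_cons => /orP[/eqP->|/IH h] yd.
  by move: yd; rewrite !inE => /orP[]->; rewrite ?orbT.
by rewrite inE h ?orbT.
Qed.

Lemma cedges_vertex c y : y \in c -> exists2 d, d \in cedges c & y \in d.
Proof.
case: c => // x s /= ys.
have : y \in rcons s x by rewrite mem_rcons.
elim: {ys}(rcons s x) {2}x => [|w p IH] v //=; rewrite inE.
case/predU1P=> [<-|/IH -/(_ w)[d hd yd]].
  by exists [set v; y]; rewrite !inE eqxx ?orbT.
by exists d => //; rewrite inE hd orbT.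
Qed.

(* Orients a cycle through the edge {a, b} so that it starts with a, b. *)
Lemma cedges_split c a b : 1 < size c -> [set a; b] \in cedges c ->
  exists q, perm_eq (a :: b :: q) c /\ perm_eq (cedges (a :: b :: q)) (cedges c).
Proof.
case: c => [|x [|y s]] // _.
move=> /walk_edges_split [s1 [u [v [s2 [e h]]]]].
have {e h} [n [q [hn hq]]] : exists n q, rot n (x :: y :: s) = u :: v :: q /\ ((u, v) = (a, b) \/ (u, v) = (b, a)).
  (* If nothing follows [v], the edge is the one that closes the cycle, and the rotation has to
     start at the last vertex of the list. *)
  case/lastP: s2 e => [|s2 w] e.
    have e2 : x :: rcons (y :: s) x = rcons (rcons s1 u) v by rewrite e -!cats1 -catA.
    move: e2; rewrite -rcons_cons => /rcons_inj[e2 xv]; subst v.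
    case: s1 e e2 => [|w s1] e [e1 e2]; first by [].
    exists (size (x :: s1)), s1; split=> //.
    rewrite e2 /= -cats1 -cat_cons.
    by rewrite -[X in rot X _]/(size (x :: s1)) rot_size_cat.
  have e2 : x :: rcons (y :: s) x = rcons (s1 ++ u :: v :: s2) w by rewrite e -!cats1 -catA.
  move: e2; rewrite -rcons_cons => /rcons_inj[e2 _].
  exists (size s1), (s2 ++ s1); rewrite e2 rot_size_cat; split=> //.
case: hq => -[? ?]; subst u v.
  by exists q; rewrite -hn perm_rot perm_cedges_rot.
(* The rotation meets the edge as [b], [a]; reversing and then rotating by [size q] brings [a], [b]
   to the front. *)
exists (rev q).
have e : a :: b :: rev q = rot (size q) (rev (b :: a :: q)).
  by rewrite -[b :: a :: q]/([:: b; a] ++ q) rev_cat -(size_rev q) rot_size_cat.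
rewrite e -hn; split.
- by rewrite perm_rot perm_rev perm_rot.
- by apply: perm_trans (perm_cedges_rot _ _) _; apply: perm_trans (perm_cedges_rev _) (perm_cedges_rot _ _).
Qed.

End Walks.


(** * Arcs of a cycle, and cycles formed by two paths *)

Section Arcs.
Variable T : finType.
Implicit Types (x y z : T) (p q s c : seq T) (l : seq {set T}).

(** [p] lists the vertices after [x], so that its edges are [walk_edges x p]; for [x = y] only the
    empty list qualifies. *)
Definition xypath x y p := (last x p == y) && uniq (x :: p).

Lemma xypath_last x y p : xypath x y p -> last x p = y.
Proof. by case/andP=> /eqP. Qed.

Lemma xypath_uniq x y p : xypath x y p -> uniq (x :: p).
Proof. by case/andP. Qed.

Lemma xypath_mem x y p : xypath x y p -> y \in x :: p.
Proof. by move/xypath_last <-; rewrite mem_last. Qed.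

Lemma xypath_cat x y z p q : xypath x y p -> xypath y z q ->
  (forall t, t \in x :: p -> t \in y :: q -> t = y) -> xypath x z (p ++ q).
Proof.
move=> /andP[/eqP h1 u1] /andP[/eqP h2 u2] h; apply/andP; split.
  by rewrite last_cat h1 h2.
rewrite -cat_cons cat_uniq u1 /=; move: u2; rewrite cons_uniq => /andP[n2 ->].
rewrite andbT; apply/hasPn => t tq; apply: contra n2 => tp.
by rewrite -(h t) // inE tq orbT.
Qed.

Lemma xypath_revP x y p : xypath x y p -> exists q,
  [/\ xypath y x q, perm_eq (walk_edges y q) (walk_edges x p),
      y :: q =i x :: p & size q = size p].
Proof.
move=> /andP[/eqP h u]; exists (rev (belast x p)).
have e : y :: rev (belast x p) = rev (x :: p).
  by rewrite [in RHS]lastI rev_rcons h.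
split.
- rewrite /xypath e rev_uniq u andbT -(last_cons y) e.
  by case: {e h u}p => [|z p] //=; rewrite rev_cons last_rcons.
- by rewrite -h walk_edges_rev.
- by move=> t; rewrite e mem_rev.
- by rewrite size_rev size_belast.
Qed.

(** Both arcs are oriented from [x] to [y]. For [x != y] their lists omit [x] and end in [y], hence
    the exception in [arcs_disj]. *)
Record arcs c x y p q : Prop := Arcs {
  arcs1 : xypath x y p;
  arcs2 : xypath x y q;
  arcs_perm : perm_eq (cedges c) (walk_edges x p ++ walk_edges x q);
  arcs_mem1 : {subset x :: p <= c};
  arcs_mem2 : {subset x :: q <= c};
  arcs_mem : forall z, z \in c -> (z \in x :: p) || (z \in x :: q);
  arcs_disj : forall z, z \in p -> z \in q -> z = y;
  arcs_size : size p + size q = size c }.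

Lemma arcsC c x y p q : arcs c x y p q -> arcs c x y q p.
Proof.
case=> h1 h2 h3 *; split=> //; first by apply: perm_trans h3 _; rewrite perm_catC.
- by move=> z; rewrite orbC; auto.
- by auto.
- by rewrite addnC.
Qed.

(** Here the first arc is explicit and [s2] is known to lie on the second, so that chosen vertices
    can be placed on a prescribed arc. *)
Lemma arcs_cat x s1 y s2 : uniq (x :: s1 ++ y :: s2) ->
  exists2 q, arcs (x :: s1 ++ y :: s2) x y (rcons s1 y) q & {subset s2 <= q}.
Proof.
move=> us.
have [[xs1 xs2 ys1] [ys2 us1 us2]] : [/\ x \notin s1, x \notin s2 & y \notin s1]
    /\ [/\ y \notin s2, uniq s1 & uniq s2].
  move: us; rewrite /= cat_uniq /= mem_cat inE !negb_or.
  by case/andP=> /and3P[-> _ ->] /and3P[-> /andP[-> _] /andP[-> ->]].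
have nxy : x != y by move: us; rewrite /= mem_cat inE !negb_or => /andP[/and3P[]].
have xr : xypath y x (rcons s2 x).
  by rewrite /xypath last_rcons eqxx /= rcons_uniq mem_rcons inE negb_or eq_sym nxy xs2 us2 ys2.
have [q [hq pq mq sq]] := xypath_revP xr.
exists q; last first.
  move=> z zs; have := mq z; rewrite !inE mem_rcons inE zs !orbT.
  by case/predU1P=> // zx; move: xs2; rewrite -zx zs.
split=> //.
- by rewrite /xypath last_rcons eqxx /= rcons_uniq mem_rcons inE negb_or nxy xs1 us1 ys1.
- rewrite /cedges rcons_cat rcons_cons.
  rewrite -cat_rcons walk_edges_cat last_rcons perm_cat2l.
  by rewrite perm_sym.
- move=> z; rewrite !inE mem_rcons mem_cat !inE.
  by case/or3P=> ->; rewrite ?orbT.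
- move=> z; rewrite mq !inE mem_rcons mem_cat !inE.
  by case/or3P=> ->; rewrite ?orbT.
- move=> z; rewrite mq !inE mem_rcons mem_cat !inE mem_rcons !inE.
  by case/or4P=> ->; rewrite ?orbT.
- move=> z zs1 zq; have := mq z; rewrite !inE zq orbT mem_rcons !inE => /esym.
  move: zs1; rewrite mem_rcons inE; case/predU1P=> // zs1.
  have zx : z != x by apply: contraNneq xs1 => <-.
  rewrite (negPf zx); case/orP=> [/eqP //|] /= zs2.
  move: us; rewrite /= cat_uniq /= => /and3P[_ _ /and3P[/norP[_ /hasPn h] _ _]].
  by move: (h z zs2); rewrite zs1.
- by rewrite sq !size_rcons /= size_cat /=; clear; lia.
Qed.

Lemma arcs_exist c x y : uniq c -> x \in c -> y \in c -> x != y ->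
  exists p q, arcs c x y p q.
Proof.
move=> uc xc yc nxy.
have [i [s hi]] : exists i s, rot i c = x :: s.
  by case: (rot_to xc) => i s hi; exists i, s.
have us : uniq (x :: s) by rewrite -hi rot_uniq.
have ms : x :: s =i c by move=> z; rewrite -hi mem_rot.
have ys : y \in s by move: yc; rewrite -ms inE eq_sym (negPf nxy).
have pe : perm_eq (cedges c) (cedges (x :: s)).
  by rewrite perm_sym -hi perm_cedges_rot.
have sz : size (x :: s) = size c by rewrite -hi size_rot.
move: {hi} us ms pe sz; case/splitPr: ys => s1 s2 us ms pe sz.
have [q [h1 h2 h3 h4 h5 h6 h7 h8] _] := arcs_cat us.
exists (rcons s1 y), q; split=> //; try by move=> z; rewrite -ms; auto.
- exact: perm_trans h3.
- by rewrite h8.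
Qed.

(** The bound on the sizes only rules out two copies of the single edge [xy], the one case in which
    internally disjoint paths do not form a cycle. *)
Lemma cyc_of_paths x y p q : xypath x y p -> xypath x y q -> x != y ->
  (forall z, z \in p -> z \in q -> z = y) -> 2 < size p + size q ->
  exists c, [/\ uniq c, 2 < size c,
    perm_eq (cedges c) (walk_edges x p ++ walk_edges x q)
    & forall z, (z \in c) = (z \in x :: p) || (z \in x :: q)].
Proof.
move=> hp hq nxy dj sz; have [r [hr pr mr sr]] := xypath_revP hq.
case/lastP: r hr pr mr sr => [|r x'] hr pr mr sr.
  by move/xypath_last: hr nxy => /= ->; rewrite eqxx.
have ex : x' = x by move/xypath_last: hr; rewrite last_rcons.
subst x'; have lp := xypath_last hp.
exists (x :: p ++ r); split.
- rewrite -cat_cons cat_uniq (xypath_uniq hp) /=.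
  move/xypath_uniq: hr; rewrite /= mem_rcons inE negb_or rcons_uniq.
  case/and3P=> /andP[_ yr] xr ->; rewrite andbT; apply/hasPn => z zr.
  rewrite inE negb_or; apply/andP; split; first by apply: contraNneq xr => <-.
  apply/negP => zp; have zy : z != y by apply: contraNneq yr => <-.
  have := mr z; rewrite !inE mem_rcons inE zr !orbT => /esym/predU1P[zx|zq].
    by move: xr; rewrite -zx zr.
  by move: zy; rewrite (dj z zp zq) eqxx.
- by move: sr sz; rewrite /= size_rcons size_cat; clear; lia.
- by rewrite /cedges rcons_cat walk_edges_cat lp perm_cat2l.
- move=> z; have := mr z; rewrite -(xypath_last hp) !inE mem_cat mem_rcons inE.
  move=> e; case: (z =P x) => //= zx; move: e.
  have -> : (z == x) = false by apply/eqP.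
  rewrite /= => <-; case: eqP => [->|] //=; rewrite !lp.
  by have := xypath_mem hp; rewrite inE eq_sym (negPf nxy) /= => ->.
Qed.

End Arcs.

(** * Decompositions into even cycles *)

Section Dec.
Variable T : finType.
Implicit Types (x y z : T) (p q s c : seq T) (l : seq {set T}).
Implicit Types (sg : pred {set T}) (cs : seq (seq T)).

Definition par sg l := odd (count sg l).

Lemma par_cat sg l1 l2 : par sg (l1 ++ l2) = par sg l1 (+) par sg l2.
Proof. by rewrite /par count_cat oddD. Qed.

Lemma par_cons sg d l : par sg (d :: l) = sg d (+) par sg l.
Proof. by rewrite /par /= oddD oddb. Qed.

Lemma par_nil sg : par sg [::] = false.
Proof. by []. Qed.

Lemma par_perm sg l1 l2 : perm_eq l1 l2 -> par sg l1 = par sg l2.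
Proof. by rewrite /par => /permP->. Qed.

Definition parE := (par_cat, par_cons, par_nil).

Definition ecyc sg c := [&& 2 < size c, uniq c & ~~ par sg (cedges c)].

(* Lists of edges are read as multisets, so that decompositions may be
   concatenated without any disjointness condition. *)
Definition dec sg l := exists cs,
  all (ecyc sg) cs /\ perm_eq (flatten (map (@cedges T) cs)) l.

Lemma dec_nil sg : dec sg [::].
Proof. by exists [::]. Qed.

Lemma dec_perm sg l1 l2 : perm_eq l1 l2 -> dec sg l1 -> dec sg l2.
Proof. by move=> h [cs [h1 h2]]; exists cs; split=> //; apply: perm_trans h. Qed.

Lemma dec_cat sg l1 l2 : dec sg l1 -> dec sg l2 -> dec sg (l1 ++ l2).
Proof.
move=> [c1 [h1 p1]] [c2 [h2 p2]]; exists (c1 ++ c2).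
by rewrite all_cat h1 h2 map_cat flatten_cat perm_cat.
Qed.

Lemma dec_ecyc sg c : ecyc sg c -> dec sg (cedges c).
Proof. by move=> h; exists [:: c]; rewrite /= h cats0. Qed.

Lemma dec_par sg l : dec sg l -> par sg l = false.
Proof.
move=> [cs [h hp]]; rewrite -(par_perm sg hp) {hp l}.
elim: cs h => //= c cs IH /andP[/and3P[_ _ /negbTE h] /IH].
by rewrite par_cat h => ->.
Qed.

Lemma dec_extract sg a b l : dec sg ([set a; b] :: l) -> exists q l1 l2,
  [/\ ecyc sg [:: a, b & q], perm_eq (cedges [:: a, b & q]) ([set a; b] :: l1),
      dec sg l2 & perm_eq l (l1 ++ l2)].
Proof.
move=> [cs [h hp]].
have : [set a; b] \in flatten (map (@cedges T) cs) by rewrite (perm_mem hp) mem_head.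
case/flattenP=> _ /mapP[c cc ->] dc.
have /and3P[c2 uc pc] := allP h _ cc.
have [q [pq pe]] := cedges_split (ltnW c2) dc.
have pcs := perm_to_rem cc.
have dcs : all (ecyc sg) (rem c cs).
  by apply/allP=> d /mem_rem; apply: (allP h).
have p2 : perm_eq (cedges c ++ flatten (map (@cedges T) (rem c cs))) ([set a; b] :: l).
  by apply: perm_trans hp; rewrite perm_sym; apply: (perm_flatten (perm_map _ pcs)).
have dq : [set a; b] \in cedges (a :: b :: q) by rewrite (perm_mem pe).
exists q, (rem [set a; b] (cedges (a :: b :: q))), (flatten (map (@cedges T) (rem c cs))).
split.
- by rewrite /ecyc (perm_size pq) c2 (perm_uniq pq) uc (par_perm _ pe).
- exact: perm_to_rem.
- by exists (rem c cs).
- rewrite -(perm_cons [set a; b]) perm_sym; apply: perm_trans p2.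
  rewrite -cat_cons; apply: perm_cat => //.
  by apply: perm_trans pe; rewrite perm_sym perm_to_rem.
Qed.

Lemma eq_par sg1 sg2 l : {in l, sg1 =1 sg2} -> par sg1 l = par sg2 l.
Proof. by move=> h; rewrite /par (eq_in_count h). Qed.

Lemma eq_dec sg1 sg2 l : {in l, sg1 =1 sg2} -> dec sg1 l -> dec sg2 l.
Proof.
move=> h [cs [h1 h2]]; exists cs; split=> //; apply/allP=> c cc.
have /and3P[c2 uc pc] := allP h1 _ cc; apply/and3P; split=> //.
rewrite -(@eq_par sg1) // => d dc; apply: h; rewrite -(perm_mem h2).
by apply/flattenP; exists (cedges c) => //; apply: map_f.
Qed.

(** Only the cycle through [ab] changes. Its vertices other than [a] and [b] are ends of edges in
    [l], so the inner vertices [p] are new to it; its parity is kept because under [sg] the edge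
    [ab] had the parity of the new path. *)
Lemma dec_subst sg a b l p : dec sg ([set a; b] :: l) -> a != b ->
  uniq p -> a \notin p -> b \notin p ->
  (forall d, d \in l -> forall z, z \in d -> z \notin p) ->
  forall sg', {in l, sg =1 sg'} ->
  sg [set a; b] = par sg' (walk_edges a (rcons p b)) ->
  dec sg' (walk_edges a (rcons p b) ++ l).
Proof.
move=> /dec_extract [q [l1 [l2 [hc pc h2 pl]]]] nab up ap bp dp sg' es ep.
have l12 d : d \in l = (d \in l1) || (d \in l2) by rewrite (perm_mem pl) mem_cat.
have ec : cedges (a :: b :: q) = [set a; b] :: walk_edges b (rcons q a) by [].
have pq : perm_eq (walk_edges b (rcons q a)) l1 by move: pc; rewrite ec perm_cons.
have vq z : z \in b :: q -> z \notin p.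
  move=> zb; have : z \in a :: b :: q by rewrite inE zb orbT.
  case/cedges_vertex=> d; rewrite ec in_cons => /predU1P[->|hd zd].
    by rewrite !inE => /orP[]/eqP->.
  by apply: dp zd; rewrite l12 -(perm_mem pq) hd.
apply: (@dec_perm _ (cedges (a :: p ++ b :: q) ++ l2)).
  rewrite /cedges rcons_cat -cat_rcons walk_edges_cat last_rcons -catA.
  by rewrite perm_cat2l perm_sym (perm_trans pl) // perm_cat2r perm_sym.
apply: dec_cat; last by apply: eq_dec h2 => d hd; apply: es; rewrite l12 hd orbT.
apply: dec_ecyc; move: hc => /and3P[sq uq eq]; apply/and3P; split.
- by rewrite /= size_cat /=; move: sq => /=; clear; lia.
- move: uq; rewrite /= inE mem_cat !inE !negb_or cat_uniq /= up ap.
  case/and3P=> /andP[-> ->] bq uq; rewrite bq uq (negbTE bp) /= !andbT.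
  by apply/hasPn => z zq; apply: vq; rewrite inE zq orbT.
- rewrite /cedges rcons_cat -cat_rcons walk_edges_cat last_rcons par_cat -ep.
  move: eq; rewrite ec par_cons; congr (~~ (_ (+) _)); apply: eq_par => d.
  by rewrite (perm_mem pq) => hd; apply: es; rewrite l12 hd.
Qed.

End Dec.

(* Proves equality of multisets of edges by counting; the cycles are generalized
   first because simplification would unfold their edge lists. *)
Ltac permc := let a := fresh "a" in apply/permP => a;
  repeat match goal with H : is_true (perm_eq _ _) |- _ => generalize (permP H a); clear H end;
  repeat match goal with |- context [cedges ?c] => generalize (cedges c); intro end;
  rewrite -?cats1 /=; do ?[rewrite !count_cat /=];
  repeat match goal with |- context [nat_of_bool ?b] => generalize (nat_of_bool b); intro end;
  clear; lia.

(** * Pairing the elements of a list by parity *)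

Section Lists.
Variable A : eqType.

Lemma perm_pick (s : seq A) x : x \in s -> exists s', perm_eq s (x :: s').
Proof. by move=> h; exists (rem x s); apply: perm_to_rem. Qed.

Lemma perm_pick2 (s : seq A) x y : x \in s -> y \in s -> x != y ->
  exists s', perm_eq s [:: x, y & s'].
Proof.
move=> xs ys nxy; have [s1 p1] := perm_pick xs.
have : y \in s1 by move: ys; rewrite (perm_mem p1) inE eq_sym (negPf nxy).
case/perm_pick=> s2 p2; exists s2; apply: perm_trans p1 _.
by rewrite perm_cons.
Qed.

Lemma exists_notin (l s : seq A) : uniq s -> size l < size s ->
  exists2 z, z \in s & z \notin l.
Proof.
move=> us ls; apply/hasP; apply: contraLR ls => /hasPn h; rewrite -leqNgt.
by apply: uniq_leq_size => // z /h; rewrite negbK.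
Qed.

Lemma perm_split (l s : seq A) : uniq l -> uniq s -> {subset l <= s} ->
  exists s', [/\ perm_eq s (l ++ s'), uniq s' & forall z, z \in s' = (z \in s) && (z \notin l)].
Proof.
move=> ul us sl; exists [seq z <- s | z \notin l]; split; last 2 first.
- exact: filter_uniq.
- by move=> z; rewrite mem_filter andbC.
apply: uniq_perm => //.
  rewrite cat_uniq ul filter_uniq // andbT; apply/hasPn => z.
  by rewrite mem_filter => /andP[].
move=> z; rewrite mem_cat mem_filter; case: (boolP (z \in l)) => //= zl.
exact: sl.
Qed.

(** Among three elements two have the same value of [f], and in a list of two the even count forces
    equality; so such a list can be exhausted by equal pairs. *)
Lemma pair_ind (f : A -> bool) (P : seq A -> Prop) :
  (forall s1 s2, perm_eq s1 s2 -> P s1 -> P s2) -> P [::] ->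
  (forall x y s, f x = f y -> P s -> P [:: x, y & s]) ->
  forall s, ~~ odd (size s) -> ~~ odd (count f s) -> P s.
Proof.
move=> Pp P0 P2 s; have [n] := ubnP (size s); elim: n s => // n IH.
case=> [|x [|y s]] //= hn hs hf.
have [e|ne] := eqVneq (f x) (f y).
  by apply: P2 => //; apply: IH; move: hn hs hf; rewrite ?e; case: (f y); clear; lia.
case: s hn hs hf => [|z s] /= hn hs hf; first by move: ne hf; case: (f x); case: (f y).
have [e|ne2] := eqVneq (f x) (f z).
  apply: (@Pp [:: x, z, y & s]); first by permc.
  by apply: P2 => //; apply: IH; move: hn hs hf; rewrite /= ?e; case: (f z); clear; lia.
have e : f y = f z by move: ne ne2; case: (f x); case: (f y); case: (f z).
apply: (@Pp [:: y, z, x & s]); first by permc.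
by apply: P2 => //; apply: IH; move: hn hs hf; rewrite /= ?e; case: (f z); clear; lia.
Qed.

(** An element with value [odd (count f s)] exists: an odd count is nonzero, and an even count in a
    list of odd length leaves an element outside [f]. Deleting it gives a list to which [pair_ind]
    applies. *)
Lemma parity_majority (f : A -> bool) s : odd (size s) ->
  exists y s', [/\ perm_eq s (y :: s'), f y = odd (count f s) &
    odd (count f s') = false].
Proof.
move=> os.
have [/hasP[y ys /eqP hy]|/hasPn h] := boolP (has (fun y => f y == odd (count f s)) s).
  have [s' ps] := perm_pick ys; exists y, s'; split=> //.
  by move: hy; rewrite (permP ps) /=; case: (f y); clear; lia.
have : count f s = if odd (count f s) then 0 else size s.
  case e : (odd _); first (apply/eqP; rewrite -leqn0 leqNgt -has_count; apply/hasPn => y /h; rewrite e; by case: (f y)).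
  by apply/eqP; rewrite -all_count; apply/allP => y /h; rewrite e; case: (f y).
by case e : (odd _) => e2; move: e; rewrite e2 ?os.
Qed.

End Lists.

(** * Edges between vertices of $H$ and vertices of $N$ *)

Section Stars.
Variables (T : finType) (sg : pred {set T}).
Implicit Types (x y z n m : T) (p q s X M : seq T).

Definition star x M : seq {set T} := [seq [set x; n] | n <- M].

Definition KK X M : seq {set T} := flatten [seq star x M | x <- X].

(* Between vertices of equal colour tau, the edges to M split into even 4-cycles. *)
Definition tau x M := par sg (star x M).

Lemma KK_cat X1 X2 M : KK (X1 ++ X2) M = KK X1 M ++ KK X2 M.
Proof. by rewrite /KK map_cat flatten_cat. Qed.

Lemma perm_star x M1 M2 : perm_eq M1 M2 -> perm_eq (star x M1) (star x M2).
Proof. exact: perm_map. Qed.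

Lemma perm_KKl X1 X2 M : perm_eq X1 X2 -> perm_eq (KK X1 M) (KK X2 M).
Proof. by move=> h; apply: perm_flatten; apply: perm_map. Qed.

Lemma tauE x M : tau x M = odd (count (fun n => sg [set x; n]) M).
Proof. by rewrite /tau /par count_map. Qed.

Lemma par_KK X M : par sg (KK X M) = odd (count (tau^~ M) X).
Proof. by elim: X => //= x X IH; rewrite par_cat oddD oddb IH. Qed.

Lemma par_KK_cons x X M : par sg (KK (x :: X) M) = tau x M (+) par sg (KK X M).
Proof. exact: par_cat. Qed.

Lemma odd_count_addb (A : eqType) (f g : A -> bool) (s : seq A) :
  odd (count (fun a => f a (+) g a) s) = odd (count f s) (+) odd (count g s).
Proof. by elim: s => //= a s IH; rewrite !oddD !oddb IH; clear; lia. Qed.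

Lemma mem_star x M d z : d \in star x M -> z \in d -> z = x \/ z \in M.
Proof. by case/mapP=> n nM -> /set2P[->|->]; auto. Qed.

Lemma ecyc_path1 n x y p : n \notin x :: p -> xypath x y p -> x != y ->
  par sg (walk_edges x p) = sg [set x; n] (+) sg [set y; n] ->
  ecyc sg (n :: x :: p) /\
  perm_eq (cedges (n :: x :: p)) ([set x; n] :: [set y; n] :: walk_edges x p).
Proof.
move=> np hp nxy e.
have pe : perm_eq (cedges (n :: x :: p)) ([set x; n] :: [set y; n] :: walk_edges x p).
  by rewrite cedges_cons /= (xypath_last hp) (setUC [set n]); permc.
split=> //; apply/and3P; split.
- by case: p {np e pe} hp => //= /xypath_last /= xy; rewrite xy eqxx in nxy.
- by rewrite cons_uniq np (xypath_uniq hp).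
- by rewrite (par_perm _ pe) !parE e; clear; lia.
Qed.

(** The cycle runs from [m] along [x]..[y] to [n], then along [x']..[y'] back to [m]. One of the
    paths may be trivial, so that a single vertex takes its place. *)
Lemma ecyc_path2 n m x y p x' y' p' : n != m ->
  n \notin x :: p -> n \notin x' :: p' -> m \notin x :: p -> m \notin x' :: p' ->
  xypath x y p -> xypath x' y' p' -> (forall z, z \in x :: p -> z \notin x' :: p') ->
  par sg (walk_edges x p) (+) par sg (walk_edges x' p') =
    sg [set x; m] (+) sg [set y; n] (+) sg [set x'; n] (+) sg [set y'; m] ->
  exists2 c, ecyc sg c & perm_eq (cedges c) ([set x; m] :: [set y; n] ::
    [set x'; n] :: [set y'; m] :: walk_edges x p ++ walk_edges x' p').
Proof.
move=> nm np np' mp mp' hp hp' dj e; exists (m :: x :: p ++ n :: x' :: p').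
apply/and3P; split.
- by rewrite /= size_cat /=; clear; lia.
- have hd : ~~ has (mem (x :: p)) (x' :: p').
    by apply/hasPn => z zp'; apply: contraL zp' => zp; apply: dj.
  rewrite -[x :: p ++ _]/((x :: p) ++ n :: x' :: p') cons_uniq cat_uniq (xypath_uniq hp).
  rewrite cons_uniq (xypath_uniq hp') np' mem_cat negb_or mp in_cons negb_or mp' eq_sym nm.
  by rewrite (_ : has _ (n :: _) = (n \in x :: p) || has (mem (x :: p)) (x' :: p')) // negb_or np hd.
- rewrite cedges_cons /= walk_edges_cat (xypath_last hp) /= last_cat /= (xypath_last hp').
  by rewrite -cats1 !parE (setUC [set m]) (setUC [set n]); move: e; clear; lia.
- rewrite cedges_cons /= walk_edges_cat (xypath_last hp) /= last_cat /= (xypath_last hp').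
  by rewrite (setUC [set m]) (setUC [set n]); permc.
Qed.

(** Since the colours agree, [sg xn] and [sg yn] differ for evenly many [n] in [M]. Two vertices
    [n], [m] that agree in this respect give an even 4-cycle, and [pair_ind] pairs all of [M] in
    this way. *)
Lemma kdec2 x y M : uniq M -> ~~ odd (size M) -> x \notin M -> y \notin M ->
  x != y -> tau x M = tau y M -> dec sg (KK [:: x; y] M).
Proof.
move=> uM eM xM yM nxy e.
pose f n := sg [set x; n] (+) sg [set y; n].
have : uniq M && (x \notin M) && (y \notin M) by rewrite uM xM.
have : ~~ odd (count f M) by rewrite odd_count_addb -!tauE e addbb.
move: eM => eM eC; move: M eM eC {uM xM yM e}; apply: pair_ind.
- move=> s1 s2 h IH; rewrite -(perm_uniq h) -!(perm_mem h) => /IH; apply: dec_perm.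
  by rewrite /KK /= !cats0; apply: perm_cat; apply: perm_star.
- by move=> _; apply: dec_nil.
move=> n m s enm IH; rewrite /= !inE !negb_or => /andP[/andP[]].
case/andP=> /andP[nm ns] /andP[ms us] /andP[xn /andP[xm xs]] /andP[yn /andP[ym ys]].
have ds : dec sg (KK [:: x; y] s) by apply: IH; rewrite us xs.
have := @ecyc_path2 n m x x [::] y y [::] nm.
rewrite !inE ![n == _]eq_sym ![m == _]eq_sym => /(_ xn yn xm ym).
rewrite /xypath /= eqxx => /(_ isT); rewrite eqxx => /(_ isT).
case=> [z||c hc pc]; first by rewrite !inE => /eqP->.
  by move: enm; rewrite /f /par /=; clear; lia.
apply: (@dec_perm _ _ (cedges c ++ KK [:: x; y] s)).
  by move: pc; rewrite /KK /star /= => pc; rewrite !cats0; permc.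
by apply: dec_cat => //; apply: dec_ecyc.
Qed.

Lemma kdec X M : uniq X -> uniq M -> ~~ odd (size X) -> ~~ odd (size M) ->
  (forall x, x \in X -> x \notin M) -> par sg (KK X M) = false -> dec sg (KK X M).
Proof.
move=> uX uM eX eM dj; rewrite par_KK => /negbT e.
have : uniq X && all (predC (mem M)) X by rewrite uX; apply/allP.
move: X eX e {uX dj}; apply: pair_ind.
- move=> s1 s2 h IH; rewrite -(perm_uniq h) -(perm_all _ h) => /IH.
  by apply: dec_perm; apply: perm_KKl.
- by move=> _; apply: dec_nil.
move=> x y s e IH /=; rewrite inE negb_or => /andP[/andP[/andP[nxy _]]].
case/andP=> _ us /and3P[xM yM aM].
rewrite -[x :: y :: s]/([:: x; y] ++ s) KK_cat; apply: dec_cat; last by apply: IH; rewrite us.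
exact: kdec2.
Qed.

End Stars.

(** * Odd cactuses *)

Section Cactus.
Variables (T : finType) (sg : pred {set T}).
Implicit Types (x y z w v : T) (c s p q : seq T) (F : seq (seq T)).

Definition ocyc c := [&& 2 < size c, uniq c & par sg (cedges c)].

Lemma ocyc_arcs c x y : ocyc c -> x \in c -> y \in c -> x != y ->
  exists p q, arcs c x y p q.
Proof. by case/and3P=> _ uc _; apply: arcs_exist. Qed.

Lemma arcs_par c x y p q : ocyc c -> arcs c x y p q ->
  par sg (walk_edges x p) = ~~ par sg (walk_edges x q).
Proof.
case/and3P=> _ _ oc h; move: oc; rewrite (par_perm _ (arcs_perm h)) par_cat.
by case: (par _ _); case: (par _ _).
Qed.

Definition fedges F : seq {set T} := flatten [seq cedges c | c <- F].

(* Without even cycles in the union, the cycles of F share at most one vertex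
   pairwise and are the blocks of a cactus. *)
Definition cactus F := [/\ all ocyc F, uniq (fedges F) &
  forall c, ecyc sg c -> ~ {subset cedges c <= fedges F}].

Lemma fedges_cat F1 F2 : fedges (F1 ++ F2) = fedges F1 ++ fedges F2.
Proof. by rewrite /fedges map_cat flatten_cat. Qed.

Lemma perm_fedges F1 F2 : perm_eq F1 F2 -> perm_eq (fedges F1) (fedges F2).
Proof. by move=> h; apply: perm_flatten; apply: perm_map. Qed.

Lemma mem_fedges F c d : c \in F -> d \in cedges c -> d \in fedges F.
Proof. by move=> cF dc; apply/flattenP; exists (cedges c) => //; apply: map_f. Qed.

Lemma cactus_perm F1 F2 : perm_eq F1 F2 -> cactus F1 -> cactus F2.
Proof.
move=> h [h1 h2 h3]; split.
- by rewrite -(perm_all _ h).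
- by rewrite -(perm_uniq (perm_fedges h)).
- by move=> c /h3 nc sc; apply: nc => d /sc; rewrite (perm_mem (perm_fedges h)).
Qed.

Lemma cactus_catl F1 F2 : cactus (F1 ++ F2) -> cactus F1.
Proof.
rewrite /cactus all_cat fedges_cat cat_uniq => -[/andP[h1 _] /andP[h2 _] h3].
by split=> // c /h3 nc sc; apply: nc => d /sc; rewrite mem_cat => ->.
Qed.

Lemma cactus_cons c F : cactus (c :: F) -> cactus F.
Proof.
move=> h; apply: (@cactus_catl F [:: c]); apply: cactus_perm h.
by rewrite -cat1s perm_catC.
Qed.

Lemma cactus_filter a F : cactus F -> cactus (filter a F).
Proof.
move=> h; apply: (@cactus_catl _ (filter (predC a) F)); apply: cactus_perm h.
by rewrite perm_sym perm_filterC.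
Qed.

Lemma ocyc_vertex c : ocyc c -> exists x, x \in c.
Proof. by case: c => // x c _; exists x; rewrite mem_head. Qed.

Lemma cactus_uniq F : cactus F -> uniq F.
Proof.
elim: F => // c F IH cF; rewrite /= (IH (cactus_cons cF)) andbT.
case: cF => /andP[/ocyc_vertex[x xc] _] + _.
have [d dc _] := cedges_vertex xc.
rewrite /fedges /= cat_uniq => /and3P[_ /hasPn h _]; apply/negP => cF.
by have := h d (mem_fedges cF dc); rewrite /= dc.
Qed.

(** [connect (coh F)] expresses connectivity in the union of the cycles without walks along
    edges. *)
Definition coh F x y := has (fun c => (x \in c) && (y \in c)) F.

Lemma walk_path (E : seq {set T}) x s : {subset walk_edges x s <= E} ->
  path (fun a b => [set a; b] \in E) x s.
Proof.
elim: s x => //= y s IH x h; rewrite h ?mem_head //=.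
by apply: IH => d ds; apply: h; rewrite inE ds orbT.
Qed.

Lemma path_walk (E : seq {set T}) x s : path (fun a b => [set a; b] \in E) x s ->
  {subset walk_edges x s <= E}.
Proof.
elim: s x => //= y s IH x /andP[h /IH hs] d; rewrite inE.
by case/predU1P=> [->|/hs].
Qed.

Lemma connect_coh F x y : all ocyc F -> connect (coh F) x y ->
  connect (fun a b => [set a; b] \in fedges F) x y.
Proof.
move=> /allP oF; apply: connect_sub => {x y} x y /hasP[c cF /andP[xc yc]].
have [->|nxy] := eqVneq x y; first exact: connect0.
have [p [q h]] := ocyc_arcs (oF c cF) xc yc nxy.
apply/connectP; exists p; last by rewrite (xypath_last (arcs1 h)).
apply: walk_path => d dp; apply: mem_fedges cF _.
by rewrite (perm_mem (arcs_perm h)) mem_cat dp.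
Qed.

(** Otherwise edges outside [c] form a path between two vertices of [c]. The arcs of [c] between
    them have opposite parities, so one of them closes an even cycle with the path. *)
Lemma cactus_sep c F (p q : T) : cactus (c :: F) -> p \in c -> q \in c ->
  connect (coh F) p q -> p = q.
Proof.
move=> [/= /andP[oc oF] uF nF] pc qc /(connect_coh oF)/connectP[s0 hs0 eq].
apply/eqP; apply: contraT => npq; move: eq npq qc.
case/shortenP: hs0 => s hs us _ -> nlast lastc.
have hc : has (mem c) s.
  apply/hasP; exists (last p s) => //.
  by case: s nlast {hs us lastc} => [|a s] /=; rewrite ?eqxx // => _; apply: mem_last.
(* Cutting the path at its first return [z] to [c] keeps its interior off [c]. *)
case/split_find: hc hs us {nlast lastc} => z s1 s2 zc hs1.
rewrite cat_path -cat_cons cat_uniq => /andP[hs _] /and3P[us _ _].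
have npz : p != z by move: us; rewrite /= mem_rcons inE negb_or => /andP[/andP[]].
have h1 : xypath p z (rcons s1 z) by rewrite /xypath last_rcons eqxx.
have [P [Q h]] := ocyc_arcs oc pc zc npz.
wlog e : P Q h / par sg (walk_edges p (rcons s1 z)) = par sg (walk_edges p P) => [H|].
  have [e|ne] := eqVneq (par sg (walk_edges p (rcons s1 z))) (par sg (walk_edges p P)).
    exact: H h e.
  apply: (H Q P); first exact: arcsC.
  by move: ne; rewrite (arcs_par oc h); case: (par _ _); case: (par _ _).
have s1c t : t \in s1 -> t \notin c by apply/hasPn.
have sub1 := path_walk hs.
case: (h) => hP _ pe sP _ _ _ _.
have [||c' [u' s' pe' _]] := cyc_of_paths h1 hP npz.
- move=> t; rewrite mem_rcons inE => /predU1P[//|/s1c tc tP].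
  by move: tc; rewrite sP // inE tP orbT.
(* Path and arc fail to form a cycle only if both are the edge [pz], which would then occur in [c]
   and in [F]. *)
- rewrite size_rcons; case: P hP pe {h e sP} => [|a [|b P]] hP pe; last by clear; case: (size s1) => /=; lia.
    by move/xypath_last: hP npz => /= ->; rewrite eqxx.
  move: (xypath_last hP) => /= az; subst a.
  case: s1 {hs1 us h1 s1c} hs sub1 => [|? ?] /= hs sub1; last by clear; lia.
  have pF : [set p; z] \in fedges F by apply: sub1; rewrite mem_head.
  move: uF; rewrite /fedges /= cat_uniq => /and3P[_ /hasPn /(_ _ pF)] /=.
  by rewrite (perm_mem pe) mem_head.
exfalso; apply: (nF c'); first by rewrite /ecyc s' u' (par_perm _ pe') par_cat e addbb.
move=> d; rewrite (perm_mem pe') mem_cat /fedges /= mem_cat => /orP[/sub1 ->|dP].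
  by rewrite orbT.
by rewrite (perm_mem pe) mem_cat dP.
Qed.

Lemma coh1 F c x y : c \in F -> x \in c -> y \in c -> connect (coh F) x y.
Proof. by move=> cF xc yc; apply: connect1; apply/hasP; exists c; rewrite ?xc. Qed.

Lemma cactus_share F c d x y : cactus F -> c \in F -> d \in F -> d != c ->
  x \in c -> x \in d -> y \in c -> y \in d -> x = y.
Proof.
move=> cF hc hd dc xc xd yc yd.
apply: (cactus_sep (cactus_perm (perm_to_rem hc) cF)) => //.
apply: (@coh1 _ d) => //; have := hd.
by rewrite (perm_mem (perm_to_rem hc)) inE (negPf dc).
Qed.

(** If [c] is disjoint from all other cycles, [v] may be any of its vertices. *)
Definition leaf F c v := [/\ c \in F, v \in c &
  forall d, d \in F -> d != c -> forall z, z \in c -> z \in d -> z = v].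

(** If [c0] is not a leaf, it shares at least two vertices with other cycles, and by [cactus_sep]
    one of two such vertices, [u], is not connected to [w] without [c0]. The component of [u] avoids
    [w] and meets [c0] only in [u]. By induction it has a leaf avoiding [u], unless all its cycles
    pass through [u], and then each of them is a leaf. *)
Lemma leaf_avoiding F c0 w : cactus F -> c0 \in F -> w \notin c0 ->
  exists c v, leaf F c v /\ w \notin c.
Proof.
have [n] := ubnP (size F); elim: n F c0 w => // n IH F c0 w sF cF c0F wc0.
pose F' := rem c0 F; have pF : perm_eq F (c0 :: F') := perm_to_rem c0F.
have sep x y : x \in c0 -> y \in c0 -> connect (coh F') x y -> x = y.
  exact: (cactus_sep (cactus_perm pF cF)).
have inF' d : d \in F -> d != c0 -> d \in F'.
  by rewrite (perm_mem pF) inE => /orP[->|].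
have cF' : cactus F' by apply: cactus_cons (cactus_perm pF cF).
have uF' : c0 \notin F' by have := cactus_uniq cF; rewrite (perm_uniq pF) => /andP[].
have F'F d : d \in F' -> d \in F by rewrite (perm_mem pF) inE orbC => ->.
pose shared x := has (fun d => x \in d) F'.
have [/hasP[u1 u1c sh1]|/hasPn h] := boolP (has shared c0); last first.
  have [|x xc0] := @ocyc_vertex c0; first by case: cF => /allP oF _ _; apply: oF.
  exists c0, x; split=> //; split=> // d dF dc z zc zd.
  by move: (h z zc); rewrite /shared; case/negP; apply/hasP; exists d => //; apply: inF'.
have [/hasP[u2 u2c /andP[u21 sh2]]|/hasPn h] := boolP (has (fun x => (x != u1) && shared x) c0); last first.
  exists c0, u1; split=> //; split=> // d dF dc z zc zd.
  apply/eqP; move: (h z zc); rewrite negb_and negbK => /orP[//|].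
  by case/negP; apply/hasP; exists d => //; apply: inF'.
have csym : connect_sym (coh F').
  by apply: sym_connect_sym => x y; apply: eq_has => d; rewrite andbC.
have [u [uc shu uw]] : exists u, [/\ u \in c0, shared u & ~~ connect (coh F') u w].
  have [h|h] := boolP (connect (coh F') u1 w); last by exists u1.
  exists u2; split=> //; apply: contra u21 => h2; apply/eqP.
  by apply: sep => //; apply: connect_trans h2 _; rewrite csym.
pose F1 := [seq d <- F' | has (connect (coh F') u) d].
have mF1 d : d \in F1 -> d \in F' /\ forall z, z \in d -> connect (coh F') u z.
  rewrite mem_filter => /andP[/hasP[y yd uy] dF']; split=> // z zd.
  by apply: connect_trans uy _; apply: coh1 dF' yd zd.
have inF1 d z : d \in F' -> z \in d -> connect (coh F') u z -> d \in F1.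
  by move=> dF' zd uz; rewrite mem_filter dF' andbT; apply/hasP; exists z.
have c0F1 d z : d \in F1 -> z \in d -> z \in c0 -> z = u.
  by move=> /mF1[_ h] zd zc; apply: sep => //; rewrite csym; apply: h.
have cF1 : cactus F1 by apply: cactus_filter.
(* A leaf of the component is a leaf of [F]: only [c0] can meet it in addition, and only in [u]. *)
have key c v : leaf F1 c v -> (u \in c -> u = v) -> exists c v, leaf F c v /\ w \notin c.
  move=> [cF1' vc lc] uv; have [cF0 cc] := mF1 _ cF1'; exists c, v; split; last first.
    by apply: contra uw => /cc.
  split; [exact: F'F|by []|].
  move=> d dF dc z zc zd; have [ed|nd] := eqVneq d c0.
    by rewrite ed in zd; have zu := c0F1 c z cF1' zc zd; rewrite zu; apply: uv; rewrite -zu.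
  by apply: (lc d) => //; apply: (inF1 d z) => //; [apply: inF'|apply: cc].
have [/hasP[d dF1 ud]|/hasPn h] := boolP (has (fun d => u \notin d) F1).
  have [|c [v [lf uc']]] := IH F1 d u _ cF1 dF1 ud.
    have : size F1 <= size F' by rewrite size_filter count_size.
    by move: sF; rewrite (perm_size pF) /=; clear; lia.
  by apply: (key c v) => //; rewrite (negPf uc').
have /hasP[d dF' ud] := shu.
have dF1 := inF1 d u dF' ud (connect0 _ _).
apply: (key d u) => //; split=> // e eF1 ed z zd ze.
have [eF' _] := mF1 _ eF1.
apply: (cactus_share cF1 dF1 eF1 ed) => //.
by move: (h e eF1); rewrite negbK.
Qed.

(** A first leaf meets other cycles only in its vertex [v], so a second leaf that avoids [v] is
    disjoint from it. *)
Lemma two_leaves F : cactus F -> 1 < size F ->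
  (exists c1 c2 v1 v2, [/\ leaf F c1 v1, leaf F c2 v2, c2 != c1 & forall z, z \in c1 -> z \notin c2])
  \/ exists v, forall c, c \in F -> v \in c.
Proof.
move=> cF sF.
have [c [v lf]] : exists c v, leaf F c v.
  (* To start, a vertex [w] off some cycle [e] is needed; another cycle [d] has one because the two
     share at most one vertex. *)
  case: F cF sF => [|d [|e F]] // cF _.
  have /andP[/and3P[d3 ud _] _] := let: And3 h _ _ := cF in h.
  have ed : e != d by have := cactus_uniq cF; rewrite /= inE negb_or eq_sym => /andP[/andP[]].
  have [w wd we] : exists2 w, w \in d & w \notin e.
    apply/hasP; apply: contraLR d3 => /hasPn h; case: d ud cF ed h => [|a [|b d]] //.
    move=> /= /andP[+ _] cF ed h.
    have ha := h a (mem_head _ _); have hb : b \in e by move: (h b); rewrite !inE eqxx orbT => /(_ isT); rewrite negbK.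
    rewrite negbK in ha; rewrite inE negb_or => /andP[/eqP[]].
    by apply: (cactus_share cF _ _ ed) => //; rewrite !inE eqxx ?orbT.
  have [|c [v [lf _]]] := leaf_avoiding cF _ we; first by rewrite !inE eqxx orbT.
  by exists c, v.
have [/hasP[d dF vd]|/hasPn h] := boolP (has (fun d => v \notin d) F); last first.
  by right; exists v => d /h; rewrite negbK.
have [c2 [v2 [lf2 vc2]]] := leaf_avoiding cF dF vd.
left.
have [/hasP[z0 z0c z0d]|/hasPn dj] := boolP (has (fun z => z \in c2) c).
  have [e|ne] := eqVneq c2 c; last first.
    case: lf => _ _ /(_ c2) h; case: lf2 => c2F _ _.
    by move: vc2; rewrite -(h c2F ne z0 z0c z0d) z0d.
  by case: lf => _ vc _; move: vc2; rewrite e vc.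
exists c, c2, v, v2; split=> //.
by apply: contraNneq vc2 => ->; case: lf.
Qed.

End Cactus.

(** * Recombining odd cycles with the edges to N *)

Section Gadgets.
Variables (T : finType) (sg : pred {set T}) (N : seq T) (Hs : pred T).
Variable LG : seq {set T}.
Hypothesis uN : uniq N.
Hypothesis eN : ~~ odd (size N).
Hypothesis NH : forall n, n \in N -> ~~ Hs n.
Hypothesis N0 : N != [::].
Implicit Types (x y z n m s t : T) (p q S X M : seq T) (E R : seq {set T}).

Local Notation tau x := (tau sg x N).

Lemma HsN x : Hs x -> x \notin N.
Proof. by move=> hx; apply/negP => /NH; rewrite hx. Qed.

Lemma notin_path n x p : n \in N -> all Hs (x :: p) -> n \notin x :: p.
Proof. by move=> nN /allP h; apply/negP => /h; apply/negP/NH. Qed.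

(** [parity_majority] picks [m] so that the rest [N'] can be paired off; the value at [m] is thereby
    determined by the value at [n]. *)
Lemma partner n (f : T -> bool) : n \in N -> exists m N',
  [/\ perm_eq N [:: n, m & N'], f n (+) f m = odd (count f N) & odd (count f N') = false].
Proof.
move=> nN; have [N1 p1] := perm_pick nN.
have o1 : odd (size N1) by move: eN; rewrite (perm_size p1) /= negbK.
have [m [N' [p2 e2 e3]]] := parity_majority f o1; exists m, N'; split=> //.
  by apply: perm_trans p1 _; rewrite perm_cons.
by rewrite e2 (permP p1) /= oddD oddb.
Qed.

Lemma partner_uniq n m N' : perm_eq N [:: n, m & N'] ->
  [/\ n != m, m \in N & n \in N] /\
  [/\ uniq N', ~~ odd (size N'), {subset N' <= N}, n \notin N' & m \notin N'].
Proof.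
move=> h; have := uN; rewrite (perm_uniq h) /= !inE negb_or.
case/and3P=> /andP[nm nN'] mN' uN'.
split; split=> //; rewrite ?(perm_mem h) ?inE ?eqxx ?orbT //.
- by move: eN; rewrite (perm_size h) /= !negbK.
- by move=> z zN'; rewrite (perm_mem h) !inE zN' !orbT.
Qed.

Lemma perm_star2 x n m N' : perm_eq N [:: n, m & N'] ->
  perm_eq (star x N) ([set x; n] :: [set x; m] :: star x N').
Proof. exact: (@perm_star _ x N [:: n, m & N']). Qed.

Lemma dec_KK X M : uniq X -> all Hs X -> ~~ odd (size X) ->
  uniq M -> {subset M <= N} -> ~~ odd (size M) ->
  par sg (KK X M) = false -> dec sg (KK X M).
Proof.
move=> uX /allP hX eX uM sM eM h; apply: kdec => // x /hX/HsN.
by apply: contra => /sM.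
Qed.

(* An odd cycle through x and y is a link with e = true; two odd cycles sharing
   a vertex w form one with e = false, for x and y on either side of w. *)
Definition link E x y (e : bool) (V : pred T) := forall b, exists p q,
  [/\ xypath x y p, xypath x y q, perm_eq E (walk_edges x p ++ walk_edges x q),
      par sg (walk_edges x p) = b & par sg (walk_edges x q) = b (+) e]
  /\ all V (x :: p) && all V (x :: q).

(** One path is closed through [n], the other through its partner [m]. The link supplies the parity
    wanted at [n]; the parity at [m] is then right because [e] is the difference of the colours. The
    rest of [N] goes into 4-cycles. *)
Lemma dec_close E x y e : link E x y e Hs -> x != y ->
  e = tau x (+) tau y -> dec sg (KK [:: x; y] N ++ E).
Proof.
move=> hl nxy he; pose f n := sg [set x; n] (+) sg [set y; n].
have [n nN] : exists n, n \in N by case: N N0 => // n s; exists n; rewrite mem_head.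
have [m [N' [pN fnm fN']]] := partner f nN.
have [[nm mN _] [uN' eN' sN' _ _]] := partner_uniq pN.
have [p [q [[hp hq pE pp pq] /andP[Vp Vq]]]] := hl (f n).
have [c1 d1] := ecyc_path1 (notin_path nN Vp) hp nxy pp.
have {pq}pq : par sg (walk_edges x q) = sg [set x; m] (+) sg [set y; m].
  by rewrite pq he -/(f m) !tauE -odd_count_addb -fnm addKb.
have [c2 d2] := ecyc_path1 (notin_path mN Vq) hq nxy pq.
have hx : Hs x by case/andP: Vp.
have hy : Hs y by apply: (allP Vp); apply: xypath_mem hp.
have dK : dec sg (KK [:: x; y] N').
  apply: dec_KK => //=; rewrite ?inE ?nxy ?hx ?hy //.
  by rewrite par_KK /= addn0 oddD !oddb !tauE -odd_count_addb.
apply: dec_perm (dec_cat (dec_ecyc c1) (dec_cat (dec_ecyc c2) dK)).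
move: (perm_star2 x pN) (perm_star2 y pN) => h1 h2.
by rewrite /KK; clear -d1 d2 pE h1 h2; permc.
Qed.

(* The paths p, p' close up to one cycle through two vertices of N, and q, q' to
   another; only the paths of the same pair have to be disjoint. *)
Definition dlink E x y x' y' (e : bool) := forall b, exists p q p' q',
  [/\ [/\ xypath x y p, xypath x y q, xypath x' y' p' & xypath x' y' q'],
      perm_eq E ((walk_edges x p ++ walk_edges x q) ++ walk_edges x' p' ++ walk_edges x' q'),
      par sg (walk_edges x p) (+) par sg (walk_edges x' p') = b,
      par sg (walk_edges x q) (+) par sg (walk_edges x' q') = b (+) e &
      [/\ forall z, z \in x :: p -> z \notin x' :: p',
          forall z, z \in x :: q -> z \notin x' :: q' &
          [&& all Hs (x :: p), all Hs (x :: q), all Hs (x' :: p') & all Hs (x' :: q')]]].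

(** Two cycles through [n] and [m] are formed with the roles of [n] and [m] exchanged, so each of
    the four vertices gives its edge to [n] to one cycle and its edge to [m] to the other. The
    second parity is correct by the colours. *)
Lemma dec_join E x y x' y' e : dlink E x y x' y' e -> uniq [:: x; y; x'; y'] ->
  e = tau x (+) tau y (+) tau x' (+) tau y' ->
  dec sg (KK [:: x; y; x'; y'] N ++ E).
Proof.
move=> hl u4 he.
pose f n := (sg [set x; n] (+) sg [set y; n]) (+) (sg [set x'; n] (+) sg [set y'; n]).
have [n nN] : exists n, n \in N by case: N N0 => // n s; exists n; rewrite mem_head.
have [m [N' [pN fnm fN']]] := partner f nN.
have [[nm mN _] [uN' eN' sN' _ _]] := partner_uniq pN.
pose b := sg [set x; m] (+) sg [set y; n] (+) sg [set x'; n] (+) sg [set y'; m].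
have [p [q [p' [q' [[hp hq hp' hq'] pE pp pq [dp dq /and4P[Vp Vq Vp' Vq']]]]]]] := hl b.
have [c1 h1 d1] := ecyc_path2 nm (notin_path nN Vp) (notin_path nN Vp')
  (notin_path mN Vp) (notin_path mN Vp') hp hp' dp pp.
have fe : odd (count f N) = e.
  by rewrite !odd_count_addb -!tauE he; clear; lia.
have [c2 h2 d2] : exists2 c, ecyc sg c & perm_eq (cedges c) ([set x; n] :: [set y; m] ::
    [set x'; m] :: [set y'; n] :: walk_edges x q ++ walk_edges x' q').
  apply: ecyc_path2; rewrite ?notin_path // 1?eq_sym // pq.
  by rewrite -fe -fnm /b /f; clear; lia.
have hx : Hs x by case/andP: Vp.
have hy : Hs y by apply: (allP Vp); apply: xypath_mem hp.
have hx' : Hs x' by case/andP: Vp'.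
have hy' : Hs y' by apply: (allP Vp'); apply: xypath_mem hp'.
have dK : dec sg (KK [:: x; y; x'; y'] N').
  apply: dec_KK => //; first by rewrite /= hx hy hx' hy'.
  rewrite par_KK -fN' !odd_count_addb -!tauE /= !oddD !oddb; clear; lia.
apply: dec_perm (dec_cat (dec_ecyc h1) (dec_cat (dec_ecyc h2) dK)).
move: (perm_star2 x pN) (perm_star2 y pN) (perm_star2 x' pN) (perm_star2 y' pN).
by rewrite /KK; clear -d1 d2 pE => h1 h2 h3 h4; permc.
Qed.

(** * Positions from which a copy of $G$ completes the decomposition *)

Hypothesis LGH : forall d, d \in LG -> forall z, z \in d -> ~~ Hs z.
(** This must hold for every signature: it is also applied to signatures that differ from [sg] on
    one edge. *)
Hypothesis BB : forall sg' a b, Hs a -> Hs b -> a != b ->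
  par sg' (LG ++ KK [:: a; b] N) = false -> dec sg' (LG ++ KK [:: a; b] N).

(* S and R are the vertices and the edges of H that are not yet used by even
   cycles; two vertices of S have to be left for the copy of G. *)
Definition win S R :=
  par sg (LG ++ KK S N ++ R) = false -> dec sg (LG ++ KK S N ++ R).

Lemma win_perm S1 S2 R1 R2 : perm_eq S1 S2 -> perm_eq R1 R2 -> win S1 R1 -> win S2 R2.
Proof.
move=> hS hR h.
have pe : perm_eq (LG ++ KK S1 N ++ R1) (LG ++ KK S2 N ++ R2).
  by rewrite perm_cat2l; apply: perm_cat => //; apply: perm_KKl.
by rewrite /win -(par_perm sg pe) => /h; apply: dec_perm.
Qed.

Lemma win_elim S1 S2 R1 R2 : dec sg (KK S1 N ++ R1) -> win S2 R2 ->
  win (S1 ++ S2) (R1 ++ R2).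
Proof.
move=> d1 h2.
have pe : perm_eq ((KK S1 N ++ R1) ++ (LG ++ KK S2 N ++ R2))
    (LG ++ KK (S1 ++ S2) N ++ R1 ++ R2).
  by rewrite KK_cat; permc.
rewrite /win -(par_perm sg pe) par_cat (dec_par d1) => /h2 d2.
exact: dec_perm pe (dec_cat d1 d2).
Qed.

(** The removed part is decomposable, hence even, so the copy of $G$ on [a] and [b] inherits even
    parity from the total. *)
Lemma win_base a b S R : Hs a -> Hs b -> a != b -> dec sg (KK S N ++ R) ->
  win [:: a, b & S] R.
Proof.
move=> ha hb nab d.
have pe : perm_eq ((KK S N ++ R) ++ (LG ++ KK [:: a; b] N))
    (LG ++ KK [:: a, b & S] N ++ R).
  by rewrite -[a :: b :: S]/([:: a; b] ++ S) KK_cat; permc.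
rewrite /win -(par_perm sg pe) par_cat (dec_par d) => /(BB ha hb nab).
by move=> d2; exact: dec_perm pe (dec_cat d d2).
Qed.

(* The vertices x and t play the parts of the two twins, but the edge from x
   to n is replaced by the path that follows p and then uses the edge yn. *)
Lemma virtual_win x y n t p N1 : xypath x y p -> all Hs (x :: p) -> Hs t ->
  t \notin x :: p -> perm_eq N (n :: N1) ->
  par sg (LG ++ star x N1 ++ [set y; n] :: walk_edges x p ++ star t N) = false ->
  dec sg (LG ++ star x N1 ++ [set y; n] :: walk_edges x p ++ star t N).
Proof.
move=> hp Vp ht tp pN e.
have hx : Hs x by case/andP: Vp.
have nN : n \in N by rewrite (perm_mem pN) mem_head.
have nN1 : n \notin N1 by have := uN; rewrite (perm_uniq pN) => /andP[].
have sN1 z : z \in N1 -> z \in N by move=> h; rewrite (perm_mem pN) inE h orbT.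
have xt : x != t by apply: contraNneq tp => ->; rewrite mem_head.
have xn : x != n by apply: contraTneq nN => <-; apply: HsN.
pose v := walk_edges x (rcons p n).
(* The replaced edge [xn] receives the parity of the path that stands in for it, so the altered copy
   has even parity too. *)
pose sg' d := if d == [set x; n] then par sg v else sg d.
have pv : perm_eq v ([set y; n] :: walk_edges x p).
  by rewrite /v walk_edges_rcons (xypath_last hp); permc.
pose l := LG ++ star x N1 ++ star t N.
(* The inner vertices of the path lie in $H$ and differ from [x] and [t], so no other edge of the
   copy touches them. *)
have inl d : d \in l -> (forall z, z \in d -> z \notin p) /\ d != [set x; n].
  rewrite !mem_cat => /or3P[dl|dl|dl]; split.
  - by move=> z /(LGH dl) hz; apply: contra hz => /(mem_behead (s := x :: p)) /(allP Vp).
  - by apply: contraTneq dl => ->; apply/negP => /LGH /(_ x); rewrite !inE eqxx hx => /(_ isT).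
  - move=> z /(mem_star dl) [->|/sN1 zN]; first by case/andP: (xypath_uniq hp).
    by have := notin_path zN Vp; rewrite inE negb_or => /andP[].
  - case/mapP: dl => k kN1 ->; apply: contraNneq nN1 => /setP /(_ n).
    rewrite !inE eqxx orbT eq_sym (negPf xn) /= => /eqP->; exact: kN1.
  - move=> z /(mem_star dl) [->|zN]; first by move: tp; rewrite inE negb_or => /andP[].
    by have := notin_path zN Vp; rewrite inE negb_or => /andP[].
  - case/mapP: dl => k kN ->; apply/eqP => /setP /(_ x).
    rewrite !inE eqxx (negPf xt) /= => /eqP xk; by move: (HsN hx); rewrite xk kN.
have es : {in l, sg' =1 sg} by move=> d /inl[_ /negPf h]; rewrite /sg' h.
have pl : perm_eq ([set x; n] :: l) (LG ++ KK [:: x; t] N).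
  have := perm_star x pN; rewrite /l /KK /= cats0 => h; clear -h; permc.
have pg : perm_eq (v ++ l) (LG ++ star x N1 ++ [set y; n] :: walk_edges x p ++ star t N).
  by rewrite /l; clear -pv; permc.
have eg : par sg' (LG ++ KK [:: x; t] N) = false.
  rewrite -(par_perm _ pl) par_cons (eq_par es) /sg' eqxx -e -(par_perm _ pg).
  by rewrite par_cat.
apply: dec_perm pg _.
have := dec_perm _ (BB hx ht xt eg); move=> /(_ ([set x; n] :: l)).
rewrite perm_sym => /(_ pl) d.
apply: (dec_subst d) => //.
- by case/andP: (xypath_uniq hp).
- by case/andP: (xypath_uniq hp).
- by have := notin_path nN Vp; rewrite inE negb_or => /andP[].
- by move=> ? /inl[].
- by rewrite /sg' eqxx.
Qed.

(** The even cycle goes from [n] to [x], along [q] to [y], then over [m] and [s] back to [n]. It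
    uses up [xn], so the copy of $G$ on [x] and [t] takes the detour along [p] and [yn] instead; the
    other edges at [y] and [s] form 4-cycles. Note that [s] may lie on [p] and [t] on [q]. *)
Lemma win_step x y s t p q S R n : xypath x y p -> xypath x y q -> x != y ->
  all Hs (x :: p) -> all Hs (x :: q) -> Hs s -> Hs t ->
  s \notin x :: q -> t \notin x :: p -> n \in N ->
  par sg (walk_edges x q) =
    sg [set x; n] (+) sg [set y; n] (+) tau y (+) tau s ->
  dec sg (KK S N ++ R) ->
  win [:: x, y, s, t & S] (walk_edges x p ++ walk_edges x q ++ R).
Proof.
move=> hp hq nxy Vp Vq hs ht sq tp nN e dr.
pose f n := sg [set y; n] (+) sg [set s; n].
have [m [N' [pN fnm fN']]] := partner f nN.
have [[nm mN _] [uN' eN' sN' nN' mN']] := partner_uniq pN.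
have hy : Hs y by apply: (allP Vq); apply: xypath_mem hq.
have ys : y != s by apply: contraNneq sq => <-; apply: xypath_mem hq.
have [c h1 d1] : exists2 c, ecyc sg c & perm_eq (cedges c) ([set x; n] :: [set y; m] ::
    [set s; m] :: [set s; n] :: walk_edges x q ++ walk_edges s [::]).
  apply: ecyc_path2; rewrite ?notin_path //= ?hs 1?eq_sym //.
  - by rewrite /xypath /= eqxx.
  - by move=> z zq; rewrite inE; apply: contraNneq sq => <-.
  - by rewrite par_nil addbF e -!addbA; congr (_ (+) _);
      move: fnm; rewrite /f odd_count_addb -!tauE; clear; lia.
have dK : dec sg (KK [:: y; s] N').
  apply: dec_KK => //=; rewrite ?inE ?ys ?hs ?hy //.
  by rewrite par_KK /= addn0 oddD !oddb !tauE -odd_count_addb.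
pose l := LG ++ ([set x; m] :: star x N') ++ [set y; n] :: walk_edges x p ++ star t N.
have pe : perm_eq (cedges c ++ KK [:: y; s] N' ++ (KK S N ++ R) ++ l)
   (LG ++ KK [:: x, y, s, t & S] N ++ walk_edges x p ++ walk_edges x q ++ R).
  have := perm_star2 s pN; have := perm_star2 y pN; have := perm_star2 x pN.
  clear -d1; rewrite -[[:: x, y, s, t & S]]/([:: x; y; s; t] ++ S) KK_cat /l; move: (KK S N) => K; rewrite /KK => h1 h2 h3; permc.
rewrite /win -(par_perm sg pe) par_cat (dec_par (dec_ecyc h1)).
rewrite par_cat (dec_par dK) par_cat (dec_par dr) /= => el.
apply: dec_perm pe _; apply: dec_cat (dec_ecyc h1) (dec_cat dK (dec_cat dr _)).
exact: (@virtual_win _ _ _ _ _ (m :: N')).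
Qed.

Definition okS S := [&& uniq S, all Hs S & ~~ odd (size S)].

Lemma okS_split l S : okS S -> uniq l -> {subset l <= S} -> ~~ odd (size l) ->
  exists S', [/\ perm_eq S (l ++ S'), okS S', all Hs l,
    forall z, z \in S' = (z \in S) && (z \notin l) &
    par sg (KK S N) = par sg (KK l N) (+) par sg (KK S' N)].
Proof.
case/and3P=> uS hS eS ul sl el; have [S' [pS uS' mS']] := perm_split ul uS sl.
exists S'; split=> //; last by rewrite (par_perm _ (perm_KKl N pS)) KK_cat par_cat.
- apply/and3P; split=> //.
    by apply/allP => z; rewrite mS' => /andP[zS _]; apply: (allP hS).
  by move: eS; rewrite (perm_size pS) size_cat oddD (negbTE el).
- by apply/allP => z /sl; apply: (allP hS).
Qed.

Lemma okS_dec S : okS S -> par sg (KK S N) = false -> dec sg (KK S N).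
Proof. by case/and3P=> *; apply: dec_KK. Qed.

(** With no cycle left, [x] and the vertex chosen by [parity_majority] carry the copy of $G$, and
    the rest pairs up by colour. *)
Lemma win_nil S : okS S -> S != [::] -> win S [::].
Proof.
case: S => // x S1 /and3P[/= /andP[xS uS] /andP[hx hS] eS] _.
rewrite negbK in eS.
have [y [S2 [p2 _ e2]]] := parity_majority (fun z => tau z) eS.
have [nxy hy] : x != y /\ Hs y.
  split; last by apply: (allP hS); rewrite (perm_mem p2) mem_head.
  by apply: contraNneq xS => ->; rewrite (perm_mem p2) mem_head.
apply: (@win_perm [:: x, y & S2] _ [::]) => //; first by rewrite perm_cons perm_sym.
apply: win_base => //; rewrite cats0; apply: okS_dec; last by rewrite par_KK.
apply/and3P; split.
- by move: uS; rewrite (perm_uniq p2) => /andP[].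
- by move: hS; rewrite (perm_all _ p2) => /andP[].
- by move: eS; rewrite (perm_size p2).
Qed.

Lemma link_sub E x y e (V1 V2 : pred T) : {subset V1 <= V2} ->
  link E x y e V1 -> link E x y e V2.
Proof.
move=> s12 h b; have [p [q [h1 /andP[h2 h3]]]] := h b; exists p, q; split=> //.
by rewrite (sub_all s12 h2) (sub_all s12 h3).
Qed.

Lemma link_arcs c x y : ocyc sg c -> x \in c -> y \in c -> x != y ->
  link (cedges c) x y true [in c].
Proof.
move=> oc xc yc nxy b; have [p [q h]] := ocyc_arcs oc xc yc nxy.
wlog hp : p q h / par sg (walk_edges x p) = b => [H|].
  have [e|ne] := eqVneq (par sg (walk_edges x p)) b; first exact: H h e.
  apply: (H q p); first exact: arcsC.
  by move: ne {H}; rewrite (arcs_par oc h); case: (par _ _); case: b.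
exists p, q; case: (h) => h1 h2 h3 h4 h5 _ _ _; split; last first.
  by apply/andP; split; apply/allP.
by split=> //; move: (arcs_par oc h); rewrite hp => ->; rewrite addbT negbK.
Qed.

(** Both paths pass through [w]. Exchanging the arcs of [c2] flips the parity of either path, and
    the two parities agree because passing to the complement changes an arc in each of the two odd
    cycles. *)
Lemma link_bowtie c1 c2 w y y' : ocyc sg c1 -> ocyc sg c2 ->
  w \in c1 -> w \in c2 -> (forall z, z \in c1 -> z \in c2 -> z = w) ->
  y \in c1 -> y' \in c2 -> y != w -> y' != w ->
  link (cedges c1 ++ cedges c2) y y' false [in c1 ++ c2].
Proof.
move=> o1 o2 w1 w2 dj yc yc' nyw nyw' b.
have [p [q h1]] := ocyc_arcs o1 yc w1 nyw.
have [p' [q' h2]] : exists p' q', arcs c2 w y' p' q'.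
  by apply: (ocyc_arcs o2) => //; rewrite eq_sym.
wlog e : p' q' h2 / par sg (walk_edges y p) (+) par sg (walk_edges w p') = b => [H|].
  have [e|ne] := eqVneq (par sg (walk_edges y p) (+) par sg (walk_edges w p')) b.
    exact: H h2 e.
  apply: (H q' p'); first exact: arcsC.
  by move: ne {H}; rewrite (arcs_par o2 h2); case: (par _ _); case: (par _ _); case: b.
have hcat r r' : xypath y w r -> xypath w y' r' -> {subset y :: r <= c1} ->
    {subset w :: r' <= c2} -> [/\ xypath y y' (r ++ r'),
    walk_edges y (r ++ r') = walk_edges y r ++ walk_edges w r' & all [in c1 ++ c2] (y :: r ++ r')].
  move=> hr hr' s1 s2; split.
  - by apply: xypath_cat hr hr' _ => t /s1 t1 /s2; apply: dj.
  - by rewrite walk_edges_cat (xypath_last hr).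
  - apply/allP=> t; rewrite -cat_cons !mem_cat => /orP[/s1 -> //|tr].
    by rewrite (s2 t) ?orbT // inE tr orbT.
case: (h1) => a1 a2 a3 a4 a5 _ _ _; case: (h2) => b1 b2 b3 b4 b5 _ _ _.
have [c11 c12 c13] := hcat _ _ a1 b1 a4 b4.
have [c21 c22 c23] := hcat _ _ a2 b2 a5 b5.
exists (p ++ p'), (q ++ q'); split; last by rewrite c13 c23.
split=> //; first by rewrite c12 c22; clear -a3 b3; permc.
  by rewrite c12 par_cat.
rewrite c22 par_cat -e (arcs_par o1 h1) (arcs_par o2 h2).
by case: (par _ _); case: (par _ _).
Qed.

Lemma dlink_links E E' x y x' y' e e' (V V' : pred T) :
  link E x y e V -> link E' x' y' e' V' ->
  {subset V <= Hs} -> {subset V' <= Hs} -> (forall z, V z -> ~~ V' z) ->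
  dlink (E ++ E') x y x' y' (e (+) e').
Proof.
move=> h h' sV sV' dj b.
have [p [q [[p1 p2 p3 p4 p5] /andP[p6 p7]]]] := h b.
(* The first link alone can supply the required parity, so the second is fixed at [false]. *)
have [p' [q' [[q1 q2 q3 q4 q5] /andP[q6 q7]]]] := h' false.
exists p, q, p', q'; split=> //.
- by clear -p3 q3; permc.
- by rewrite p4 q4 addbF.
- by rewrite p5 q5 addFb addbA.
split.
- by move=> z zp; apply/negP => zq; have := dj _ (allP p6 _ zp); rewrite (allP q6 _ zq).
- by move=> z zp; apply/negP => zq; have := dj _ (allP p7 _ zp); rewrite (allP q7 _ zq).
- by rewrite (sub_all sV p6) (sub_all sV p7) (sub_all sV' q6) (sub_all sV' q7).
Qed.

(** * A single odd cycle *)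

Lemma win_mixed c S x y z : ocyc sg c -> all Hs c -> okS S -> x \in c -> y \in c ->
  x \in S -> y \in S -> tau x != tau y -> z \in S -> z != x -> z != y ->
  win S (cedges c).
Proof.
move=> oc hc oS xc yc xS yS ne zS zx zy.
have nxy : x != y by apply: contraNneq ne => ->.
have [S' [pS oS' _ mS' _]] : exists S', [/\ perm_eq S ([:: x; y] ++ S'), okS S', all Hs [:: x; y],
    forall z, z \in S' = (z \in S) && (z \notin [:: x; y]) &
    par sg (KK S N) = par sg (KK [:: x; y] N) (+) par sg (KK S' N)].
  apply: okS_split => //=; first by rewrite inE nxy.
  by move=> t; rewrite !inE => /orP[]/eqP->.
apply: (@win_perm ([:: x; y] ++ S') _ (cedges c ++ [::])).
- by rewrite perm_sym.
- by rewrite cats0.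
apply: win_elim.
  apply: (@dec_close _ _ _ true) => //.
    by apply: link_sub (link_arcs oc xc yc nxy); apply/allP.
  by move: ne; case: (tau x); case: (tau y).
(* [z] ensures that vertices for the copy of $G$ survive. *)
apply: win_nil => //; have : z \in S' by rewrite mS' zS !inE negb_or zx.
by case: (S').
Qed.

Lemma win_arc c x y p q s t S R n : all Hs c -> arcs c x y p q ->
  x != y -> Hs s -> Hs t -> s \notin x :: q -> t \notin x :: p -> n \in N ->
  par sg (walk_edges x q) =
    sg [set x; n] (+) sg [set y; n] (+) tau y (+) tau s ->
  dec sg (KK S N ++ R) -> win [:: x, y, s, t & S] (cedges c ++ R).
Proof.
move=> hc h nxy hs ht sq tp nN e d; case: (h) => h1 h2 h3 h4 h5 _ _ _.
apply: (@win_perm [:: x, y, s, t & S] _ (walk_edges x p ++ walk_edges x q ++ R)) => //.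
  by clear -h3; permc.
apply: (win_step (n := n)) => //.
- by apply/allP=> z /h4; apply: (allP hc).
- by apply/allP=> z /h5; apply: (allP hc).
Qed.

Lemma exN : exists n, n \in N.
Proof. by case: N N0 => // n s; exists n; rewrite mem_head. Qed.

(** With [s] and [t] off the cycle the arcs are interchangeable, and as their parities differ one of
    them meets the condition of [win_step]. *)
Lemma win_outside c x y p q s t S R : ocyc sg c -> all Hs c -> arcs c x y p q ->
  x != y -> Hs s -> Hs t -> s \notin c -> t \notin c ->
  dec sg (KK S N ++ R) -> win [:: x, y, s, t & S] (cedges c ++ R).
Proof.
move=> oc hc h nxy hs ht sc tc d; have [n nN] := exN.
wlog e : p q h / par sg (walk_edges x q) =
    sg [set x; n] (+) sg [set y; n] (+) tau y (+) tau s => [H|].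
  have [e|ne] := eqVneq (par sg (walk_edges x q)) 
    (sg [set x; n] (+) sg [set y; n] (+) tau y (+) tau s); first exact: H h e.
  apply: (H q p); first exact: arcsC.
  move: ne {H}; rewrite (arcs_par oc h); move: (_ (+) tau s) => b.
  by case: (par _ _); case: b.
apply: (win_arc hc h nxy hs ht _ _ nN e d).
- by apply: contra sc => /(arcs_mem2 h).
- by apply: contra tc => /(arcs_mem1 h).
Qed.

(** If the parity condition fails, the arcs are exchanged, and [s] with [t] as well, so that each
    vertex still avoids the arc it has to avoid. Equal colours keep the required parity the same. *)
Lemma win_sep c x y p q s t S R : ocyc sg c -> all Hs c -> arcs c x y p q ->
  x != y -> Hs s -> Hs t -> tau s = tau t ->
  s \notin [:: x; y] -> t \notin [:: x; y] ->
  (s \in p -> t \notin p) -> (s \in q -> t \notin q) ->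
  dec sg (KK S N ++ R) -> win [:: x, y, s, t & S] (cedges c ++ R).
Proof.
move=> oc hc h nxy hs ht est; rewrite !inE !negb_or => /andP[sx sy] /andP[tx ty] hp hq d.
have [n nN] := exN.
wlog [sq tp] : p q h hp hq / s \notin q /\ t \notin p => [H|].
  have [sq|sq] := boolP (s \in q).
    apply: (H q p) => //; first exact: arcsC.
    split; last exact: hq.
    by apply: contra sy => sp; rewrite (arcs_disj h sp sq).
  have [tp|tp] := boolP (t \in p); last by apply: (H p q).
  apply: (H q p) => //; first exact: arcsC.
  split; first by apply/negP => /hp; rewrite tp.
  by apply: contra ty => tq; rewrite (arcs_disj h tp tq).
have [e|ne] := eqVneq (par sg (walk_edges x q)) 
    (sg [set x; n] (+) sg [set y; n] (+) tau y (+) tau s).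
  by apply: (win_arc hc h nxy hs ht _ _ nN e d); rewrite inE negb_or ?sx ?tx.
apply: (@win_perm [:: x, y, t, s & S] _ (cedges c ++ R)) => //; first by clear; permc.
apply: (win_arc hc (arcsC h) nxy ht hs _ _ nN _ d); rewrite ?inE ?negb_or ?sx ?tx //.
rewrite (arcs_par oc h) -est; move: ne; move: (_ (+) tau s) => b.
by case: (par _ _); case: b.
Qed.

(* All triangles xyn, yzn, xzn are odd.  Flipping the edge xn makes the graph
   with x, w in the parts of the twins even; the odd cycle xn..kx obtained is
   then recombined with the triangle xyz and the edges at y and z. *)
Lemma win_triangle4 x y z w S R : uniq [:: x; y; z; w] ->
  all Hs [:: x; y; z; w] -> 3 < size N ->
  (forall n, n \in N -> sg [set x; y] (+) sg [set x; n] (+) sg [set y; n]) ->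
  (forall n, n \in N -> sg [set y; z] (+) sg [set y; n] (+) sg [set z; n]) ->
  (forall n, n \in N -> sg [set z; x] (+) sg [set x; n] (+) sg [set z; n]) ->
  sg [set x; y] (+) sg [set y; z] (+) sg [set z; x] ->
  dec sg (KK S N ++ R) ->
  win [:: x, y, z, w & S] ([:: [set x; y]; [set y; z]; [set z; x]] ++ R).
Proof.
rewrite /= !inE !negb_or !andbT.
case/and3P=> /and3P[xy xz xw] /andP[yz yw] zw /and4P[hx hy hz hw] N4 txy tyz tzx tr d et.
have [n [N1 pN1]] : exists n N1, perm_eq N (n :: N1).
  by case: N N0 => // n s; exists n, s.
have nN : n \in N by rewrite (perm_mem pN1) mem_head.
have nN1 : n \notin N1 by have := uN; rewrite (perm_uniq pN1) => /andP[].
have sN1 k : k \in N1 -> k \in N by move=> h; rewrite (perm_mem pN1) inE h orbT.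
pose sg' d := if d == [set x; n] then ~~ sg d else sg d.
pose l := LG ++ star x N1 ++ star w N.
have pl : perm_eq ([set x; n] :: l) (LG ++ KK [:: x; w] N).
  by have := perm_star x pN1; rewrite /l /KK => h; clear -h; permc.
have xn : x != n by apply: contraTneq nN => <-; apply: HsN.
have hl e : e \in l -> [/\ y \notin e, z \notin e & e != [set x; n]].
  have aux k : Hs k -> k != x -> k != w -> e \in l -> k \notin e.
    move=> hk kx kw; rewrite !mem_cat => /or3P[el|el|el]; apply/negP=> ke.
    - by move: (LGH el ke); rewrite hk.
    - case: (mem_star el ke) => [ek|/sN1 kN]; first by rewrite ek eqxx in kx.
      by move: (HsN hk); rewrite kN.
    - case: (mem_star el ke) => [ek|kN]; first by rewrite ek eqxx in kw.
      by move: (HsN hk); rewrite kN.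
  move=> el; split; [by apply: aux; rewrite // eq_sym|by apply: aux; rewrite // eq_sym|].
  move: el; rewrite !mem_cat => /or3P[el|el|el].
  - by apply: contraTneq el => ->; apply/negP => /LGH /(_ x); rewrite !inE eqxx hx => /(_ isT).
  - case/mapP: el => k kN1 ->; apply: contraNneq nN1 => /setP /(_ n).
    rewrite !inE eqxx orbT eq_sym (negPf xn) /= => /eqP->; exact: kN1.
  - case/mapP: el => k kN ->; apply/eqP => /setP /(_ x).
    rewrite !inE eqxx (negPf xw) /= => /eqP xk; by move: (HsN hx); rewrite xk kN.
have es : {in l, sg' =1 sg} by move=> e /hl[_ _ /negPf h]; rewrite /sg' h.
have pe : perm_eq ([set x; n] :: l ++ star y N ++ star z N ++ (KK S N ++ R) ++
    [:: [set x; y]; [set y; z]; [set z; x]])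
    (LG ++ KK [:: x, y, z, w & S] N ++ [:: [set x; y]; [set y; z]; [set z; x]] ++ R).
  rewrite -[[:: x, y, z, w & S]]/([:: x; y; z; w] ++ S) KK_cat.
  move: (KK S N) => K; have := perm_star x pN1; rewrite /l /KK => h; clear -h; permc.
apply: (dec_perm pe).
have dSR := dec_par d.
(* The signs of [yk] and [zk] differ for all [k] in [N] or for none, and [size N] is even. *)
have tyz' : tau y = tau z.
  suff : tau y (+) tau z = false by case: (tau y); case: (tau z).
  rewrite !tauE -odd_count_addb.
  rewrite (eq_in_count (a2 := fun=> ~~ sg [set y; z])); last first.
    by move=> k /tyz; case: (sg _); case: (sg _); case: (sg _).
  by case: (sg _); rewrite /= ?count_pred0 ?count_predT // (negbTE eN).
have el : par sg' (LG ++ KK [:: x; w] N) = false.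
  rewrite -(par_perm _ pl) par_cons (eq_par es) /sg' eqxx.
  move: et; rewrite -(par_perm _ pe) par_cons (par_cat _ l) (par_cat _ (star y N)) (par_cat _ (star z N)).
  rewrite (par_cat _ (KK S N ++ R)) dSR !par_cons par_nil -[par sg (star y N)]/(tau y) -[par sg (star z N)]/(tau z) tyz'.
  by move: tr; clear; lia.
have := dec_perm _ (BB hx hw xw el) => /(_ ([set x; n] :: l)).
rewrite perm_sym => /(_ pl) /dec_extract [q [l1 [l2 [hc pc d2 pl12]]]].
have l12 e : (e \in l) = (e \in l1) || (e \in l2) by rewrite (perm_mem pl12) mem_cat.
have {d2} d2 : dec sg l2 by apply: eq_dec d2 => e h; apply: es; rewrite l12 h orbT.
case/lastP: q hc pc => [|q p] hc pc; first by case/and3P: hc.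
have ec : perm_eq (cedges [:: x, n & rcons q p])
     ([set x; n] :: [set x; p] :: walk_edges n (rcons q p)).
  by rewrite cedges_cons /= last_rcons (setUC [set p]); clear; permc.
have el1 : perm_eq l1 ([set x; p] :: walk_edges n (rcons q p)).
  by rewrite -(perm_cons [set x; n]) perm_sym; apply: perm_trans pc; rewrite perm_sym.
have /and3P[_ uq pq] := hc.
have xp : x != p by move: uq; rewrite /= inE mem_rcons inE !negb_or => /andP[/and3P[]].
have pN1' : p \in N1.
  have : [set x; p] \in l by rewrite l12 (perm_mem el1) mem_head.
  rewrite !mem_cat => /or3P[pl'|/mapP[k kN1]|/mapP[k kN]].
  - by have := LGH pl'; move/(_ x); rewrite !inE eqxx hx => /(_ isT).
  - move/setP/(_ p); rewrite !inE eqxx orbT eq_sym (negPf xp) => /esym/eqP->.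
    exact: kN1.
  - move/setP/(_ x); rewrite !inE eqxx (negPf xw) => /esym/eqP xk.
    by move: (HsN hx); rewrite xk kN.
have [N2 pN2] := perm_pick pN1'.
have pN : perm_eq N [:: n, p & N2] by apply: perm_trans pN1 _; rewrite perm_cons.
(* Two more vertices of [N] are taken: [k] for a 6-cycle and [k'] for a 4-cycle. *)
have : 1 < size N2 by move: N4; rewrite (perm_size pN).
case: N2 pN2 pN => [|k [|k' N4']] // pN2 pN _.
have uN' : uniq [:: n, p, k, k' & N4'] by rewrite -(perm_uniq pN).
have sN' : all [in N] [:: n; p; k; k'].
  by apply/allP=> t; rewrite (perm_mem pN) !inE => /or4P[]->; rewrite ?orbT.
have /and5P[_ pN' kN kN' _] := sN'.
have yzq t : Hs t -> t != x -> (forall e, e \in l -> t \notin e) -> t \notin n :: rcons q p.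
  move=> ht tx h; apply/negP => tq.
  have [e] : exists2 e, e \in cedges [:: x, n & rcons q p] & t \in e.
    by apply: cedges_vertex; rewrite inE tq orbT.
  rewrite (perm_mem pc) in_cons => /predU1P[->|e1 te].
    rewrite !inE (negPf tx) /= => /eqP tn.
    by move: (HsN ht); rewrite tn nN.
  by have := h e; rewrite l12 e1 te => /(_ isT).
have yq : y \notin n :: rcons q p by apply: yzq; rewrite // 1?eq_sym // => e /hl[].
have zq : z \notin n :: rcons q p by apply: yzq; rewrite // 1?eq_sym // => e /hl[].
have yE t : t \in N -> sg [set y; t] = ~~ (sg [set x; y] (+) sg [set x; t]).
  by move=> /txy; clear; lia.
have zE t : t \in N -> sg [set z; t] = ~~ (sg [set z; x] (+) sg [set x; t]).
  by move=> /tzx; clear; lia.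
have yzE : sg [set y; z] = ~~ (sg [set x; y] (+) sg [set z; x]).
  by move: tr; clear; lia.
have pl1 : par sg' l1 = par sg l1 by apply: eq_par => e h; apply: es; rewrite l12 h.
have pA : par sg (walk_edges n (rcons q p)) = sg [set x; p] (+) ~~ sg [set x; n].
  move: pq; rewrite (par_perm _ pc) par_cons pl1 (par_perm _ el1) par_cons /sg' eqxx.
  by clear; lia.
(* Replacing [x] in the cycle by the edge [zy] makes it even for [sg]. The freed edges [xn] and [xp]
   go into the 6-cycle [c2], the edges [xy] and [zx] into the 4-cycle [c3]. *)
have c1p : perm_eq (cedges [:: z, y, n & rcons q p])
    ([set y; z] :: [set y; n] :: [set z; p] :: walk_edges n (rcons q p)).
  by rewrite cedges_cons /= last_rcons (setUC [set p]) (setUC [set z] [set y]); clear; permc.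
have c1 : ecyc sg [:: z, y, n & rcons q p].
  apply/and3P; split=> //.
    have uq2 : uniq (n :: rcons q p) by case/andP: uq.
    by rewrite 2!cons_uniq uq2 yq in_cons negb_or zq eq_sym yz.
  by rewrite (par_perm _ c1p) !par_cons pA yzE (yE n) // (zE p) //; clear; lia.
have xyzN t : t \in N -> [/\ t != x, t != y & t != z].
  by move=> tN; split; apply: contraTneq tN => ->; apply: HsN.
have [nx ny nz] := xyzN n nN; have [px py pz] := xyzN p pN'.
have [kx ky kz] := xyzN k kN; have [k'x k'y k'z] := xyzN k' kN'.
have c2 : ecyc sg [:: x; n; z; k; y; p].
  apply/and3P; split=> //.
    move: uN'; rewrite /= !inE !negb_or => /and3P[/and3P[np nk _] /andP[pk _] _].
    by rewrite !andbT; do ?[apply/andP; split]; rewrite // eq_sym.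
  rewrite /cedges /= !par_cons par_nil.
  by rewrite !(setUC [set n]) !(setUC [set k]) !(setUC [set p]) (yE k) // (yE p) // (zE n) // (zE k) //; clear; lia.
have c3 : ecyc sg [:: y; x; z; k'].
  apply/and3P; split=> //.
    by rewrite /= !inE !negb_or !andbT; do ?[apply/andP; split]; rewrite // eq_sym.
  rewrite /cedges /= !par_cons par_nil.
  by rewrite !(setUC [set k']) (setUC [set y] [set x]) (setUC [set x] [set z]) (yE k') // (zE k') //; clear; lia.
have dK : dec sg (KK [:: y; z] N4').
  apply: dec_KK.
  - by rewrite /= inE yz.
  - by rewrite /= hy hz.
  - by [].
  - by move: uN'; rewrite /= => /and5P[_ _ _ _ ->].
  - by move=> t tN; rewrite (perm_mem pN) !inE tN !orbT.
  - by move: eN; rewrite (perm_size pN) /= !negbK.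
  - move: tyz'; rewrite par_KK /= !tauE !(permP pN) /= !oddD !oddb.
    rewrite (yE n) // (yE p) // (yE k) // (yE k') // (zE n) // (zE p) // (zE k) // (zE k') //.
    by clear; lia.
apply: dec_perm (dec_cat (dec_ecyc c1) (dec_cat (dec_ecyc c2) (dec_cat (dec_ecyc c3) (dec_cat dK (dec_cat d d2))))).
have := perm_star y pN; have := perm_star z pN.
clear -pl12 el1 c1p; clearbody l; move: (KK S N ++ R) => K; rewrite /KK.
move=> h1 h2.
have c2p : perm_eq (cedges [:: x; n; z; k; y; p]) [:: [set x; n]; [set z; n]; [set z; k]; [set y; k]; [set y; p]; [set x; p]].
  by rewrite /cedges /= !(setUC [set n]) !(setUC [set k]) !(setUC [set p]).
have c3p : perm_eq (cedges [:: y; x; z; k']) [:: [set x; y]; [set z; x]; [set z; k']; [set y; k']].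
  by rewrite /cedges /= !(setUC [set k']) (setUC [set y] [set x]) (setUC [set x] [set z]).
permc.
Qed.

(* Here n y z m and n z x m have the parities of n w2 m and n w3 m, with which they
   close up to even cycles; n x y m is the path replacing n x m in the copy of G
   on x and w1. *)
Lemma win_triangle2 n m x y z w1 w2 w3 S R : perm_eq N [:: n; m] ->
  uniq [:: x; y; z; w1; w2; w3] -> all Hs [:: x; y; z; w1; w2; w3] ->
  sg [set y; z] (+) sg [set y; n] (+) sg [set z; n] ->
  sg [set z; x] (+) sg [set x; n] (+) sg [set z; n] ->
  tau z != tau w2 -> tau x != tau w3 ->
  dec sg (KK S N ++ R) ->
  win [:: x, y, z, w1, w2, w3 & S] ([:: [set x; y]; [set y; z]; [set z; x]] ++ R).
Proof.
move=> pN u6 V6 tyz tzx e2 e3 d et.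
have [[nm mN nN] _] := partner_uniq pN.
have pstar t : perm_eq (star t N) [:: [set t; n]; [set t; m]] by apply: (perm_star t pN).
have tauE2 t : tau t = sg [set t; n] (+) sg [set t; m].
  by rewrite tauE (permP pN) /= addn0 oddD !oddb.
have notN k X : k \in N -> all Hs X -> k \notin X.
  by move=> kN /allP h; apply/negP => /h; apply/negP/NH.
have /and5P[hx hy hz h1 /and3P[h2 h3 _]] := V6.
have u6' : [/\ x != y, y != z, z != w2 & z != x] /\ [/\ x != w3, x != w1, y != w1, z != w3 & y != w2].
  move: u6; rewrite /= !inE !negb_or -!andbA.
  by repeat (case/andP; intro); split; split=> //; rewrite eq_sym.
case: u6' => [[xy yz zw2 zx] [xw3 xw1 yw1 zw3 yw2]].
have [c1 k1 d1] : exists2 c, ecyc sg c & perm_eq (cedges c) ([set y; n] :: [set z; m] ::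
    [set w2; m] :: [set w2; n] :: walk_edges y [:: z] ++ walk_edges w2 [::]).
  apply: ecyc_path2; rewrite ?notN //= ?hy ?hz ?h2 1?eq_sym //.
  - by rewrite /xypath /= eqxx inE yz.
  - by rewrite /xypath /= eqxx.
  - by move=> t; rewrite !inE => /orP[]/eqP->; rewrite eq_sym // eq_sym.
  - by move: tyz e2; rewrite !tauE2 !parE; clear; lia.
have [c2 k2 d2] : exists2 c, ecyc sg c & perm_eq (cedges c) ([set z; n] :: [set x; m] ::
    [set w3; m] :: [set w3; n] :: walk_edges z [:: x] ++ walk_edges w3 [::]).
  apply: ecyc_path2; rewrite ?notN //= ?hx ?hz ?h3 1?eq_sym //.
  - by rewrite /xypath /= eqxx inE zx.
  - by rewrite /xypath /= eqxx.
  - by move=> t; rewrite !inE => /orP[]/eqP->; rewrite eq_sym // eq_sym.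
  - by move: tzx e3; rewrite !tauE2 !parE; clear; lia.
pose l := LG ++ star x [:: n] ++ [set y; m] :: walk_edges x [:: y] ++ star w1 N.
have pe : perm_eq (cedges c1 ++ cedges c2 ++ (KK S N ++ R) ++ l)
  (LG ++ KK [:: x, y, z, w1, w2, w3 & S] N ++ [:: [set x; y]; [set y; z]; [set z; x]] ++ R).
  rewrite -[[:: x, y, z, w1, w2, w3 & S]]/([:: x; y; z; w1; w2; w3] ++ S) KK_cat.
  have p1 := pstar x; have p2 := pstar y; have p3 := pstar z; have p4 := pstar w2; have p5 := pstar w3.
  by rewrite /l; move: (KK S N) => K; rewrite /KK; clear -d1 d2 p1 p2 p3 p4 p5; permc.
apply: (dec_perm pe).
apply: dec_cat (dec_ecyc k1) (dec_cat (dec_ecyc k2) (dec_cat d _)).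
apply: virtual_win => //.
- by rewrite /xypath /= eqxx inE xy.
- by rewrite /= hx hy.
- by rewrite !inE negb_or eq_sym xw1 eq_sym yw1.
- by apply: perm_trans pN _; permc.
- move: et; rewrite -(par_perm _ pe) (par_cat _ (cedges c1)) (par_cat _ (cedges c2)).
  by rewrite (par_cat _ (KK S N ++ R)) (dec_par (dec_ecyc k1)) (dec_par (dec_ecyc k2)) (dec_par d).
Qed.

Lemma perm_KK_par S S' : perm_eq S S' -> par sg (KK S N) = par sg (KK S' N).
Proof. by move=> h; apply: par_perm; apply: perm_KKl. Qed.

(** The partner has the colour of [s] if [KK S N] is even and the opposite colour if it is odd. In
    the odd case this places the partner of a vertex of a monochromatic cycle off that cycle. *)
Lemma okS_partner S s : okS S -> s \in S -> exists t S',
  [/\ perm_eq S [:: s, t & S'], okS S', dec sg (KK S' N),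
      tau t = tau s (+) par sg (KK S N) & [/\ t != s, t \in S, Hs s & Hs t]].
Proof.
case/and3P=> uS /allP hS eS sS; have [S1 p1] := perm_pick sS.
have oS1 : odd (size S1) by move: eS; rewrite (perm_size p1) /= negbK.
have [t [S2 [p2 e2 e3]]] := parity_majority (fun z => tau z) oS1.
have pS : perm_eq S [:: s, t & S2] by apply: perm_trans p1 _; rewrite perm_cons.
have tS : t \in S by rewrite (perm_mem pS) !inE eqxx orbT.
have := uS; rewrite (perm_uniq pS) /= !inE negb_or => /and3P[/andP[st _] _ uS2].
have oS2 : okS S2.
  apply/and3P; split=> //; last by move: oS1; rewrite (perm_size p2).
  by apply/allP=> z zS; apply: hS; rewrite (perm_mem pS) !inE zS !orbT.
exists t, S2; split=> //.
- by apply: okS_dec; rewrite // par_KK.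
- by rewrite e2 (perm_KK_par p1) par_KK_cons par_KK addKb.
- by rewrite eq_sym; split=> //; apply: hS.
Qed.

(** The alternatives leave out just a triangle with [size N = 2] and a single vertex of [S] off it.
    A cycle with both colours is absorbed directly; the work concerns a monochromatic cycle and
    splits by the parity of [KK S N]. *)
Lemma win1 c S : ocyc sg c -> okS S -> {subset c <= S} ->
  3 < size c \/ 3 < size N \/ (exists s t, [/\ s \in S, t \in S, s \notin c, t \notin c & s != t]) ->
  win S (cedges c).
Proof.
move=> oc oS cS cond.
have /and3P[c3 uc _] := oc.
have hc : all Hs c by apply/allP=> z /cS; case/and3P: oS => _ /allP h _; apply: h.
have [/hasP[x xc /hasP[y yc ne]]|mono] := boolP (has (fun x => has (fun y => tau x != tau y) c) c).
  have [z zc] := exists_notin (l := [:: x; y]) uc c3.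
  rewrite !inE negb_or => /andP[zx zy]; apply: (@win_mixed c S x y z) => //; exact: cS.
have {}mono x y : x \in c -> y \in c -> tau x = tau y.
  move=> xc yc; apply/eqP; apply: contraNT mono => h.
  by apply/hasP; exists x => //; apply/hasP; exists y.
rewrite -[cedges c]cats0.
have colour_notin t s : t \in c -> tau s = ~~ tau t -> s \notin c.
  by move=> tc e; apply/negP=> /(mono t) -/(_ tc) h; move: e; rewrite h; case: (tau s).
have split2 x y : x \in c -> y \in c -> x != y -> exists S',
    [/\ perm_eq S ([:: x; y] ++ S'), okS S',
     forall z, z \in S' = (z \in S) && (z \notin [:: x; y]) & par sg (KK S' N) = par sg (KK S N)].
  move=> xc yc nxy; have [|||S' [pS oS' _ mS' eS']] := @okS_split [:: x; y] S oS; rewrite /= ?inE ?nxy //.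
    by move=> t; rewrite !inE => /orP[]/eqP->; apply: cS.
  by exists S'; split=> //; rewrite eS' !par_KK_cons (mono x y) // addKb.
have {split2} pick x y t : x \in c -> y \in c -> x != y -> t \in S -> t != x -> t != y ->
    exists s S2, [/\ perm_eq S [:: x, y, s, t & S2], okS S2, dec sg (KK S2 N ++ [::]),
     tau s = tau t (+) par sg (KK S N) & [/\ Hs s, Hs t, s != t, s != x & s != y]].
  move=> xc yc nxy tS tx ty; have [S' [pS oS' mS' eS']] := split2 _ _ xc yc nxy.
  have tS' : t \in S' by rewrite mS' tS !inE negb_or tx.
  have [s [S2 [p2 oS2 d2 e2 [st sS' ht hs]]]] := okS_partner oS' tS'.
  exists s, S2; split=> //.
  - by apply: perm_trans pS _; rewrite !perm_cons; apply: perm_trans p2 _; permc.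
  - by rewrite cats0.
  - by rewrite e2 eS'.
  - by move: sS'; rewrite mS' !inE negb_or => /andP[_ /andP[]]; split.
have [n nN] := exN.
(* With four vertices both arcs between [x1] and [x3] have an inner vertex: [x2] on one, [x4] on the
   other. *)
have [c4|] := ltnP 3 (size c).
  case: c oc c3 uc hc mono colour_notin cS pick {cond} c4 => [|x1 [|x2 [|x3 [|x4 c']]]] //.
  set c := _ :: _; move=> oc _ uc hc mono colour_notin cS pick _.
  have [x1c x2c x3c x4c] : [/\ x1 \in c, x2 \in c, x3 \in c & x4 \in c].
    by rewrite !inE !eqxx !orbT.
  have [[n12 n13 n14] [n23 n24 n34]] : [/\ x1 != x2, x1 != x3 & x1 != x4] /\
      [/\ x2 != x3, x2 != x4 & x3 != x4].
    move: uc; rewrite /= !inE !negb_or -!andbA.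
    by repeat (case/andP; intro); split; split.
  have [q h sq] := arcs_cat (uc : uniq (x1 :: [:: x2] ++ x3 :: x4 :: c')).
  have x4q : x4 \in q by apply: sq; rewrite mem_head.
  have x4p : x4 \notin x1 :: rcons [:: x2] x3.
    by rewrite !inE !negb_or !(eq_sym x4) n14 n24 n34.
  have x2q : x2 \notin x1 :: q.
    rewrite inE negb_or eq_sym n12; apply: contra n23 => hq.
    by rewrite (arcs_disj h (_ : x2 \in _) hq) //= mem_head.
  (* If the parity is odd, the partner of [x4] or of [x2] lies off the cycle, and the choice between
     [x4] and [x2] decides which arc enters the even cycle. *)
  case eS : (par sg (KK S N)).
    have [e|ne] := eqVneq (par sg (walk_edges x1 q))
        (sg [set x1; n] (+) sg [set x3; n] (+) true).
      have [||s [S2 [p2 _ d2 e2 [hs ht _ _ _]]]] := pick x1 x3 x4 x1c x3c n13 (cS _ x4c); rewrite 1?eq_sym //.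
      have sc : s \notin c by apply: (colour_notin x4); rewrite // e2 eS addbT.
      apply: (@win_perm [:: x1, x3, s, x4 & S2] _ (cedges c ++ [::])); rewrite // 1?perm_sym //.
      apply: (win_arc hc h n13 hs ht _ x4p nN _ d2).
        by apply: contra sc => /(arcs_mem2 h).
      by rewrite e e2 eS (mono x4 x3) //; clear; lia.
    have [||s [S2 [p2 _ d2 e2 [hs ht _ _ _]]]] := pick x1 x3 x2 x1c x3c n13 (cS _ x2c); rewrite // 1?eq_sym //.
    have sc : s \notin c by apply: (colour_notin x2); rewrite // e2 eS addbT.
    apply: (@win_perm [:: x1, x3, s, x2 & S2] _ (cedges c ++ [::])); rewrite // 1?perm_sym //.
    apply: (win_arc hc (arcsC h) n13 hs ht _ x2q nN _ d2).
      by apply: contra sc => /(arcs_mem1 h).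
    rewrite (arcs_par oc h) e2 eS (mono x2 x3) //; move: (tau x3) ne; clear.
    by case; case: (par _ _); case: (sg _); case: (sg _).
  (* If the parity is even, [x2] and [x4] are the equally coloured pair separated by the arcs. *)
  have [|||S' [pS oS' hS' _ eS']] := @okS_split [:: x1; x3; x2; x4] S oS; rewrite //.
  - by rewrite /= !inE !negb_or n13 n12 n14 n34 n24 eq_sym n23.
  - by move=> t; rewrite !inE => /or4P[]/eqP->; apply: cS.
  apply: (@win_perm [:: x1, x3, x2, x4 & S'] _ (cedges c ++ [::])); rewrite // 1?perm_sym //.
  have /and5P[h1 h3 h2 h4 _] := hS'.
  apply: (win_sep oc hc h n13 h2 h4 (mono _ _ x2c x4c)).
  - by rewrite !inE negb_or eq_sym n12.
  - by rewrite !inE negb_or !(eq_sym x4) n14.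
  - by move=> _; move: x4p; rewrite inE negb_or => /andP[].
  - by move: x2q; rewrite inE negb_or => /andP[_ /negPf->].
  rewrite cats0; apply: okS_dec => //.
  move: eS'; rewrite eS !par_KK_cons (mono x3 x1) // (mono x2 x1) // (mono x4 x1) //.
  by case: (tau x1); case: (par sg (KK S' N)).
move=> c3'; have {c3 c3'} c3 : size c = 3 by apply/eqP; rewrite eqn_leq c3' c3.
(* For odd parity, one even triangle [x y k] with [k] in [N] suffices: the arcs are the edge [xy]
   and the path through [z], and the partner of [z] lies off the cycle. *)
have win_even x y z k : uniq [:: x; y; z] -> perm_eq c [:: x; y; z] ->
    perm_eq (cedges c) [:: [set x; y]; [set y; z]; [set z; x]] -> k \in N ->
    par sg (KK S N) -> sg [set x; y] = sg [set x; k] (+) sg [set y; k] ->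
    win S (cedges c ++ [::]).
  move=> u3 pc pe kN eS e.
  have [xc yc zc] : [/\ x \in c, y \in c & z \in c] by rewrite !(perm_mem pc) !inE !eqxx !orbT.
  have [xy yz zx] : [/\ x != y, z != y & z != x].
    by move: u3; rewrite /= !inE !negb_or !(eq_sym z) andbT => /andP[/andP[-> ->] ->].
  have [s [S2 [p2 _ d2 e2 [hs hz sz sx sy]]]] := pick x y z xc yc xy (cS _ zc) zx yz.
  have [q h _] := arcs_cat (u3 : uniq (x :: [::] ++ y :: [:: z])).
  have o3 : ocyc sg [:: x; y; z].
    by rewrite /ocyc u3; rewrite -(par_perm _ (_ : perm_eq (cedges c) _)) //; case/and3P: oc.
  have sc : s \notin c by apply: (colour_notin z); rewrite // e2 eS addbT.
  have h3 : all Hs [:: x; y; z] by rewrite -(perm_all _ pc).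
  apply: (@win_perm [:: x, y, s, z & S2] _ (cedges [:: x; y; z] ++ [::])); rewrite // 1?perm_sym //.
    by rewrite !cats0.
  apply: (win_arc h3 h xy hs hz _ _ kN _ d2).
  - by apply: contra sc => /(arcs_mem2 h); rewrite (perm_mem pc).
  - by rewrite !inE negb_or zx.
  have := arcs_par o3 h; rewrite /= par_cons par_nil e e2 eS (mono z y) //.
  move: (tau y); clear.
  by case; case: (par _ _); case: (sg _); case: (sg _).
case: c oc c3 uc hc mono colour_notin cS pick cond win_even => [|x [|y [|z [|? ?]]]] //.
set c := [:: x; y; z]; move=> oc _ uc hc mono colour_notin cS pick cond win_even.
have [xc yc zc] : [/\ x \in c, y \in c & z \in c] by rewrite !inE !eqxx !orbT.
have [xy zy zx] : [/\ x != y, z != y & z != x].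
  by move: uc; rewrite /= !inE !negb_or !(eq_sym z) andbT => /andP[/andP[-> ->] ->].
have ce : cedges c = [:: [set x; y]; [set y; z]; [set z; x]] by [].
have [q h _] := arcs_cat (uc : uniq (x :: [::] ++ y :: [:: z])).
have [t [S2 [p2 oS2 d2 e2 [ht hz tz tx ty]]]] := pick x y z xc yc xy (cS _ zc) zx zy.
have tc : t \notin c by rewrite !inE !negb_or tx ty.
(* If the parity is even, [t] has the colour of [z] and lies off the triangle, so no arc contains
   both. *)
case eS : (par sg (KK S N)); last first.
  apply: (@win_perm [:: x, y, t, z & S2] _ (cedges c ++ [::])); rewrite // 1?perm_sym //.
  apply: (win_sep oc hc h xy ht hz _ _ _ _ _ d2).
  - by rewrite e2 eS addbF.
  - by rewrite !inE negb_or tx.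
  - by rewrite !inE negb_or zx.
  - by rewrite inE (negPf ty).
  - by move=> tq; have := arcs_mem2 h (mem_behead (s := x :: q) tq); rewrite (negPf tc).
(* A vertex [u] off the triangle but of its colour has a partner of the other colour, so both lie
   off the triangle. *)
have [/hasP[u uS /andP[uc' /eqP eu]]|/hasPn noX] := boolP (has (fun u => (u \notin c) && (tau u == tau x)) S).
  have [ux uy] : u != x /\ u != y by move: uc'; rewrite !inE !negb_or => /and3P[].
  have [s [S3 [p3 _ d3 e3 [hs hu su sx sy]]]] := pick x y u xc yc xy uS ux uy.
  apply: (@win_perm [:: x, y, s, u & S3] _ (cedges c ++ [::])); rewrite // 1?perm_sym //.
  apply: (win_outside oc hc h xy hs hu _ uc' d3).
  by apply: (colour_notin x); rewrite // e3 eu eS addbT.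
(* Where [win_even] does not apply, every triangle formed by an edge of [c] and a vertex of [N] is
   odd. *)
have tri a b d : uniq [:: a; b; d] -> perm_eq c [:: a; b; d] ->
    perm_eq (cedges c) [:: [set a; b]; [set b; d]; [set d; a]] ->
    win S (cedges c ++ [::]) \/ forall k, k \in N -> sg [set a; b] (+) sg [set a; k] (+) sg [set b; k].
  move=> u3 pc pe.
  have [/hasP[k kN /eqP e]|/hasPn h'] := boolP (has (fun k => sg [set a; b] == sg [set a; k] (+) sg [set b; k]) N).
    by left; apply: (win_even a b d k).
  by right=> k /h'; case: (sg _); case: (sg _); case: (sg _).
have [//|txy] := tri x y z uc (perm_refl _) (perm_refl _).
have [//|tyz] : win S (cedges c ++ [::]) \/ forall k, k \in N -> sg [set y; z] (+) sg [set y; k] (+) sg [set z; k].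
  apply: (tri y z x); rewrite ?ce /c; [|by permc|by permc].
  by move: uc; rewrite /= !inE !negb_or !andbT (eq_sym y x) (eq_sym z x) => /andP[/andP[-> ->] ->].
have [//|tzx] : win S (cedges c ++ [::]) \/ forall k, k \in N -> sg [set z; x] (+) sg [set z; k] (+) sg [set x; k].
  apply: (tri z x y); rewrite ?ce /c; [|by permc|by permc].
  by move: uc; rewrite /= !inE !negb_or !andbT (eq_sym z y) (eq_sym z x) => /andP[/andP[-> ->] ->].
have {}tzx k : k \in N -> sg [set z; x] (+) sg [set x; k] (+) sg [set z; k].
  by move=> /tzx; case: (sg _); case: (sg _); case: (sg _).
have hx : Hs x by case/and4P: hc.
have hy : Hs y by case/and4P: hc.
have xz : x != z by rewrite eq_sym.
have u4 : uniq [:: x; y; z; t].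
  by rewrite /= !inE !negb_or xy xz !(eq_sym _ t) tx ty tz (eq_sym y z) zy.
have [N4|N3] := ltnP 3 (size N).
  apply: (@win_perm [:: x, y, z, t & S2] _ (cedges c ++ [::])) => //.
    by rewrite perm_sym; apply: perm_trans p2 _; permc.
  rewrite ce; apply: win_triangle4 => //; first by rewrite /= hx hy hz ht.
  by case/and3P: oc => _ _; rewrite ce !par_cons par_nil; clear; lia.
(* Now [size N] is 2. One of the two vertices off the triangle differs from [t], and its partner in
   [S2] is a third; by [noX] their colour is not that of the triangle. *)
case: cond => [|[|[s1 [s2 [s1S s2S s1c s2c s12]]]]] //; first by rewrite ltnNge N3.
have {s1 s2 s1S s2S s1c s2c s12} [s sS2] : exists s, s \in S2.
  wlog st : s1 s2 s1S s2S s1c s2c s12 / s1 != t => [H|].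
    have [e|ne] := eqVneq s1 t; last exact: (H s1 s2).
    by apply: (H s2 s1); rewrite // eq_sym // -e.
  exists s1; move: s1S; rewrite (perm_mem p2) !inE; move: s1c; rewrite !inE !negb_or.
  by rewrite (negPf st) => /and3P[/negPf-> /negPf-> /negPf->].
have [w [S3 [p3 _ d3 _ [ws wS hs hw]]]] := okS_partner oS2 sS2.
have uS : uniq S by case/and3P: oS.
have nocol u : u \in S2 -> tau u != tau x /\ [/\ u != x, u != y, u != z & u != t].
  move=> uS2; have uS' : u \in S by rewrite (perm_mem p2) !inE uS2 !orbT.
  have [ux uy uz ut] : [/\ u != x, u != y, u != z & u != t].
    move: uS; rewrite (perm_uniq p2) /= !inE !negb_or => /and5P[/and4P[_ _ _ h1] /and3P[_ _ h2] /andP[_ h3] h4 _].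
    by split; [apply: contraNneq h1|apply: contraNneq h2|apply: contraNneq h4|apply: contraNneq h3] => <-.
  split=> //; have := noX u uS'; rewrite !inE !negb_or ux uy uz /=.
  by [].
have [m [k pN]] : exists m k, perm_eq N [:: m; k].
  by case: N eN N0 N3 => [|a [|b [|? [|? ?]]]] //; exists a, b; apply: perm_refl.
have [cs [sx sy sz st]] := nocol _ sS2; have [cw [wx wy wz wt]] := nocol _ wS.
have kN : k \in N by rewrite (perm_mem pN) !inE eqxx orbT.
have mN : m \in N by rewrite (perm_mem pN) mem_head.
apply: (@win_perm [:: x, y, z, t, s, w & S3] _ (cedges c ++ [::])) => //.
  by rewrite perm_sym; clear -p2 p3; permc.
rewrite ce; apply: (win_triangle2 pN) => //.
- by rewrite /= !inE !negb_or !andbT; do ?[apply/andP; split]; rewrite // eq_sym.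
- by rewrite /= hx hy hz ht hs hw.
- exact: tyz.
- exact: tzx.
- by rewrite (mono z x) // eq_sym.
- by rewrite eq_sym.
- by rewrite cats0; move: d3.
Qed.

(** * Two odd cycles *)

Lemma colour_pair c : ocyc sg c -> exists x y, [/\ x \in c, y \in c, x != y & tau x = tau y].
Proof.
case/and3P; case: c => [|x [|y [|z c]]] // _ uc _.
move: uc; rewrite /= !inE !negb_or => /and3P[/and3P[xy xz _] /andP[yz _] _].
have [exy|nxy] := eqVneq (tau x) (tau y); first by exists x, y; rewrite !inE !eqxx !orbT.
have [exz|nxz] := eqVneq (tau x) (tau z); first by exists x, z; rewrite !inE !eqxx !orbT.
exists y, z; rewrite !inE !eqxx !orbT; split=> //.
by move: nxy nxz; case: (tau x); case: (tau y); case: (tau z).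
Qed.

Lemma dec_cycles c1 c2 x y x' y' : ocyc sg c1 -> ocyc sg c2 ->
  all Hs c1 -> all Hs c2 -> (forall z, z \in c1 -> z \notin c2) ->
  x \in c1 -> y \in c1 -> x != y -> tau x = tau y ->
  x' \in c2 -> y' \in c2 -> x' != y' -> tau x' = tau y' ->
  dec sg (KK [:: x; y; x'; y'] N ++ cedges c1 ++ cedges c2).
Proof.
move=> o1 o2 /allP V1 /allP V2 dj xc yc xy exy xc' yc' xy' exy'.
apply: (@dec_join _ _ _ _ _ (true (+) true)).
- apply: (dlink_links (link_arcs o1 xc yc xy) (link_arcs o2 xc' yc' xy')) => //.
- rewrite /= !inE !negb_or xy xy' /= !andbT; apply/andP; split; apply/andP; split;
    by apply: contraTneq isT => e; move: (dj _ xc) (dj _ yc); rewrite e ?xc' ?yc'.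
- by rewrite exy exy'; case: (tau y); case: (tau y').
Qed.

Lemma dec_bowtie c1 c2 w y y' : ocyc sg c1 -> ocyc sg c2 ->
  all Hs c1 -> all Hs c2 -> w \in c1 -> w \in c2 ->
  (forall z, z \in c1 -> z \in c2 -> z = w) ->
  y \in c1 -> y' \in c2 -> y != w -> y' != w -> tau y = tau y' ->
  dec sg (KK [:: y; y'] N ++ cedges c1 ++ cedges c2).
Proof.
move=> o1 o2 /allP V1 /allP V2 w1 w2 dj yc yc' yw yw' eyy.
apply: (@dec_close _ _ _ false).
- apply: link_sub (link_bowtie o1 o2 w1 w2 dj yc yc' yw yw') => z.
  by rewrite mem_cat => /orP[/V1|/V2].
- by apply: contraNneq yw => e; rewrite (dj y) // e.
- by rewrite eyy addbb.
Qed.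

(** The exact membership of [S'] is passed on because each continuation has to check that the
    surviving cycles keep all their vertices. *)
Lemma win_use l S R R1 R2 : okS S -> uniq l -> {subset l <= S} -> ~~ odd (size l) ->
  dec sg (KK l N ++ R1) -> perm_eq R (R1 ++ R2) ->
  (forall S', okS S' -> (forall z, z \in S' = (z \in S) && (z \notin l)) ->
    par sg (KK S N) = par sg (KK l N) (+) par sg (KK S' N) -> win S' R2) ->
  win S R.
Proof.
move=> oS ul sl el d pR h; have [S' [pS oS' _ mS' eS']] := okS_split oS ul sl el.
apply: (@win_perm (l ++ S') _ (R1 ++ R2)); rewrite 1?perm_sym //.
by apply: win_elim d (h S' oS' mS' eS').
Qed.

Lemma okS_all S (c : seq T) : okS S -> {subset c <= S} -> all Hs c.
Proof. by case/and3P=> _ /allP h _ cS; apply/allP=> z /cS/h. Qed.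

(** This is the case out of reach of [dec_bowtie]: apart from [w] the cycles have opposite colours,
    and [w] has that of [c2]. If [KK S N] is odd, [c1] is removed with [w] and [a], and [c2] is left
    to [win_outside]. If it is even, two paths from [a] to [e] through [w] play the parts of the
    arcs in [win_step]. *)
Lemma win_flower c1 c2 w a S : ocyc sg c1 -> ocyc sg c2 -> okS S ->
  {subset c1 <= S} -> {subset c2 <= S} -> w \in c1 -> w \in c2 ->
  (forall z, z \in c1 -> z \in c2 -> z = w) ->
  a \in c1 -> a != w -> tau w != tau a ->
  (forall y, y \in c1 -> y != w -> tau y = tau a) ->
  (forall y, y \in c2 -> y != w -> tau y = ~~ tau a) ->
  win S (cedges c1 ++ cedges c2).
Proof.
move=> o1 o2 oS s1 s2 w1 w2 dj ac aw twa mono1 mono2.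
have V1 := okS_all oS s1; have V2 := okS_all oS s2.
have /and3P[c13 u1 _] := o1; have /and3P[c23 u2 _] := o2.
have [b bc] := exists_notin (l := [:: w; a]) u1 c13.
rewrite !inE negb_or => /andP[bw ba].
have [e ec] := exists_notin (l := [:: w]) u2 (ltnW c23); rewrite !inE => ew.
have [c cc] := exists_notin (l := [:: w; e]) u2 c23.
rewrite !inE negb_or => /andP[cw ce].
have nac2 z : z \in c1 -> z != w -> z \notin c2.
  by move=> zc; apply: contraNN => zc2; rewrite (dj z zc zc2).
have ne z t : z \in c1 -> z != w -> t \in c2 -> z != t.
  by move=> zc zw tc; apply: contraTneq tc => <-; apply: nac2.
case eS : (par sg (KK S N)).
  apply: (@win_use [:: w; a] S _ (cedges c1) (cedges c2)) => //.
  - by rewrite /= inE eq_sym aw.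
  - by move=> z; rewrite !inE => /orP[]/eqP->; apply: s1.
  - apply: (@dec_close _ _ _ true).
    + by apply: link_sub (link_arcs o1 w1 ac _); [apply/allP|rewrite eq_sym].
    + by rewrite eq_sym.
    + by move: twa; case: (tau w); case: (tau a).
  move=> S' oS' mS' eS'.
  have inS' z : z \in S -> z != w -> z != a -> z \in S'.
    by move=> zS zw za; rewrite mS' zS !inE negb_or zw.
  have ea := ne a e ac aw ec; have ca := ne a c ac aw cc.
  have [|||S2 [pS2 oS2 _ mS2 eS2]] := @okS_split [:: e; c] S' oS'; rewrite /= ?inE 1?eq_sym ?ce //.
    by move=> z; rewrite !inE => /orP[]/eqP->; apply: inS' => //; [apply: s2|rewrite eq_sym|apply: s2|rewrite eq_sym].
  have bS2 : b \in S2.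
    by rewrite mS2 inS' //= ?s1 // !inE negb_or (ne b e) // (ne b c).
  have [t [S3 [pS3 _ d3 et [tb tS2 hb ht]]]] := okS_partner oS2 bS2.
  have tS' : t \in S' by move: tS2; rewrite mS2 => /andP[].
  (* Removing [w] and [a] has made the parity even and [e], [c] preserve it, so the partner of [b]
     has the colour of [b], which no vertex of [c2] other than [w] has. *)
  have eta : tau t = tau a.
    rewrite et mono1 //; move: eS' eS2; rewrite eS !par_KK_cons (mono2 e) // (mono2 c) //.
    move: twa; move: (tau w) (tau a) (par sg (KK S' N)) (par sg (KK S2 N)); rewrite /KK /par /=.
    by do 4!case.
  have tc : t \notin c2.
    apply/negP => tc; have : tau t = ~~ tau a.
      by apply: mono2 => //; move: tS'; rewrite mS' !inE negb_or => /andP[_ /andP[]].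
    by rewrite eta; case: (tau a).
  have [p [q h]] : exists p q, arcs c2 e c p q by apply: (ocyc_arcs o2); rewrite // eq_sym.
  apply: (@win_perm [:: e, c, b, t & S3] _ (cedges c2 ++ [::])); rewrite ?cats0 //.
    by rewrite perm_sym; apply: perm_trans pS2 _; rewrite !perm_cons.
  rewrite -[cedges c2]cats0; apply: (win_outside o2 V2 h _ hb ht _ tc); rewrite ?cats0 //.
  - by rewrite eq_sym.
  - exact: nac2.
have [|||S' [pS oS' hS' _ eS']] := @okS_split [:: a; e; b; c] S oS; rewrite //.
- rewrite /= !inE !negb_or !andbT (ne a e) // (ne a c) // (eq_sym a b) ba /=.
  by rewrite (eq_sym e b) (ne b e) // (ne b c) // (eq_sym e c) ce.
- by move=> z; rewrite !inE => /or4P[]/eqP->; [apply: s1|apply: s2|apply: s1|apply: s2].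
have {eS'} dS' : dec sg (KK S' N ++ [::]).
  rewrite cats0; apply: okS_dec => //; move: eS'; rewrite eS !par_KK_cons (mono2 e) // (mono2 c) // (mono1 b) //.
  move: (tau a) (par sg (KK S' N)); rewrite /KK /par /=; by do 2!case.
have /and5P[ha he hb hc _] := hS'.
(* The arcs of the two cycles are combined so that one path avoids [b] and the other avoids [c]. *)
have [p0 [p1 [h1 bp]]] : exists p0 p1, arcs c1 a w p0 p1 /\ b \notin p0.
  have [p [q h]] := ocyc_arcs o1 ac w1 aw.
  have [bp|bp] := boolP (b \in p); last by exists p, q.
  exists q, p; split; first exact: arcsC.
  by apply: contra bw => bq; rewrite (arcs_disj h bp bq).
have [r0 [r1 [h2 cr]]] : exists r0 r1, arcs c2 w e r0 r1 /\ c \notin r0.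
  have [p [q h]] : exists p q, arcs c2 w e p q by apply: (ocyc_arcs o2); rewrite // eq_sym.
  have [cp|cp] := boolP (c \in p); last by exists p, q.
  exists q, p; split; first exact: arcsC.
  by apply: contra ce => cq; rewrite (arcs_disj h cp cq).
have hcat r r' : xypath a w r -> xypath w e r' -> {subset a :: r <= c1} ->
    {subset w :: r' <= c2} -> [/\ xypath a e (r ++ r'),
    walk_edges a (r ++ r') = walk_edges a r ++ walk_edges w r' & all Hs (a :: r ++ r')].
  move=> hr hr' q1 q2; split.
  - by apply: xypath_cat hr hr' _ => t /q1 t1 /q2; apply: dj.
  - by rewrite walk_edges_cat (xypath_last hr).
  - apply/allP=> t; rewrite -cat_cons mem_cat => /orP[/q1/(allP V1)//|tr].
    by apply: (allP V2); apply: q2; rewrite inE tr orbT.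
case: (h1) => a1 a2 a3 a4 a5 _ _ _; case: (h2) => b1 b2 b3 b4 b5 _ _ _.
have [x11 x12 x13] := hcat _ _ a1 b2 a4 b5.
have [x21 x22 x23] := hcat _ _ a2 b1 a5 b4.
have bQ : b \notin a :: (p0 ++ r1).
  rewrite inE negb_or ba mem_cat negb_or bp; apply: contra (nac2 b bc bw) => br.
  by apply: b5; rewrite inE br orbT.
have cP : c \notin a :: (p1 ++ r0).
  rewrite inE negb_or eq_sym (ne a c) //= mem_cat negb_or cr andbT.
  by apply: contra cw => cp; rewrite (dj c) // a5 // inE cp orbT.
have ep := arcs_par o1 h1; have er := arcs_par o2 h2.
have nae : a != e by apply: ne.
have [n nN] := exN.
(* Both paths have the same parity, while exchanging [b] and [c], which differ in colour, flips the
   parity required by [win_step]. *)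
have [eq|neq] := eqVneq (par sg (walk_edges a (p0 ++ r1))) (sg [set a; n] (+) sg [set e; n] (+) true).
  apply: (@win_perm [:: a, e, b, c & S'] _
     (walk_edges a (p1 ++ r0) ++ walk_edges a (p0 ++ r1) ++ [::])); first by rewrite perm_sym.
    by rewrite x12 x22; clear -a3 b3; permc.
  apply: (win_step (n := n)) => //.
  by rewrite eq (mono1 b) // (mono2 e) //; case: (tau a); case: (sg _); case: (sg _).
apply: (@win_perm [:: a, e, c, b & S'] _
     (walk_edges a (p0 ++ r1) ++ walk_edges a (p1 ++ r0) ++ [::])).
- by rewrite perm_sym; apply: perm_trans pS _; permc.
- by rewrite x12 x22; clear -a3 b3; permc.
apply: (win_step (n := n)) => //.
rewrite (mono2 e) // (mono2 c) //; move: neq; rewrite x12 x22 !par_cat ep er.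
by case: (tau a); case: (sg _); case: (sg _); case: (par _ _); case: (par _ _).
Qed.

Lemma two_notin (c l : seq T) : uniq c -> (size l).+1 < size c ->
  exists x y, [/\ x \in c, y \in c, x != y, x \notin l & y \notin l].
Proof.
move=> uc lc; have [x xc xl] := exists_notin uc (ltnW lc).
have [y yc] := exists_notin (l := x :: l) uc lc.
by rewrite inE negb_or => /andP[yx yl]; exists x, y; rewrite eq_sym.
Qed.

Lemma ocyc_two c v : ocyc sg c -> exists x y, [/\ x \in c, y \in c, x != y, x != v & y != v].
Proof.
case/and3P=> c3 uc _; have [x [y [xc yc xy]]] := two_notin (l := [:: v]) uc c3.
by rewrite !inE => xv yv; exists x, y.
Qed.

Lemma ocyc_uniq c : ocyc sg c -> uniq c.
Proof. by case/and3P. Qed.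

Lemma ocyc_size c : ocyc sg c -> 2 < size c.
Proof. by case/and3P. Qed.

Lemma notin_neq (c : seq T) x y : x \in c -> y \notin c -> x != y.
Proof. by move=> xc; apply: contraNneq => <-. Qed.

(** Disjoint cycles, or cycles with equally coloured vertices on both sides of [w], disappear
    together and leave a vertex over. Otherwise [win_flower] applies with the cycles ordered by the
    colour of [w]. *)
Lemma win2 c1 c2 S : cactus sg [:: c1; c2] -> okS S -> {subset c1 <= S} ->
  {subset c2 <= S} -> win S (cedges c1 ++ cedges c2).
Proof.
move=> cF oS s1 s2; have [/= /and3P[o1 o2 _] _ _] := cF.
have c21 : c2 != c1 by have := cactus_uniq cF; rewrite /= inE eq_sym => /andP[].
have V1 := okS_all oS s1; have V2 := okS_all oS s2.
have [/hasP[w w1 w2]|/hasPn dj] := boolP (has (fun z => z \in c2) c1); last first.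
  have [x [y [xc yc xy exy]]] := colour_pair o1.
  have [x' [y' [xc' yc' xy' exy']]] := colour_pair o2.
  have ne z t : z \in c1 -> t \in c2 -> z != t.
    by move=> zc tc; rewrite eq_sym; apply: notin_neq tc _; apply: dj.
  apply: (@win_use [:: x; y; x'; y'] S _ (cedges c1 ++ cedges c2) [::]) => //.
  - by rewrite /= !inE !negb_or xy xy' !ne.
  - by move=> z; rewrite !inE => /or4P[]/eqP->; [apply: s1|apply: s1|apply: s2|apply: s2].
  - exact: dec_cycles.
  - by rewrite cats0.
  move=> S' oS' mS' _; apply: win_nil => //.
  have [z zc zxy] := exists_notin (l := [:: x; y]) (ocyc_uniq o1) (ocyc_size o1).
  have : z \in S'.
    rewrite mS' s1 //= !inE !negb_or (ne z x') // (ne z y') //.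
    by move: zxy; rewrite !inE negb_or => /andP[-> ->].
  by case: (S').
have dj z : z \in c1 -> z \in c2 -> z = w.
  by move=> z1 z2; apply: (cactus_share cF _ _ c21) => //; rewrite !inE eqxx ?orbT.
have [/hasP[y y1 /hasP[y' y2 /and3P[yw yw' /eqP e]]]|no] :=
    boolP (has (fun y => has (fun y' => [&& y != w, y' != w & tau y == tau y']) c2) c1).
  apply: (@win_use [:: y; y'] S _ (cedges c1 ++ cedges c2) [::]) => //.
  - by rewrite /= inE andbT; apply: contraNneq yw => e2; rewrite (dj y) // e2.
  - by move=> z; rewrite !inE => /orP[]/eqP->; [apply: s1|apply: s2].
  - exact: (dec_bowtie o1 o2 V1 V2 w1 w2).
  - by rewrite cats0.
  move=> S' oS' mS' _; apply: win_nil => //.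
  have : w \in S' by rewrite mS' s1 // !inE negb_or eq_sym yw eq_sym yw'.
  by case: (S').
have opp y y' : y \in c1 -> y' \in c2 -> y != w -> y' != w -> tau y' = ~~ tau y.
  move=> y1 y2 yw yw'; have : tau y != tau y'.
    by apply: contra no => e; apply/hasP; exists y => //; apply/hasP; exists y'; rewrite // yw yw'.
  by case: (tau y); case: (tau y').
have [a [_ [a1 _ _ aw _]]] := ocyc_two w o1.
have [e [_ [e2 _ _ ew _]]] := ocyc_two w o2.
have opp1 y : y \in c1 -> y != w -> tau y = tau a.
  by move=> y1 yw; apply: negb_inj; rewrite -(opp y e) // -(opp a e).
have opp2 y : y \in c2 -> y != w -> tau y = tau e.
  by move=> y2 yw; rewrite (opp a y) // (opp a e).
have [twa|twa] := boolP (tau w != tau a).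
  by apply: (win_flower o1 o2 oS s1 s2 w1 w2 dj a1 aw twa opp1) => y y2 yw; apply: opp.
apply: (@win_perm S _ (cedges c2 ++ cedges c1)); rewrite // 1?perm_catC //.
apply: (win_flower o2 o1 oS s2 s1 w2 w1 _ e2 ew) => //.
- by move=> z z2 z1; apply: dj.
- by move: twa; rewrite negbK (opp a e) // => /eqP->; case: (tau a).
- by move=> y y1 yw; rewrite (opp y e) // negbK.
Qed.

(** * Three odd cycles, two of them disjoint leaves *)

Section Three.
(** [c1] and [c2] are leaves attached at [v1] and [v2] and monochromatic elsewhere; [a], [a'] and
    [b], [b'] are samples of their other vertices. *)
Variables (c1 c2 m S : seq T) (v1 v2 a a' b b' : T).
Hypotheses (o1 : ocyc sg c1) (o2 : ocyc sg c2) (om : ocyc sg m) (oS : okS S).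
Hypotheses (s1 : {subset c1 <= S}) (s2 : {subset c2 <= S}) (sm : {subset m <= S}).
Hypothesis dj : forall z, z \in c1 -> z \notin c2.
Hypotheses (a1 : a \in c1) (a1' : a' \in c1) (aa' : a != a') (av : a != v1) (av' : a' != v1).
Hypotheses (b2 : b \in c2) (b2' : b' \in c2) (bb' : b != b') (bv : b != v2) (bv' : b' != v2).
Hypotheses (vc1 : v1 \in c1) (vc2 : v2 \in c2).
Hypothesis mono1 : forall y, y \in c1 -> y != v1 -> tau y = tau a.
Hypothesis mono2 : forall y, y \in c2 -> y != v2 -> tau y = tau b.
Hypothesis dj1 : forall z, z \in m -> z \in c1 -> z = v1.
Hypothesis dj2 : forall z, z \in m -> z \in c2 -> z = v2.

Let V1 := okS_all oS s1.
Let V2 := okS_all oS s2.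
Let Vm := okS_all oS sm.

Let ne12 z t : z \in c1 -> t \in c2 -> z != t.
Proof. by move=> zc tc; rewrite eq_sym; apply: notin_neq tc _; apply: dj. Qed.

Let n1m z : z \in c1 -> z != v1 -> z \notin m.
Proof. by move=> zc; apply: contraNN => zm; rewrite (dj1 zm zc). Qed.

Let n2m z : z \in c2 -> z != v2 -> z \notin m.
Proof. by move=> zc; apply: contraNN => zm; rewrite (dj2 zm zc). Qed.

Let sub2 z t : z \in S -> t \in S -> {subset [:: z; t] <= S}.
Proof. by move=> zS tS x; rewrite !inE => /orP[]/eqP->. Qed.

Lemma win3_join : (forall S', okS S' -> (forall z, z \in S' = (z \in S) && (z \notin [:: a; a'; b; b'])) ->
   {subset m <= S'} -> v1 \in S' -> v2 \in S' -> win S' (cedges m)) ->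
  win S (cedges c1 ++ cedges c2 ++ cedges m).
Proof.
move=> h; apply: (@win_use [:: a; a'; b; b'] S _ (cedges c1 ++ cedges c2) (cedges m)).
- by [].
- by rewrite /= !inE !negb_or aa' bb' !ne12.
- by move=> z; rewrite !inE => /or4P[]/eqP->; [apply: s1|apply: s1|apply: s2|apply: s2].
- by [].
- by apply: dec_cycles => //; [rewrite (mono1 a1')|rewrite (mono2 b2')].
- by rewrite catA.
move=> S' oS' mS' _; apply: h => //.
- move=> z zm; have zS := sm zm; rewrite mS' zS !inE !negb_or /=; apply/and4P.
  by split; apply: (notin_neq zm); [apply: n1m|apply: n1m|apply: n2m|apply: n2m].
- by rewrite mS' s1 // !inE !negb_or (ne12 vc1 b2) (ne12 vc1 b2') !(eq_sym v1) av av'.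
- by rewrite mS' s2 // !inE !negb_or !(eq_sym v2) (ne12 a1 vc2) (ne12 a1' vc2) bv bv'.
Qed.

(** [c1] and [m] go together as two cycles meeting in [v1]. The vertices [v1] and [a'] stay behind
    off [c2], which is what [win1] asks for. *)
Lemma win3_close y : v1 \in m -> y \in m -> y != v1 -> y \notin c2 -> tau y = tau a ->
  win S (cedges c1 ++ cedges c2 ++ cedges m).
Proof.
move=> vm ym yv yc2 e; have ya : y != a by apply: (notin_neq ym); apply: n1m.
apply: (@win_use [:: a; y] S _ (cedges c1 ++ cedges m) (cedges c2)) => //.
- by rewrite /= inE eq_sym ya.
- by apply: sub2; [apply: s1|apply: sm].
- by apply: (dec_bowtie o1 om V1 Vm vc1 vm) => // z z1 zm; apply: dj1.
- by clear; permc.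
move=> S' oS' mS' _; apply: win1 => //.
  move=> z z2; rewrite mS' s2 // !inE negb_or eq_sym ne12 //=.
  exact: notin_neq z2 yc2.
right; right; exists v1, a'; split; rewrite ?dj //.
- by rewrite mS' s1 // !inE negb_or !(eq_sym v1) av yv.
- rewrite mS' s1 // !inE negb_or eq_sym aa' eq_sym; apply: (notin_neq ym); exact: n1m.
- by rewrite eq_sym.
Qed.

(** After the leaves are joined, [v1] and [v2] are two vertices off [m]. *)
Lemma win3_apart : (forall z, z \in m -> z \notin c1) -> (forall z, z \in m -> z \notin c2) ->
  win S (cedges c1 ++ cedges c2 ++ cedges m).
Proof.
move=> m1 m2; apply: win3_join => S' oS' mS' sm' v1S v2S.
apply: win1 => //; right; right; exists v1, v2; split=> //.
- by apply: contraL vc1; apply: m1.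
- by apply: contraL vc2; apply: m2.
- exact: ne12.
Qed.

(** If [win3_close] does not apply, [m] without [v1] has the colour opposite to [c1] without [v1].
    So [v1] disagrees with one of these two cycles, which is kept for last and handled by
    [win_mixed]. *)
Lemma win3_one : v1 \in m -> (forall z, z \in m -> z \notin c2) ->
  win S (cedges c1 ++ cedges c2 ++ cedges m).
Proof.
move=> vm m2.
have [/hasP[y ym /andP[yv /eqP e]]|/hasPn no] := boolP (has (fun y => (y != v1) && (tau y == tau a)) m).
  by apply: (win3_close vm ym) => //; apply: m2.
have opp y : y \in m -> y != v1 -> tau y = ~~ tau a.
  by move=> /no + yv; rewrite yv /=; case: (tau y); case: (tau a).
have [y [y' [ym ym' yy' yv yv']]] := ocyc_two v1 om.
have [e|ne] := eqVneq (tau v1) (tau a).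
  apply: win3_join => S' oS' mS' sm' v1S v2S.
  apply: (@win_mixed m S' v1 y v2 om Vm oS' vm ym (sm' _ vm) (sm' _ ym)) => //.
  - by rewrite e (opp y) //; case: (tau a).
  - by rewrite eq_sym ne12.
  - exact: notin_neq vc2 (m2 _ ym).
have nm2 z t : z \in m -> t \in c2 -> z != t.
  by move=> zm tc; rewrite eq_sym; apply: notin_neq tc _; apply: m2.
apply: (@win_use [:: y; y'; b; b'] S _ (cedges m ++ cedges c2) (cedges c1)) => //.
- by rewrite /= !inE !negb_or yy' bb' !nm2.
- by move=> z; rewrite !inE => /or4P[]/eqP->; [apply: sm|apply: sm|apply: s2|apply: s2].
- by apply: dec_cycles => //; rewrite ?(opp y) ?(opp y') // (mono2 b2').
- by clear; permc.
move=> S' oS' mS' _.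
have n1y z : z \in c1 -> z != y /\ z != y'.
  move=> z1; split; [move: yv|move: yv']; apply: contraNneq => ez.
    by rewrite (dj1 ym) // -ez.
  by rewrite (dj1 ym') // -ez.
have in1 z : z \in c1 -> z \in S'.
  by move=> z1; have [h1 h2] := n1y z z1; rewrite mS' s1 // !inE !negb_or h1 h2 !ne12.
apply: (@win_mixed c1 S' v1 a a'); rewrite ?in1 //.
by rewrite eq_sym.
Qed.

(** If [y] disagrees with both leaves, all three cycles are absorbed at once: two paths from [y] to
    [b] through [v2] are joined with the two arcs between [a] and [a']. Because [m] and [c1] share
    [v1], the arc of [m] that avoids [v1] is matched with the arc of [c1] that may contain it, and
    vice versa. *)
Lemma win3_chain : v1 \in m -> v2 \in m -> win S (cedges c1 ++ cedges c2 ++ cedges m).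
Proof.
move=> vm1 vm2; have v12 : v1 != v2 by apply: ne12.
have [y ym] := exists_notin (l := [:: v1; v2]) (ocyc_uniq om) (ocyc_size om).
rewrite !inE negb_or => /andP[yv1 yv2].
have y1 : y \notin c1 by apply: contra yv1 => y1; rewrite (dj1 ym y1).
have y2 : y \notin c2 by apply: contra yv2 => y2; rewrite (dj2 ym y2).
have [e|nea] := eqVneq (tau y) (tau a); first exact: (win3_close vm1 ym).
have [e|neb] := eqVneq (tau y) (tau b).
  have yb : y != b by apply: (notin_neq ym); apply: n2m.
  apply: (@win_use [:: b; y] S _ (cedges c2 ++ cedges m) (cedges c1)) => //.
  - by rewrite /= inE eq_sym yb.
  - by apply: sub2; [apply: s2|apply: sm].
  - by apply: (dec_bowtie o2 om V2 Vm vc2 vm2) => // z z1 zm; apply: dj2.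
  - by clear; permc.
  move=> S' oS' mS' _; apply: win1 => //.
    move=> z z2; rewrite mS' s1 // !inE negb_or ne12 //=.
    exact: notin_neq z2 y1.
  have n21 z : z \in c2 -> z \notin c1 by apply: contraL; apply: dj.
  right; right; exists v2, b'; split; rewrite ?n21 //.
  - by rewrite mS' s2 // !inE negb_or !(eq_sym v2) bv yv2.
  - by rewrite mS' s2 // !inE negb_or eq_sym bb' eq_sym; apply: (notin_neq ym); apply: n2m.
  - by rewrite eq_sym.
have [yb ya ya'] : [/\ y != b, y != a & y != a'].
  by split; apply: (notin_neq ym); [apply: n2m|apply: n1m|apply: n1m].
have u4 : uniq [:: y; b; a; a'].
  by rewrite /= !inE !negb_or yb ya ya' aa' !(eq_sym b) (ne12 a1 b2) (ne12 a1' b2).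
apply: (@win_use [:: y; b; a; a'] S _ (cedges c1 ++ cedges c2 ++ cedges m) [::]) => //.
- by move=> z; rewrite !inE => /or4P[]/eqP->; [apply: sm|apply: s2|apply: s1|apply: s1].
(* Complementing the arcs in three odd cycles flips the parity three times, hence [true]; the
   colours agree with this, as [y] and [b] differ and [a] and [a'] do not. *)
- apply: (@dec_join _ _ _ _ _ true).
  + move=> g.
    have [p1 [p2 [h1 vp1]]] : exists p1 p2, arcs m y v2 p1 p2 /\ v1 \notin p1.
      have [p [q h]] := ocyc_arcs om ym vm2 yv2.
      have [vp|vp] := boolP (v1 \in p); last by exists p, q.
      exists q, p; split; first exact: arcsC.
      by apply: contra v12 => vq; apply/eqP; apply: (arcs_disj h).
    have [u1 [u2 [h2 vu1]]] : exists u1 u2, arcs c1 a a' u1 u2 /\ v1 \notin u1.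
      have [p [q h]] := ocyc_arcs o1 a1 a1' aa'.
      have [vp|vp] := boolP (v1 \in p); last by exists p, q.
      exists q, p; split; first exact: arcsC.
      by apply: contra av' => vq; rewrite (arcs_disj h vp vq).
    have [r [r' h3]] : exists r r', arcs c2 v2 b r r' by apply: (ocyc_arcs o2); rewrite // eq_sym.
    wlog e : r r' h3 / par sg (walk_edges y p1) (+) par sg (walk_edges v2 r) (+) par sg (walk_edges a u2) = g => [H|].
      have [e|ne] := eqVneq (par sg (walk_edges y p1) (+) par sg (walk_edges v2 r) (+) par sg (walk_edges a u2)) g.
        exact: H h3 e.
      apply: (H r' r); first exact: arcsC.
      by move: ne {H}; rewrite (arcs_par o2 h3); case: (par _ _); case: (par _ _); case: (par _ _); case: g.
    have hcat X Y : xypath y v2 X -> xypath v2 b Y -> {subset y :: X <= m} ->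
        {subset v2 :: Y <= c2} -> [/\ xypath y b (X ++ Y),
        walk_edges y (X ++ Y) = walk_edges y X ++ walk_edges v2 Y,
        all Hs (y :: X ++ Y) & forall z, z \in y :: X ++ Y -> z \in c1 -> z = v1 /\ z \in X].
      move=> ht ht' q1 q2; split.
      - by apply: xypath_cat ht ht' _ => z /q1 t1 /q2; apply: dj2.
      - by rewrite walk_edges_cat (xypath_last ht).
      - apply/allP=> z; rewrite -cat_cons mem_cat => /orP[/q1/(allP Vm)//|tr].
        by apply: (allP V2); apply: q2; rewrite inE tr orbT.
      - move=> z; rewrite inE mem_cat => /or3P[/eqP->|zt|zt] z1.
        + by move: y1; rewrite z1.
        + by split=> //; apply: dj1 => //; apply: q1; rewrite inE zt orbT.
        + by move: (dj z1); rewrite q2 // inE zt orbT.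
    case: (h1) => f1 f2 f3 f4 f5 _ _ _; case: (h2) => g1 g2 g3 g4 g5 _ _ _.
    case: (h3) => k1 k2 k3 k4 k5 _ _ _.
    have [x11 x12 x13 x14] := hcat _ _ f1 k1 f4 k4.
    have [x21 x22 x23 x24] := hcat _ _ f2 k2 f5 k5.
    exists (p1 ++ r), (p2 ++ r'), u2, u1; split=> //.
    * by rewrite x12 x22; clear -f3 g3 k3; permc.
    * by rewrite x12 par_cat.
    * rewrite x22 par_cat -e (arcs_par om h1) (arcs_par o2 h3) (arcs_par o1 h2).
      by case: (par _ _); case: (par _ _); case: (par _ _).
    * split.
      - move=> z zp; apply/negP => /g5 z1; have [ez zp1] := x14 z zp z1.
        by move: vp1; rewrite -ez zp1.
      - move=> z zp; apply/negP => zu; have [ez _] := x24 z zp (g4 z zu).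
        move: zu; rewrite ez inE eq_sym (negPf av) /=; exact/negP.
      - have Va X : {subset a :: X <= c1} -> all Hs (a :: X).
          by move=> h; apply/allP=> z /h/(allP V1).
        by rewrite x13 x23 (Va u2 g5) (Va u1 g4).
  + by [].
  + rewrite (mono1 a1') //; move: nea neb; by case: (tau y); case: (tau a); case: (tau b).
- by rewrite cats0.
move=> S' oS' mS' _; apply: win_nil => //.
have : v1 \in S'.
  by rewrite mS' s1 // !inE !negb_or !(eq_sym v1) yv1 av av' (eq_sym b) ne12.
by case: (S').
Qed.

End Three.

(** Induction on the number of cycles. Vertices used up with a removed cycle lie on no surviving
    one, so the rest is again a cactus inside the remaining set. *)
Lemma win_many F S : cactus sg F -> okS S -> (forall c, c \in F -> {subset c <= S}) ->
  1 < size F -> win S (fedges F).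
Proof.
have [k] := ubnP (size F); elim: k F S => // k IH F S sFk cF oS sF F1.
have oF c : c \in F -> ocyc sg c by case: cF => /allP h _ _; apply: h.
have share c d x y : c \in F -> d \in F -> d != c ->
    x \in c -> x \in d -> y \in c -> y \in d -> x = y by apply: cactus_share cF.
have uF := cactus_uniq cF.
have V c : c \in F -> all Hs c by move=> cF'; apply: okS_all oS (sF c cF').
have take2 c d : c \in F -> d \in F -> d != c -> exists F2,
    [/\ perm_eq F [:: c, d & F2], size F = (size F2).+2,
        forall e, e \in F2 -> [/\ e \in F, e != c & e != d] & cactus sg F2].
  move=> hc hd dc; have [|F2 pF] := perm_pick2 hc hd; first by rewrite eq_sym.
  have cF2 := cactus_perm pF cF; exists F2; split=> //.
  - by rewrite (perm_size pF).
  - have := uF; rewrite (perm_uniq pF) /= !inE negb_or => /and3P[/andP[_ cn] dn _] e eF2.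
    rewrite (perm_mem pF) !inE eF2 !orbT; split=> //.
      by apply: contraNneq cn => <-.
    by apply: contraNneq dn => <-.
  - exact: cactus_cons (cactus_cons cF2).
have [F3|] := ltnP 2 (size F); last first.
  case: F sFk cF oF share uF V take2 sF F1 => [|c1 [|c2 [|? ?]]] // _ cF _ _ _ _ _ sF _ _.
  rewrite /fedges /= cats0; apply: win2 => //; apply: sF; rewrite !inE eqxx ?orbT //.
(* The induction needs two cycles. A single one is left to [win1], and the two vertices off all
   remaining cycles secure its hypothesis. *)
have finish F2 S' : size F2 < size F -> 0 < size F2 -> cactus sg F2 -> okS S' ->
    (forall c, c \in F2 -> {subset c <= S'}) ->
    (exists s t, [/\ s \in S', t \in S', s != t & forall c, c \in F2 -> s \notin c /\ t \notin c]) ->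
    win S' (fedges F2).
  case: F2 => [|c [|d F2]] // sz _ cF2 oS' sF2 [s [t [sS tS st nst]]]; last first.
    by apply: IH => //; apply: leq_trans sz _; rewrite -ltnS.
  rewrite /fedges /= cats0; have [h1 h2] := nst c (mem_head _ _).
  apply: win1 => //; first by have [/= /andP[]] := cF2.
    by apply: sF2; rewrite mem_head.
  by right; right; exists s, t.
case: (two_leaves cF F1) => [[c1 [c2 [v1 [v2 [[c1F vc1 l1] [c2F vc2 l2] c21 dj]]]]]|[v hv]]; last first.
  (* When all cycles pass through [v], two among any three have equally coloured vertices other than
     [v]. *)
  have [c [d [y [y' [cF' dF' dc [yc yd yv yv' e]]]]]] : exists c d y y',
     [/\ c \in F, d \in F, d != c & [/\ y \in c, y' \in d, y != v, y' != v & tau y = tau y']].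
    case: F uF oF F3 {IH sFk cF share take2 sF F1 V finish hv} => [|a [|b [|c F]]] //.
    rewrite /= !inE !negb_or => /and3P[/and3P[ab ac _] /andP[bc _] _] oF _.
    have [aF bF cF] : [/\ a \in [:: a, b, c & F], b \in [:: a, b, c & F] & c \in [:: a, b, c & F]].
      by rewrite !inE !eqxx !orbT.
    have [ya [_ [ha _ _ hav _]]] := ocyc_two v (oF a aF).
    have [yb [_ [hb _ _ hbv _]]] := ocyc_two v (oF b bF).
    have [yc [_ [hc _ _ hcv _]]] := ocyc_two v (oF c cF).
    have [eab|nab] := eqVneq (tau ya) (tau yb).
      by exists a, b, ya, yb; rewrite aF bF eq_sym ab.
    have [eac|nac] := eqVneq (tau ya) (tau yc).
      by exists a, c, ya, yc; rewrite aF cF eq_sym ac.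
    exists b, c, yb, yc; rewrite bF cF eq_sym bc; split=> //; split=> //.
    by move: nab nac; case: (tau ya); case: (tau yb); case: (tau yc).
  have [F2 [pF szF mF2 cF2]] := take2 c d cF' dF' dc.
  have dj z : z \in c -> z \in d -> z = v.
    by move=> zc zd; apply: (share c d); rewrite ?hv.
  have nF2 b z e0 : b \in F -> z \in b -> z != v -> e0 \in F -> e0 != b -> z \notin e0.
    move=> bF zb zv eF eb; apply: contra zv => ze; apply/eqP.
    by apply: (share b e0); rewrite ?hv.
  apply: (@win_use [:: y; y'] S _ (cedges c ++ cedges d) (fedges F2)) => //.
  - by rewrite /= inE andbT; apply: contraNneq yv => e2; rewrite (dj y) // e2.
  - by move=> z; rewrite !inE => /orP[]/eqP->; [apply: (sF c)|apply: (sF d)].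
  - by apply: (dec_bowtie (oF c cF') (oF d dF') (V c cF') (V d dF') (hv c cF') (hv d dF')).
  - by rewrite -catA; apply: (perm_fedges pF).
  move=> S' oS' mS' _; apply: finish => //.
  - by rewrite szF ltnS leqnSn.
  - by move: F3; rewrite szF; case: (size F2).
  - move=> e0 /mF2[eF ec ed] z ze; have zS := sF e0 eF z ze.
    rewrite mS' zS !inE negb_or.
    by rewrite (notin_neq ze (nF2 c y e0 _ _ _ _ _)) ?(notin_neq ze (nF2 d y' e0 _ _ _ _ _)).
  have [z zc] := exists_notin (l := [:: v; y]) (ocyc_uniq (oF c cF')) (ocyc_size (oF c cF')).
  rewrite !inE negb_or => /andP[zv zy].
  have [t td] := exists_notin (l := [:: v; y']) (ocyc_uniq (oF d dF')) (ocyc_size (oF d dF')).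
  rewrite !inE negb_or => /andP[tv ty].
  have cd : c != d by rewrite eq_sym.
  exists z, t; split.
  - rewrite mS' (sF c) // !inE negb_or zy; apply: (notin_neq zc); exact: (nF2 d).
  - rewrite mS' (sF d) // !inE negb_or ty andbT; apply: (notin_neq td); exact: (nF2 c).
  - by apply: (notin_neq zc); apply: (nF2 d).
  - by move=> e0 /mF2[eF ec ed]; split; [apply: (nF2 c)|apply: (nF2 d)].
have p1 z e : z \in c1 -> z != v1 -> e \in F -> e != c1 -> z \notin e.
  by move=> zc zv eF ec; apply: contra zv => ze; apply/eqP; apply: (l1 e).
have p2 z e : z \in c2 -> z != v2 -> e \in F -> e != c2 -> z \notin e.
  by move=> zc zv eF ec; apply: contra zv => ze; apply/eqP; apply: (l2 e).
(* A leaf with both colours away from its attachment vertex can be removed by itself. *)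
have kill c v x y : c \in F -> (forall z e, z \in c -> z != v -> e \in F -> e != c -> z \notin e) ->
    x \in c -> y \in c -> x != v -> y != v -> tau x != tau y -> win S (fedges F).
  move=> cF' pc xc yc xv yv ne.
  have nxy : x != y by apply: contraNneq ne => ->.
  have pF := perm_to_rem cF'.
  apply: (@win_use [:: x; y] S _ (cedges c) (fedges (rem c F))) => //.
  - by rewrite /= inE nxy.
  - by move=> z; rewrite !inE => /orP[]/eqP->; apply: (sF c).
  - apply: (@dec_close _ _ _ true) => //.
      by apply: link_sub (link_arcs (oF c cF') xc yc nxy); apply/allP; apply: V.
    by move: ne; case: (tau x); case: (tau y).
  - exact: (perm_fedges pF).
  move=> S' oS' mS' _.
  have := perm_size pF => /= sz.
  have cr := cactus_cons (cactus_perm pF cF).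
  have rF e : e \in rem c F -> e \in F /\ e != c.
    by rewrite (mem_rem_uniq _ uF) inE => /andP[].
  apply: IH => //.
  - by move: sFk; rewrite sz ltnS.
  - move=> e /rF[eF ec] z ze; have zS := sF e eF z ze; rewrite mS' zS !inE negb_or.
    by rewrite (notin_neq ze (pc x e _ _ _ _)) ?(notin_neq ze (pc y e _ _ _ _)).
  - by move: F3; rewrite sz ltnS.
have [a [a' [a1 a1' aa' av av']]] := ocyc_two v1 (oF c1 c1F).
have [b [b' [b2 b2' bb' bv bv']]] := ocyc_two v2 (oF c2 c2F).
have [/hasP[x xc /andP[xv ne]]|/hasPn mono1] := boolP (has (fun x => (x != v1) && (tau x != tau a)) c1).
  exact: (kill c1 v1 x a).
have [/hasP[x xc /andP[xv ne]]|/hasPn mono2] := boolP (has (fun x => (x != v2) && (tau x != tau b)) c2).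
  exact: (kill c2 v2 x b).
have {}mono1 y : y \in c1 -> y != v1 -> tau y = tau a.
  by move=> /mono1 + yv; rewrite yv /= negbK => /eqP.
have {}mono2 y : y \in c2 -> y != v2 -> tau y = tau b.
  by move=> /mono2 + yv; rewrite yv /= negbK => /eqP.
have [F2 [pF szF mF2 cF2]] := take2 c1 c2 c1F c2F c21.
have o1 := oF _ c1F; have o2 := oF _ c2F.
have ne12 z t : z \in c1 -> t \in c2 -> z != t.
  by move=> zc tc; rewrite eq_sym; apply: notin_neq tc _; apply: dj.
(* Both leaves are now monochromatic off their attachment vertices. They are removed together if at
   least two cycles remain for the induction. *)
have [F22|] := ltnP 1 (size F2).
  apply: (@win_use [:: a; a'; b; b'] S _ (cedges c1 ++ cedges c2) (fedges F2)) => //.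
  - by rewrite /= !inE !negb_or aa' bb' !ne12.
  - by move=> z; rewrite !inE => /or4P[]/eqP->; [apply: (sF c1)|apply: (sF c1)|apply: (sF c2)|apply: (sF c2)].
  - by apply: dec_cycles; rewrite ?V //; [rewrite (mono1 a')|rewrite (mono2 b')].
  - by rewrite -catA; apply: (perm_fedges pF).
  move=> S' oS' mS' _; apply: IH => //; first by move: sFk; rewrite szF ltnS => /ltnW.
  move=> e /mF2[eF ec ed] z ze; have zS := sF e eF z ze; rewrite mS' zS !inE !negb_or /=.
  by apply/and4P; split; apply: (notin_neq ze); [apply: p1|apply: p1|apply: p2|apply: p2].
case: F2 pF szF mF2 cF2 => [|m [|? ?]] // pF szF mF2 cF2 _; first by rewrite szF in F3.
have [mF mc1 mc2] := mF2 m (mem_head _ _).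
have dj1 z : z \in m -> z \in c1 -> z = v1 by move=> zm z1; apply: (l1 m).
have dj2 z : z \in m -> z \in c2 -> z = v2 by move=> zm z1; apply: (l2 m).
have om := oF m mF.
have dj' z : z \in c2 -> z \notin c1 by apply: contraL; apply: dj.
suff h : win S (cedges c1 ++ cedges c2 ++ cedges m).
  apply: win_perm h => //; rewrite perm_sym; apply: perm_trans (perm_fedges pF) _.
  by rewrite /fedges /= cats0.
have [s1 s2 sm] := And3 (sF c1 c1F) (sF c2 c2F) (sF m mF).
have [/hasP[z1 zm1 zc1]|/hasPn n1] := boolP (has (fun z => z \in c1) m).
  have {z1 zm1 zc1} vm1 : v1 \in m by rewrite -(dj1 z1).
  have [/hasP[z2 zm2 zc2]|/hasPn n2] := boolP (has (fun z => z \in c2) m).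
    have {z2 zm2 zc2} vm2 : v2 \in m by rewrite -(dj2 z2).
    by apply: (@win3_chain c1 c2 m S v1 v2 a a' b b').
  by apply: (@win3_one c1 c2 m S v1 v2 a a' b b').
have [/hasP[z2 zm2 zc2]|/hasPn n2] := boolP (has (fun z => z \in c2) m).
  have {z2 zm2 zc2} vm2 : v2 \in m by rewrite -(dj2 z2).
  apply: (@win_perm S _ (cedges c2 ++ cedges c1 ++ cedges m)) => //; first by clear; permc.
  by apply: (@win3_one c2 c1 m S v2 v1 b b' a a').
by apply: (@win3_apart c1 c2 m S v1 v2 a a' b b').
Qed.

(** The last hypothesis is the only trace of the co-claw: a single triangle, four vertices in all,
    and [size N = 2]. *)
Lemma win_cactus F S : cactus sg F -> okS S -> S != [::] ->
  (forall c, c \in F -> {subset c <= S}) ->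
  (forall c, F = [:: c] -> size S = 4 -> size c = 3 -> 3 < size N) ->
  win S (fedges F).
Proof.
case: F => [|c [|d F]] cF oS S0 sF hb; first exact: win_nil.
  rewrite /fedges /= cats0; have [/= /andP[oc _] _ _] := cF.
  have sc : {subset c <= S} by apply: sF; rewrite mem_head.
  apply: win1 => //.
  have [c4|c3] := ltnP 3 (size c); first by left.
  right; have e3 : size c = 3 by apply/eqP; rewrite eqn_leq c3; case/and3P: oc.
  have [e4|n4] := eqVneq (size S) 4; first by left; apply: (hb c).
  (* [size S] is even, at least 3 and not 4, so at least two vertices lie off the triangle. *)
  right; have /and3P[uS _ eS] := oS.
  have [|s [t [sS tS st sc' tc]]] := two_notin (l := c) uS.
    have : size c <= size S by apply: uniq_leq_size => //; apply: ocyc_uniq.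
    by move: n4 eS; rewrite e3; clear; lia.
  by exists s, t.
exact: win_many.
Qed.

End Gadgets.

(** * Splitting an even graph into even cycles and a cactus *)

Section Veblen.
Variables (T : finType) (sg : pred {set T}).
Implicit Types (x y z : T) (c s : seq T) (E : seq {set T}).

Definition even_graph E := [/\ uniq E,
  forall d, d \in E -> exists a b, a != b /\ d = [set a; b] &
  forall x, ~~ odd (count (fun d : {set T} => x \in d) E)].

Lemma even_graph_perm E1 E2 : perm_eq E1 E2 -> even_graph E1 -> even_graph E2.
Proof.
move=> h [h1 h2 h3]; split; first by rewrite -(perm_uniq h).
  by move=> d; rewrite -(perm_mem h); apply: h2.
by move=> x; rewrite -(permP h).
Qed.

(** Passing through a vertex uses two edges, so only the ends of the walk affect parity; members of
    [E] being genuine pairs excludes loops. *)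
Lemma count_walk E x a s : (forall d, d \in E -> exists a b, a != b /\ d = [set a; b]) ->
  {subset walk_edges a s <= E} ->
  odd (count (fun d : {set T} => x \in d) (walk_edges a s)) = (x == a) (+) (x == last a s).
Proof.
move=> hE; elim: s a => [|b s IH] a /= h; first by rewrite addbb.
rewrite oddD IH => [|d ds]; last by apply: h; rewrite inE ds orbT.
have ab : a != b.
  have [|u [v [uv e]]] := hE [set a; b]; first by apply: h; rewrite mem_head.
  apply: contraNneq uv => ab; rewrite ab setUid in e.
  have : u \in [set b] by rewrite e !inE eqxx.
  have : v \in [set b] by rewrite e !inE eqxx orbT.
  by rewrite !inE => /eqP-> /eqP->.
rewrite !inE oddb; case: (x =P a) => [->|_]; first by rewrite (negPf ab); case: (a == _).
by case: (x == b); case: (x == _).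
Qed.

Lemma even_graph_sub E1 E2 c : even_graph (E1 ++ E2) -> perm_eq E1 (cedges c) -> even_graph E2.
Proof.
move=> [u hE hd] pc; split.
- by move: u; rewrite cat_uniq => /and3P[].
- by move=> d dE; apply: hE; rewrite mem_cat dE orbT.
- move=> x; have := hd x; rewrite count_cat oddD (permP pc).
  case: c pc => [|a s] //= pc; rewrite (count_walk (E := E1 ++ E2)) //.
    by rewrite last_rcons addbb.
  by move=> d ds; rewrite mem_cat (perm_mem pc) ds.
Qed.

(** A path is extended at its first vertex, where even degree provides a second edge, until the new
    vertex already lies on the path. In [key], the number [n] bounds the extensions still
    possible. *)
Lemma even_graph_cycle E : even_graph E -> E != [::] ->
  exists c, [/\ uniq c, 2 < size c & {subset cedges c <= E}].
Proof.
move=> [uE hE hd] E0.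
have key n x h s : #|T| < n + size (x :: h :: s) -> uniq (x :: h :: s) ->
    {subset walk_edges x (h :: s) <= E} ->
    exists c, [/\ uniq c, 2 < size c & {subset cedges c <= E}].
  elim: n x h s => [|n IH] x h s hn us sE.
    by move: hn; rewrite add0n ltnNge -(card_uniqP us) max_card.
  have xhE : [set x; h] \in E by apply: sE; rewrite mem_head.
  have [E' pE] := perm_pick xhE.
  have [d dE' xd] : exists2 d, d \in E' & x \in d.
    apply/hasP; rewrite has_count; have := hd x.
    by rewrite (permP pE) /= !inE eqxx /= negbK; case: (count _ _).
  have dE : d \in E by rewrite (perm_mem pE) inE dE' orbT.
  have dn : d != [set x; h].
    by have := uE; rewrite (perm_uniq pE) /= => /andP[+ _]; apply: contraNneq => <-.
  have [y [xy ed]] : exists y, x != y /\ d = [set x; y].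
    have [a [b [ab e]]] := hE d dE; move: xd; rewrite e !inE => /orP[]/eqP ->.
      by exists b.
    by exists a; rewrite eq_sym setUC.
  subst d; have yh : y != h by apply: contraNneq dn => ->.
  have [ys|ys] := boolP (y \in s); last first.
    apply: (IH y x (h :: s)).
    - by move: hn => /=; clear; lia.
    - by rewrite cons_uniq us inE negb_or eq_sym xy inE negb_or yh ys.
    - by move=> d; rewrite /= inE setUC => /predU1P[->|/sE].
  case/splitPr: ys us sE {hn} => s1 s2 us sE; exists (x :: h :: rcons s1 y); split.
  - by move: us; rewrite -cat_rcons -2!cat_cons cat_uniq => /andP[].
  - by rewrite /= size_rcons.
  - move=> d; rewrite cedges_cons mem_rcons inE => /predU1P[->|ds].
      by rewrite /= last_rcons setUC.
    by apply: sE; rewrite -cat_rcons -cat_cons walk_edges_cat mem_cat ds.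
have [d dE] : exists d, d \in E by case: E E0 {uE hE hd key} => // d E; exists d; rewrite mem_head.
have [a [b [ab e]]] := hE d dE.
apply: (key #|T| a b [::]) => /=; first by lia.
  by rewrite inE ab.
by move=> d'; rewrite inE => /eqP->; rewrite -e.
Qed.

Lemma perm_subset_cat E1 E : uniq E1 -> uniq E -> {subset E1 <= E} ->
  exists E2, perm_eq E (E1 ++ E2).
Proof. by move=> u1 u s; have [E2 [p _ _]] := perm_split u1 u s; exists E2. Qed.

Lemma uniq_walk_edges x s : uniq (x :: s) -> uniq (walk_edges x s).
Proof.
elim: s x => //= y s IH x /andP[xs us]; rewrite IH // andbT.
by apply: contra xs => h; apply: (mem_walk_edges h); rewrite !inE eqxx.
Qed.

Lemma uniq_cedges c : uniq c -> 2 < size c -> uniq (cedges c).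
Proof.
case: c => [|x [|y s]] // us s2; rewrite cedges_cons rcons_uniq uniq_walk_edges // andbT.
rewrite /= inE negb_or; move: us; rewrite cons_uniq => /andP[xs us].
apply/andP; split; last first.
  by apply: contra xs => h; apply: (mem_walk_edges h); rewrite !inE eqxx orbT.
apply: contraTneq s2 => e; suff -> : s = [::] by [].
have yl : last y s = y.
  have : last y s \in [set x; y] by rewrite -e !inE eqxx.
  rewrite !inE => /orP[/eqP h|/eqP//].
  by move: xs; rewrite -h mem_last.
by case: s us yl {xs e} => //= z s /and3P[ys _ _] yl; move: ys; rewrite -{1}yl mem_last.
Qed.

(** Once no even cycle is left, an arbitrary decomposition of the remaining even graph into cycles
    consists of odd ones and is a cactus. *)
Lemma even_graph_decomp E : even_graph E ->
  exists R0 F, [/\ perm_eq E (R0 ++ fedges F), dec sg R0 & cactus sg F].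
Proof.
have [n] := ubnP (size E); elim: n E => // n IH E sE eE; have [uE _ _] := eE.
have rem_cycle c : uniq c -> 2 < size c -> {subset cedges c <= E} ->
    exists E2, [/\ perm_eq E (cedges c ++ E2), size E2 < n & even_graph E2].
  move=> uc c2 sc; have [E2 pE] := perm_subset_cat (uniq_cedges uc c2) uE sc.
  exists E2; split=> //; last exact: even_graph_sub (even_graph_perm pE eE) (perm_refl _).
  move: sE; rewrite (perm_size pE) size_cat; case: c c2 {uc sc pE} => // a c _.
  by rewrite cedges_cons size_rcons addSn ltnS; apply: leq_ltn_trans; apply: leq_addl.
(* A cycle has at most [#|T|] vertices, so a search through bounded sequences decides whether an
   even one exists. *)
have [/existsP[c /andP[ec /allP sc]]|noeven] :=
    boolP [exists c : {bseq #|T| of T}, ecyc sg c && all [in E] (cedges c)].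
  have /and3P[c2 uc _] := ec; have [E2 [pE sE2 eE2]] := rem_cycle c uc c2 sc.
  have [R0 [F [p2 dR cF]]] := IH E2 sE2 eE2.
  exists (cedges c ++ R0), F; split=> //; first by clear -pE p2; permc.
  exact: dec_cat (dec_ecyc ec) dR.
have {}noeven c : ecyc sg c -> ~ {subset cedges c <= E}.
  move=> ec sc; move/negP: noeven; apply; have /and3P[_ uc _] := ec.
  have sz : size c <= #|T| by rewrite -(card_uniqP uc) max_card.
  by apply/existsP; exists (Bseq sz); rewrite /= ec; apply/allP.
exists [::]; have dn := dec_nil sg.
suff [F [pF oF]] : exists F, perm_eq E (fedges F) /\ all (ocyc sg) F.
  exists F; split=> //; split=> //; first by rewrite -(perm_uniq pF).
  by move=> c ec sc; apply: (noeven c ec) => d /sc; rewrite (perm_mem pF).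
have [m] := ubnP (size E).
elim: m E eE uE noeven {IH rem_cycle sE} => // m IH E eE uE noeven sE.
have [->|E0] := eqVneq E [::]; first by exists [::].
have [c [uc c2 sc]] := even_graph_cycle eE E0.
have [E2 pE] := perm_subset_cat (uniq_cedges uc c2) uE sc.
have eE2 := even_graph_sub (even_graph_perm pE eE) (perm_refl _).
have [||F [pF oF]] := IH E2 eE2 (let: And3 u _ _ := eE2 in u).
- by move=> c' /noeven nc s'; apply: nc => d /s' dE; rewrite (perm_mem pE) mem_cat dE orbT.
- move: sE; rewrite (perm_size pE) size_cat; case: c c2 {uc sc pE} => // a c _.
  by rewrite cedges_cons size_rcons addSn ltnS; apply: leq_ltn_trans; apply: leq_addl.
exists (c :: F); split; first by apply: perm_trans pE _; rewrite perm_cat2l.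
rewrite /= oF andbT /ocyc uc c2 /=; apply: contraT => ne.
by case: (noeven c); rewrite // /ecyc uc c2.
Qed.

End Veblen.

(** * Subdivisions and signatures *)

Section Subdivision.
Variables (G K : sgraph) (f : G -> K) (p : G -> G -> seq K).
Hypothesis S : subdivides_via f p.
Implicit Types (x y z : G) (s t c : seq G) (d : {set G}) (e : {set K}).

Definition seg x y := walk_edges (f x) (rcons (p x y) (f y)).

(* The edges of K that replace d, for an arbitrary choice of its orientation. *)
Definition kd d : seq {set K} :=
  if [pick xy : G * G | sedge xy.1 xy.2 && (d == [set xy.1; xy.2])] is Some xy
  then seg xy.1 xy.2 else [::].

Definition KD (l : seq {set G}) := flatten (map kd l).

(* The signature Sigma induced by K: the edges replaced by paths of odd length. *)
Definition odd_edge : pred {set G} := fun d => odd (size (kd d)).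

Lemma edgesP x y : sedge x y -> [set x; y] \in edges G.
Proof. by move=> h; rewrite inE; apply/existsP; exists x; apply/existsP; exists y; rewrite h eqxx. Qed.

Lemma mem_edges d : d \in edges G -> exists x y, sedge x y /\ d = [set x; y].
Proof. by rewrite inE => /existsP[x /existsP[y /andP[h /eqP->]]]; exists x, y. Qed.

Lemma segC x y : sedge x y -> perm_eq (seg y x) (seg x y).
Proof.
move=> xy; rewrite /seg (sd_rev S xy).
have := walk_edges_rev (f x) (rcons (p x y) (f y)).
by rewrite last_rcons belast_rcons rev_cons.
Qed.

Lemma kd_seg x y : sedge x y -> perm_eq (kd [set x; y]) (seg x y).
Proof.
move=> xy; rewrite /kd; case: pickP => [[x' y'] /= /andP[h /eqP/set2_eq]|/(_ (x, y))]; last first.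
  by rewrite /= xy eqxx.
case=> -[? ?]; subst x' y'; first exact: perm_refl.
by rewrite perm_sym segC // sedge_sym.
Qed.

Lemma size_seg x y : size (seg x y) = (size (p x y)).+1.
Proof.
rewrite /seg; move: (rcons _ _) (size_rcons (p x y) (f y)) => s <-.
by elim: s (f x) => //= z s IH a; rewrite IH.
Qed.

Lemma seg_sedge x y e : sedge x y -> e \in seg x y -> exists a b, sedge a b /\ e = [set a; b].
Proof.
move=> /(sd_path S); rewrite /seg; elim: (rcons _ _) (f x) => //= z s IH a /andP[az /IH h].
by rewrite inE => /predU1P[->|/h//]; exists a, z.
Qed.

(** For comparing segments: an interior vertex, or else the pair of ends, determines the edge of
    [G]. *)
Lemma seg_inner x y e : sedge x y -> e \in seg x y ->
  (exists2 a, a \in e & a \in p x y) \/ e = [set f x; f y].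
Proof.
move=> xy exy; have [a [b [ab ee]]] := seg_sedge xy exy.
have nab : a != b by apply: contraTneq ab => ->; rewrite sedge_irr.
have mem (k : K) : k \in e -> [|| k == f x, k \in p x y | k == f y].
  by move=> ke; have := mem_walk_edges exy ke; rewrite !inE mem_rcons inE [(k == f y) || _]orbC.
have ae : a \in e by rewrite ee !inE eqxx.
have be : b \in e by rewrite ee !inE eqxx orbT.
case/or3P: (mem a ae) => [/eqP ax|h|/eqP ay]; last 2 first.
- by left; exists a.
- case/or3P: (mem b be) => [/eqP bx|h|/eqP bY]; last 2 first.
  + by left; exists b.
  + by move: nab; rewrite ay bY eqxx.
  by right; rewrite ee ay bx setUC.
case/or3P: (mem b be) => [/eqP bx|h|/eqP bY].
- by move: nab; rewrite ax bx eqxx.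
- by left; exists b.
by right; rewrite ee ax bY.
Qed.

Lemma seg_disjoint x y x' y' e : sedge x y -> sedge x' y' ->
  e \in seg x y -> e \in seg x' y' -> [set x; y] = [set x'; y'].
Proof.
have aux x1 y1 x2 y2 a : sedge x1 y1 -> sedge x2 y2 -> e \in seg x2 y2 ->
    a \in e -> a \in p x1 y1 -> [set x1; y1] = [set x2; y2].
  move=> h1 h2 e2 ae a1; have := mem_walk_edges e2 ae.
  rewrite !inE mem_rcons inE => /or3P[/eqP ea|/eqP ea|a2].
  - by move: a1; rewrite ea (negPf (sd_interior S _ h1)).
  - by move: a1; rewrite ea (negPf (sd_interior S _ h1)).
  - exact: (sd_disjoint S h1 h2 a1 a2).
move=> h h' exy exy'.
case: (seg_inner h exy) => [[a ae ap]|e1]; first exact: (aux _ _ _ _ a h h').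
case: (seg_inner h' exy') => [[a ae ap]|e2].
  by apply/esym; apply: (aux _ _ _ _ a h' h).
move: e2; rewrite e1 => /set2_eq; case=> -[/(sd_inj S) -> /(sd_inj S) ->] //.
by rewrite setUC.
Qed.

Lemma kd_nil d : d \in edges G -> kd d != [::].
Proof.
case/mem_edges=> x [y [xy ->]]; have /perm_size := kd_seg xy.
by rewrite size_seg; case: (kd _).
Qed.

Lemma uniq_kd d : d \in edges G -> uniq (kd d).
Proof.
case/mem_edges=> x [y [xy ->]]; rewrite (perm_uniq (kd_seg xy)).
by apply: uniq_walk_edges; apply: sd_uniq.
Qed.

Lemma kd_disjoint d d' e : d \in edges G -> d' \in edges G ->
  e \in kd d -> e \in kd d' -> d = d'.
Proof.
case/mem_edges=> x [y [xy ->]]; case/mem_edges=> x' [y' [xy' ->]].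
rewrite (perm_mem (kd_seg xy)) (perm_mem (kd_seg xy')); exact: seg_disjoint.
Qed.

Lemma KD_cat l1 l2 : KD (l1 ++ l2) = KD l1 ++ KD l2.
Proof. by rewrite /KD map_cat flatten_cat. Qed.

Lemma perm_KD l1 l2 : perm_eq l1 l2 -> perm_eq (KD l1) (KD l2).
Proof. by move=> h; apply: perm_flatten; apply: perm_map. Qed.

Lemma mem_KD l e : e \in KD l -> exists2 d, d \in l & e \in kd d.
Proof. by case/flattenP=> _ /mapP[d dl ->]; exists d. Qed.

Lemma KD_mem l d e : d \in l -> e \in kd d -> e \in KD l.
Proof. by move=> dl ed; apply/flattenP; exists (kd d) => //; apply: map_f. Qed.

Lemma odd_size_KD l : odd (size (KD l)) = par odd_edge l.
Proof. by elim: l => // d l IH; rewrite par_cons -IH -oddD -size_cat. Qed.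

(** Segments are nonempty and those of distinct edges are disjoint. Both directions are used, for
    lifting cycles and for projecting them. *)
Lemma uniq_KD l : {subset l <= edges G} -> uniq l = uniq (KD l).
Proof.
elim: l => // d l IH sl; have dG : d \in edges G by apply: sl; rewrite mem_head.
have sl' : {subset l <= edges G} by move=> d' h; apply: sl; rewrite inE h orbT.
rewrite /KD /= cat_uniq uniq_kd //= -/(KD l) -IH //; congr andb.
apply/idP/hasPn => [dl e /mem_KD[d' dl' ed']|h].
  by apply: contra dl => ed; rewrite (kd_disjoint dG (sl' _ dl') ed ed').
apply/negP => dl; have := kd_nil dG; case E : (kd d) => [|e s] // _.
have ed : e \in kd d by rewrite E mem_head.
by have := h e (KD_mem dl ed); rewrite /= ed.
Qed.

Lemma KD_edges : perm_eq (KD (enum (edges G))) (enum (edges K)).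
Proof.
apply: uniq_perm; rewrite ?enum_uniq //.
  by rewrite -uniq_KD ?enum_uniq // => d; rewrite mem_enum.
move=> e; rewrite mem_enum; apply/idP/idP => [/mem_KD[d]|eK].
  rewrite mem_enum => /mem_edges[x [y [xy ->]]]; rewrite (perm_mem (kd_seg xy)).
  case/(seg_sedge xy)=> a [b [ab ->]]; rewrite inE.
  by apply/existsP; exists a; apply/existsP; exists b; rewrite ab eqxx.
have [x [y [xy exy]]] := sd_edges S eK.
apply: (@KD_mem _ [set x; y]); first by rewrite mem_enum edgesP.
by rewrite (perm_mem (kd_seg xy)).
Qed.

Lemma KD_inj l : {subset l <= edges G} -> perm_eq (KD l) (enum (edges K)) ->
  perm_eq l (enum (edges G)).
Proof.
move=> sl pl; apply: uniq_perm; rewrite ?enum_uniq //.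
  by rewrite uniq_KD // (perm_uniq pl) enum_uniq.
move=> d; rewrite mem_enum; apply/idP/idP => [/sl //|dG].
have := kd_nil dG; case E : (kd d) => [|e s] // _.
have ed : e \in kd d by rewrite E mem_head.
have : e \in KD l.
  rewrite (perm_mem pl) -(perm_mem KD_edges); apply: KD_mem ed.
  by rewrite mem_enum.
by case/mem_KD=> d' dl ed'; rewrite (kd_disjoint dG (sl _ dl) ed ed').
Qed.

Fixpoint lift_walk x t : seq K :=
  if t is y :: t' then rcons (p x y) (f y) ++ lift_walk y t' else [::].

Lemma lift_cat x s t : lift_walk x (s ++ t) = lift_walk x s ++ lift_walk (last x s) t.
Proof. by elim: s x => //= y s IH x; rewrite IH catA. Qed.

Lemma last_lift x t : last (f x) (lift_walk x t) = f (last x t).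
Proof. by elim: t x => //= y t IH x; rewrite last_cat last_rcons IH. Qed.

Lemma path_lift x t : path (@sedge G) x t -> path (@sedge K) (f x) (lift_walk x t).
Proof.
elim: t x => //= y t IH x /andP[xy /IH h].
by rewrite cat_path (sd_path S xy) last_rcons.
Qed.

Lemma walk_lift x t : path (@sedge G) x t ->
  perm_eq (walk_edges (f x) (lift_walk x t)) (KD (walk_edges x t)).
Proof.
elim: t x => //= y t IH x /andP[xy /IH h].
rewrite walk_edges_cat last_rcons /KD /=; apply: perm_cat => //.
by rewrite perm_sym; apply: kd_seg.
Qed.

Lemma size_lift x t : size t <= size (lift_walk x t).
Proof.
elim: t x => //= y t IH x; rewrite size_cat size_rcons addSn ltnS.
exact: leq_trans (IH y) (leq_addl _ _).
Qed.

Lemma mem_lift x t a : path (@sedge G) x t -> a \in lift_walk x t ->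
  (exists2 z, z \in t & a = f z) \/
  exists z z', [/\ sedge z z', [set z; z'] \in walk_edges x t & a \in p z z'].
Proof.
elim: t x => //= y t IH x /andP[xy hp].
rewrite mem_cat mem_rcons inE -orbA => /or3P[/eqP->|ap|/(IH _ hp)[[z zt ->]|[z [z' [h1 h2 h3]]]]].
- by left; exists y; rewrite ?mem_head.
- by right; exists x, y; rewrite mem_head.
- by left; exists z; rewrite // inE zt orbT.
- by right; exists z, z'; rewrite inE h2 orbT.
Qed.

Lemma uniq_lift x t : path (@sedge G) x t -> uniq t -> uniq (walk_edges x t) -> uniq (lift_walk x t).
Proof.
elim: t x => //= y t IH x /andP[xy hp] /andP[yt ut] /andP[et eu].
have up : uniq (rcons (p x y) (f y)) by have := sd_uniq S xy; rewrite cons_uniq => /andP[].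
rewrite cat_uniq up IH // andbT; apply/hasPn => a /(mem_lift hp) ha.
rewrite /= mem_rcons inE negb_or; case: ha => [[z zt ->]|[z [z' [h1 h2 h3]]]].
  rewrite (inj_eq (sd_inj S)) (sd_interior S) // andbT.
  by apply: contraNneq yt => <-.
apply/andP; split; first by apply: contraTneq h3 => ->; apply: (sd_interior S).
by apply: contra et => ap; rewrite (sd_disjoint S xy h1 ap h3).
Qed.

Lemma edges_path x t : {subset walk_edges x t <= edges G} -> path (@sedge G) x t.
Proof.
elim: t x => //= y t IH x h.
rewrite IH ?andbT => [|d dt]; last by apply: h; rewrite inE dt orbT.
have /mem_edges[u [v [uv e]]] : [set x; y] \in edges G by apply: h; rewrite mem_head.
by case: (set2_eq e) => -[-> ->] //; rewrite sedge_sym.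
Qed.

Lemma lift_cycle c : ecyc odd_edge c -> {subset cedges c <= edges G} ->
  exists C, [/\ is_cycle C, ~~ odd #|C| & perm_eq (enum C) (KD (cedges c))].
Proof.
case: c => [|x s] /and3P[sz us ec] sc; first by [].
have hp : path (@sedge G) x (rcons s x) by apply: edges_path.
have [q eq] : exists q : seq K, lift_walk x (rcons s x) = rcons q (f x).
  by rewrite -cats1 lift_cat /= cats0; eexists; rewrite -rcons_cat.
have pC := walk_lift hp; rewrite eq in pC.
have uC : uniq (KD (cedges (x :: s))) by rewrite -uniq_KD //; apply: uniq_cedges.
have pe : perm_eq (enum [set d in walk_edges (f x) (rcons q (f x))]) (KD (cedges (x :: s))).
  apply: uniq_perm; rewrite ?enum_uniq // => d.
  by rewrite mem_enum inE (perm_mem pC).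
exists [set d in walk_edges (f x) (rcons q (f x))]; split=> //.
- exists (f x), q; split=> //.
  + have := size_lift x (rcons s x); rewrite eq !size_rcons.
    exact: leq_trans.
  + rewrite cons_uniq -rcons_uniq -eq; apply: uniq_lift => //.
      by rewrite rcons_uniq.
    exact: (uniq_cedges us sz).
  + by rewrite -eq; apply: path_lift.
- by rewrite cardE (perm_size pe) odd_size_KD.
Qed.

Lemma cover_flatten (T : finType) (L : seq {set T}) (E : {set T}) :
  perm_eq (flatten (map (fun C : {set T} => enum C) L)) (enum E) -> set0 \notin L ->
  partition [set C in L] E.
Proof.
move=> pL L0; apply/and3P; split; last by rewrite inE.
  apply/eqP/setP => x; rewrite -[x \in E]mem_enum -(perm_mem pL).
  apply/bigcupP/flattenP => [[C]|[_ /mapP[C CL ->]]].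
    by rewrite inE => CL xC; exists (enum C); rewrite ?mem_enum //; apply: map_f.
  by rewrite mem_enum => xC; exists C; rewrite ?inE.
have : uniq (flatten (map (fun C : {set T} => enum C) L)) by rewrite (perm_uniq pL) enum_uniq.
move=> uL; apply/trivIsetP => A B; rewrite !inE.
elim: L uL {pL L0} => // C L IH /=; rewrite cat_uniq => /and3P[_ /hasPn dj uL].
have aux D : D \in L -> [disjoint C & D].
  move=> DL; rewrite disjoint_sym; apply/pred0P => x /=; apply/negbTE; rewrite negb_and.
  case xD : (x \in D) => //=; have := dj x; rewrite /= mem_enum; apply.
  by apply/flattenP; exists (enum D); rewrite ?mem_enum //; apply: map_f.
rewrite !inE => /predU1P[->|AL] /predU1P[->|BL] //; first by rewrite eqxx.
- by move=> _; apply: aux.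
- by move=> _; rewrite disjoint_sym; apply: aux.
- exact: IH.
Qed.

Lemma lift_dec : dec odd_edge (enum (edges G)) -> even_cycle_decomposable K.
Proof.
move=> [cs [ecs pcs]].
have scs : {subset flatten (map (@cedges G) cs) <= edges G}.
  by move=> d; rewrite (perm_mem pcs) mem_enum.
have [L [hL pL]] : exists L : seq {set {set K}},
   (forall C, C \in L -> is_cycle C /\ ~~ odd #|C|) /\
   perm_eq (flatten (map (fun C : {set {set K}} => enum C) L)) (KD (flatten (map (@cedges G) cs))).
  elim: cs ecs scs {pcs} => [|c cs IH] /=; first by exists [::].
  move=> /andP[ec ecs] sc.
  have [|L [hL pL]] := IH ecs; first by move=> d h; apply: sc; rewrite mem_cat h orbT.
  have [|C [h1 h2 h3]] := lift_cycle ec; first by move=> d h; apply: sc; rewrite mem_cat h.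
  exists (C :: L); split; first by move=> D; rewrite inE => /predU1P[->|/hL].
  by rewrite /= KD_cat; apply: perm_cat.
exists [set C in L]; split; last by move=> C; rewrite inE => /hL.
apply: cover_flatten.
  by apply: perm_trans pL _; apply: perm_trans (perm_KD pcs) KD_edges.
apply/negP => /hL[[x [s [_ _ _ e]]] _]; move/setP/(_ [set x; head x s]): e.
by rewrite in_set0 in_set; case: s => [|y s] /=; rewrite in_cons eqxx.
Qed.

Lemma par_edges : par odd_edge (enum (edges G)) = odd #|edges K|.
Proof. by rewrite -odd_size_KD (perm_size KD_edges) cardE. Qed.

End Subdivision.

Lemma signed_subdivisions (G : sgraph) :
  (forall sg : pred {set G}, par sg (enum (edges G)) = false -> dec sg (enum (edges G))) ->
  strongly_even_cycle_decomposable G.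
Proof.
move=> h K [f [p S]] eK; apply: (lift_dec S); apply: h.
by rewrite (par_edges S); apply: negbTE.
Qed.

(** * Realising a given signature by a subdivision *)

Section Contraction.
Variables (G : sgraph) (sg : pred {set G}).
Implicit Types (x y z : G).

(** Edges in [sg] keep length 1 and the others get length 2. The edge itself serves as its
    subdividing vertex. *)
Definition even_edge : Type := {d : {set G} | (d \in edges G) && ~~ sg d}.

Definition subdivided_rel : rel (G + even_edge)%type := fun a b =>
  match a, b with
  | inl x, inl y => sedge x y && sg [set x; y]
  | inl x, inr d | inr d, inl x => x \in val d
  | inr _, inr _ => false
  end.

Lemma subdivided_sym : symmetric subdivided_rel.
Proof. by move=> [x|d] [y|e] //=; rewrite sedge_sym setUC. Qed.

Lemma subdivided_irr : irreflexive subdivided_rel.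
Proof. by move=> [x|d] //=; rewrite sedge_irr. Qed.

Definition subdivided : sgraph := SGraph subdivided_sym subdivided_irr.

Definition interior x y : seq subdivided :=
  if sg [set x; y] then [::] else if insub [set x; y] is Some d then [:: inr d] else [::].

Lemma interior_odd x y : sg [set x; y] -> interior x y = [::].
Proof. by rewrite /interior => ->. Qed.

Lemma interior_even x y : sedge x y -> ~~ sg [set x; y] ->
  exists2 d : even_edge, val d = [set x; y] & interior x y = [:: inr d].
Proof.
move=> xy nsg; rewrite /interior (negPf nsg); case: insubP => [d _ <-|]; first by exists d.
by rewrite edgesP // nsg.
Qed.

Variant interior_spec x y : seq subdivided -> Type :=
  | InteriorOdd of sg [set x; y] : interior_spec x y [::]
  | InteriorEven (d : even_edge) of val d = [set x; y] : interior_spec x y [:: inr d].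

Lemma interiorP x y : sedge x y -> interior_spec x y (interior x y).
Proof.
move=> xy; rewrite /interior; case: ifPn => [s|s]; first exact: InteriorOdd.
case: insubP => [d _ e|]; first exact: InteriorEven.
by rewrite edgesP // s.
Qed.

Lemma mem_interior x y a : sedge x y -> a \in interior x y ->
  exists2 d : even_edge, a = inr d & val d = [set x; y].
Proof.
by move=> xy; case: (interiorP xy) => [//|d e]; rewrite inE => /eqP->; exists d.
Qed.

Lemma subdividedP : subdivides_via (fun x => inl x : subdivided) interior.
Proof.
split.
- by move=> x y [].
- move=> x y xy; case: (interiorP xy) => [s|d e] /=; first by rewrite xy s.
  by rewrite e !inE !eqxx !orbT.
- move=> x y xy; have nxy : x != y by apply: contraTneq xy => ->; rewrite sedge_irr.
  by case: (interiorP xy) => [s|d e] /=; rewrite !inE andbT; apply: contra nxy => /eqP[->].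
- move=> x y xy; rewrite {1}/interior setUC -/(interior x y).
  by case: (interiorP xy).
- by move=> x y z xy; apply/negP => /(mem_interior xy)[].
- by move=> x y x' y' a xy xy' /(mem_interior xy)[d -> <-] /(mem_interior xy')[d' [->] <-].
- case=> [x|d]; first by left; exists x.
  have /andP[/mem_edges[x [y [xy e]]] nsg] := valP d; right; exists x, y; split=> //.
  rewrite e in nsg; have [d' e' ->] := interior_even xy nsg.
  by rewrite inE; apply/eqP; congr inr; apply: val_inj; rewrite /= e'.
move=> e /mem_edges[a [b [ab ->]]].
have aux (x : G) (d : even_edge) : x \in val d -> exists y z, sedge y z /\
    [set inl x; inr d] \in walk_edges (inl y : subdivided) (rcons (interior y z) (inl z)).
  have /andP[/mem_edges[y [z [yz ed]]] nsg] := valP d.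
  rewrite ed in nsg; have [d' e' iE] := interior_even yz nsg.
  have -> : d = d' by apply: val_inj; rewrite e'.
  rewrite e' => xd; exists y, z; split=> //; rewrite iE /= !inE.
  by move: xd; rewrite !inE => /orP[]/eqP->; rewrite ?eqxx // (setUC [set inr d']) eqxx orbT.
case: a b ab => [x|d] [y|d'] //= h.
- by have /andP[xy s] := h; exists x, y; rewrite interior_odd // mem_head.
- exact: aux.
- by rewrite setUC; apply: aux.
Qed.

Let f x : subdivided := inl x.

Lemma odd_edge_subdivided : {in edges G, odd_edge f interior =1 sg}.
Proof.
move=> d /mem_edges[x [y [xy ->]]].
rewrite /odd_edge (perm_size (kd_seg subdividedP xy)) size_seg.
have [s|s] := boolP (sg [set x; y]); first by rewrite interior_odd.
by have [d' _ ->] := interior_even xy s.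
Qed.

Fixpoint nobacktrack (T : eqType) (a : T) s :=
  if s is b :: s' then (if s' is c :: _ then a != c else true) && nobacktrack b s' else true.

(** A walk that enters a subdividing vertex and does not turn back leaves it at the other end of the
    edge, so it traverses the whole segment. Turning back there would correspond to no edge of
    [G]. *)
Lemma unlift s x y : path (@sedge subdivided) (inl x) s -> nobacktrack (inl x) s ->
  last (inl x) s = inl y -> exists2 t, s = lift_walk f interior x t & path (@sedge G) x t.
Proof.
have [n] := ubnP (size s); elim: n s x => // n IH [|[z|d] s] x sz; first by exists [::].
  rewrite /= => /andP[/andP[xz sxz] hp] /andP[_ hn] hl.
  have [t -> pt] := IH s z sz hp hn hl; exists (z :: t); last by rewrite /= xz.
  by rewrite /= interior_odd.
case: s sz => [|[z|d'] s] sz; [by []| |by rewrite /= andbF].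
rewrite [path _ _ _]/= => /and3P[xd zd hp].
rewrite [nobacktrack _ _]/= => /and3P[xz _ hn] hl.
have [t -> pt] := IH s z (ltnW sz) hp hn hl.
have /andP[/mem_edges[u [v [uv ed]]] nsg] := valP d.
have [xy e] : sedge x z /\ val d = [set x; z].
  have {}xz : x != z by apply: contraNneq xz => ->.
  move: (xd : x \in val d) (zd : z \in val d); rewrite ed !inE.
  move=> /orP[]/eqP ex /orP[]/eqP ez; subst x z; rewrite ?eqxx // in xz *.
  by rewrite sedge_sym setUC.
rewrite e in nsg; have [d' e' iE] := interior_even xy nsg.
exists (z :: t); last by rewrite /= xy.
by rewrite /= iE /=; congr (inr _ :: _); apply: val_inj; rewrite e e'.
Qed.

Lemma nobacktrack_cycle (T : eqType) (a : T) s : uniq (a :: s) -> 1 < size s ->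
  nobacktrack a (rcons s a).
Proof.
have aux b t : uniq (b :: t) -> a \notin b :: t -> nobacktrack b (rcons t a).
  elim: t b => // c t IH b; rewrite rcons_cons => /= /andP[bn ut] /=.
  rewrite !inE !negb_or => /and3P[ab ac at_].
  rewrite IH ?andbT //; last by rewrite inE negb_or ac.
  case: t bn {IH ut at_} => [|e t] /=; first by rewrite eq_sym.
  by rewrite !inE !negb_or => /and3P[].
case: s => [|b [|c s]] // /= /andP[an us] _.
move: (an); rewrite !inE !negb_or => /and3P[ab ac _]; rewrite ac /=.
exact: (aux b (c :: s)).
Qed.

Lemma subseq_lift x t : subseq (map f t) (lift_walk f interior x t).
Proof.
elim: t x => //= y t IH x.
rewrite -cat1s; apply: cat_subseq => //.
by rewrite -cats1; apply: suffix_subseq.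
Qed.

(** Subdividing vertices are pairwise non-adjacent, so a rotation by at most one step starts the
    cycle at a vertex of [G]. *)
Lemma cycle_start (C : {set {set subdivided}}) : is_cycle C -> exists x s,
  [/\ 3 <= size (f x :: s), uniq (f x :: s), path (@sedge subdivided) (f x) (rcons s (f x))
    & C = [set e in walk_edges (f x) (rcons s (f x))]].
Proof.
case=> -[x|d] [s [sz us ps ->]]; first by exists x, s.
case: s sz us ps => [|[y|d'] s] // sz us ps; exists y, (rcons s (inr d)); split.
- by move: sz; rewrite /= size_rcons.
- by rewrite -rcons_cons rcons_uniq -cons_uniq.
- move: ps; rewrite rcons_cons /= !rcons_path last_rcons.
  by case/andP=> h /andP[-> ->]; rewrite /= h.
- apply/setP => e; rewrite !in_set.
  have := perm_mem (perm_cedges_rot 1 (inr d :: f y :: s)) e.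
  by rewrite rot1_cons.
Qed.

Lemma unlift_cycle (C : {set {set subdivided}}) : is_cycle C -> ~~ odd #|C| ->
  exists c, [/\ ecyc sg c, {subset cedges c <= edges G} &
    perm_eq (enum C) (KD f interior (cedges c))].
Proof.
move=> /cycle_start[x [s [sz us ps eC]]] oC.
have hn := nobacktrack_cycle us sz.
have [t et pt] := unlift ps hn (last_rcons _ _ _).
have lt : f (last x t) = f x by rewrite -(last_lift f interior) -et last_rcons.
case/lastP: t et pt lt => [|t x'] et pt; first by case: s {us ps eC hn sz} et.
rewrite last_rcons => -[ex]; subst x'.
have pw := walk_lift subdividedP pt; rewrite -et in pw.
have sc : {subset walk_edges x (rcons t x) <= edges G}.
  elim: (rcons t x) {1 3}x pt => //= z r IH v /andP[vz /IH hr] d; rewrite inE.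
  by case/predU1P=> [->|/hr//]; apply: edgesP.
have uw : uniq (walk_edges (f x) (rcons s (f x))) by apply: (uniq_cedges us sz).
have pe : perm_eq (enum C) (KD f interior (walk_edges x (rcons t x))).
  rewrite perm_sym; apply: perm_trans (_ : perm_eq _ (walk_edges (f x) (rcons s (f x)))) _.
    by rewrite perm_sym.
  by apply: uniq_perm; rewrite ?enum_uniq // => e; rewrite mem_enum eC inE.
have ue : uniq (walk_edges x (rcons t x)).
  by rewrite (uniq_KD subdividedP) // -(perm_uniq pw).
exists (x :: t); split=> //; apply/and3P; split.
(* One vertex would give a loop, and two would give the same edge twice, against [ue]. *)
- case: t et pt pw sc pe ue => [|y [|z t]] //= et pt pw sc pe.
    by move: pt; rewrite sedge_irr.
  by rewrite inE setUC eqxx.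
- rewrite cons_uniq -rcons_uniq -(map_inj_uniq (f := f)); last by move=> u v [].
  apply: subseq_uniq (subseq_lift x _) _.
  by rewrite -et rcons_uniq -cons_uniq.
- move: oC; rewrite cardE (perm_size pe) odd_size_KD; congr (~~ _); apply: eq_par => d ds.
  by apply: odd_edge_subdivided; apply: sc.
Qed.

Lemma dec_subdivided : even_cycle_decomposable subdivided -> dec sg (enum (edges G)).
Proof.
move=> [P [pP hP]].
have [cs [ecs scs pcs]] : exists cs, [/\ all (ecyc sg) cs,
    {subset flatten (map (@cedges G) cs) <= edges G} &
    perm_eq (flatten (map (fun C : {set {set subdivided}} => enum C) (enum P)))
      (KD f interior (flatten (map (@cedges G) cs)))].
  have : {subset enum P <= P} by move=> C; rewrite mem_enum.
  elim: (enum P) => [|C L IH] sL; first by exists [::].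
  have [|cs [h1 h2 h3]] := IH; first by move=> D DL; apply: sL; rewrite inE DL orbT.
  have [|cC oC] := hP C; first by apply: sL; rewrite mem_head.
  have [c [k1 k2 k3]] := unlift_cycle cC oC.
  exists (c :: cs); split; rewrite /= ?k1 //.
    by move=> d; rewrite mem_cat => /orP[/k2|/h2].
  by rewrite KD_cat; apply: perm_cat.
exists cs; split=> //; apply: (KD_inj subdividedP scs).
rewrite perm_sym; apply: perm_trans pcs.
have /and3P[/eqP cP tP _] := pP.
apply: uniq_perm; first exact: enum_uniq; last first.
  move=> e; rewrite mem_enum -cP; apply/bigcupP/flattenP => [[C CP eC]|[_ /mapP[C CP ->]]].
    by exists (enum C); rewrite ?mem_enum //; apply: map_f; rewrite mem_enum.
  by rewrite !mem_enum in CP *; exists C.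
have : {subset enum P <= P} by move=> C; rewrite mem_enum.
elim: (enum P) (enum_uniq P) => //= C L IH /andP[CL uL] sL.
rewrite cat_uniq enum_uniq IH // ?andbT; last by move=> D DL; apply: sL; rewrite inE DL orbT.
apply/hasPn => e /flattenP[_ /mapP[D DL ->]]; rewrite /= !mem_enum => eD.
have CD : C != D by apply: contraNneq CL => ->.
have /trivIsetP/(_ C D) := tP; rewrite !sL ?mem_head ?inE ?DL ?orbT // => /(_ isT isT CD).
by move/disjointFl=> ->.
Qed.

End Contraction.

(** The converse of [signed_subdivisions], obtained from the subdivision that realises [sg]. *)
Lemma signed_decomposable (G : sgraph) (sg : pred {set G}) :
  strongly_even_cycle_decomposable G -> par sg (enum (edges G)) = false ->
  dec sg (enum (edges G)).
Proof.
move=> hG e; apply: dec_subdivided; apply: hG.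
  by exists (fun x => inl x : subdivided sg), (@interior G sg); apply: subdividedP.
rewrite -(par_edges (subdividedP sg)) (eq_par (sg2 := sg)) ?e // => d.
by rewrite mem_enum; apply: odd_edge_subdivided.
Qed.

(** * Twin substitutions *)

Lemma count_deg (G : sgraph) (x : G) :
  count (fun d : {set G} => x \in d) (enum (edges G)) = deg x.
Proof.
rewrite -size_filter /deg cardE -(size_map (fun y => [set x; y])).
apply: perm_size; apply: uniq_perm; first by rewrite filter_uniq ?enum_uniq.
  rewrite map_inj_in_uniq ?enum_uniq // => y z; rewrite !mem_enum !inE => xy xz.
  by case/set2_eq => -[] // zx; move: xz; rewrite -zx sedge_irr.
move=> d; rewrite mem_filter mem_enum; apply/andP/mapP => [[xd /mem_edges[a [b [ab ed]]]]|[y + ->]].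
  move: xd; rewrite ed !inE => /orP[]/eqP->.
    by exists b; rewrite // mem_enum inE.
  by exists a; [rewrite mem_enum inE sedge_sym|rewrite setUC].
by rewrite mem_enum inE => xy; rewrite edgesP // !inE eqxx.
Qed.

Lemma edges_set2 (G : sgraph) (d : {set G}) : d \in enum (edges G) ->
  exists a b, a != b /\ d = [set a; b].
Proof.
rewrite mem_enum => /mem_edges[a [b [ab ->]]]; exists a, b; split=> //.
by apply: contraTneq ab => ->; rewrite sedge_irr.
Qed.

Lemma dec_even_graph (G : sgraph) sg (x : G) : dec sg (enum (edges G)) -> ~~ odd (deg x).
Proof.
rewrite -count_deg => -[cs [_ pcs]]; rewrite -(permP pcs).
have : {subset flatten (map (@cedges G) cs) <= enum (edges G)}.
  by move=> d; rewrite (perm_mem pcs).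
elim: cs {pcs} => //= c cs IH h; rewrite count_cat oddD negb_add.
have -> : odd (count (fun d : {set G} => x \in d) (cedges c)) = false.
  case: c h => [|a s] h //; rewrite /cedges (count_walk (E := enum (edges G))).
  - by rewrite last_rcons addbb.
  - exact: edges_set2.
  - by move=> d ds; apply: h; rewrite mem_cat ds.
by rewrite eq_sym; apply/eqP/negbTE; apply: IH => d ds; apply: h; rewrite mem_cat ds orbT.
Qed.

(** Each vertex of the triangle has degree 2 within it, so even degrees forbid any edge to the
    fourth vertex. *)
Lemma co_clawP (H : sgraph) (x y z : H) : eulerian H -> #|H| = 4 ->
  uniq [:: x; y; z] -> sedge x y -> sedge y z -> sedge z x -> isomorphic H co_claw.
Proof.
move=> eH H4 u3 xy yz zx.
have [|w _ wn] := exists_notin (l := [:: x; y; z]) (enum_uniq H); first by rewrite -cardE H4.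
have u4 : uniq [:: x; y; z; w].
  by move: u3 wn; rewrite /= !inE !negb_or !(eq_sym w) !andbT => /andP[/andP[-> ->] ->] /and3P[-> -> ->].
have pH : perm_eq (enum H) [:: x; y; z; w].
  rewrite perm_sym; apply: uniq_perm; rewrite ?enum_uniq //.
  have sub : {subset [:: x; y; z; w] <= enum H} by move=> h _; rewrite mem_enum.
  have sz : size (enum H) <= size [:: x; y; z; w] by rewrite -cardE H4.
  by case: (uniq_min_size u4 sub sz).
have degE h : deg h = sedge h x + (sedge h y + (sedge h z + sedge h w)).
  have -> : deg h = count (sedge h) (enum H).
    rewrite /deg cardE -size_filter; apply: perm_size; apply: uniq_perm.
    - exact: enum_uniq.
    - by apply: filter_uniq; apply: enum_uniq.
    - by move=> k; rewrite mem_enum inE [RHS]mem_filter mem_enum andbT.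
  by rewrite (permP pH) /= addn0.
have yx : sedge y x by rewrite sedge_sym.
have zy : sedge z y by rewrite sedge_sym.
have xz : sedge x z by rewrite sedge_sym.
have xw : sedge x w = false by move: (eH x); rewrite degE sedge_irr xy xz; case: (sedge x w).
have yw : sedge y w = false by move: (eH y); rewrite degE sedge_irr yx yz; case: (sedge y w).
have zw : sedge z w = false by move: (eH z); rewrite degE sedge_irr zx zy; case: (sedge z w).
have wx : sedge w x = false by rewrite sedge_sym.
have wy : sedge w y = false by rewrite sedge_sym.
have wz : sedge w z = false by rewrite sedge_sym.
pose f h : co_claw := if h == x then inl (@Ordinal 3 0 isT) else
  if h == y then inl (@Ordinal 3 1 isT) else
  if h == z then inl (@Ordinal 3 2 isT) else inr ord0.
pose g (a : co_claw) : H := match a with inl i => nth x [:: x; y; z] i | inr _ => w end.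
move: u4; rewrite /= !inE !negb_or !andbT => /and3P[/and3P[nxy nxz nxw] /andP[nyz nyw] nzw].
have fx : f x = inl (@Ordinal 3 0 isT) by rewrite /f eqxx.
have fy : f y = inl (@Ordinal 3 1 isT) by rewrite /f eq_sym (negPf nxy) eqxx.
have fz : f z = inl (@Ordinal 3 2 isT) by rewrite /f eq_sym (negPf nxz) eq_sym (negPf nyz) eqxx.
have fw : f w = inr ord0 by rewrite /f !(eq_sym w) (negPf nxw) (negPf nyw) (negPf nzw).
have inH h : h \in [:: x; y; z; w] by rewrite -(perm_mem pH) mem_enum.
exists f; split.
  exists g => [h|a].
    by have := inH h; rewrite !inE => /or4P[]/eqP->; rewrite ?fx ?fy ?fz ?fw.
  case: a => [[[|[|[|i]]] hi]|i] //=; rewrite ?fx ?fy ?fz ?fw ?(ord1 i) //;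
    by congr inl; apply: val_inj.
move=> h k; have := inH h; have := inH k; rewrite !inE.
by move=> /or4P[]/eqP-> /or4P[]/eqP->;
  rewrite ?fx ?fy ?fz ?fw ?sedge_irr ?xy ?yx ?xz ?zx ?yz ?zy ?xw ?yw ?zw ?wx ?wy ?wz.
Qed.

Section Image.
Variables (T1 T2 : finType) (phi : T1 -> T2).
Hypothesis phi_inj : injective phi.

Lemma imset2P (x y : T1) : phi @: [set x; y] = [set phi x; phi y].
Proof. by rewrite imsetU !imset_set1. Qed.

Lemma cedges_map c : cedges (map phi c) = [seq phi @: (d : {set T1}) | d <- cedges c].
Proof.
have walk_map t z : walk_edges (phi z) (map phi t) = [seq phi @: (d : {set T1}) | d <- walk_edges z t].
  by elim: t z => //= y t IH z; rewrite imset2P IH.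
by case: c => // x s; rewrite /cedges /= -map_rcons walk_map.
Qed.

Lemma par_map sg (l : seq {set T1}) :
  par sg [seq phi @: (d : {set T1}) | d <- l] = par (fun d => sg (phi @: (d : {set T1}))) l.
Proof. by rewrite /par count_map. Qed.

Lemma dec_map sg (l : seq {set T1}) : dec (fun d => sg (phi @: (d : {set T1}))) l ->
  dec sg [seq phi @: (d : {set T1}) | d <- l].
Proof.
move=> [cs [h p]]; exists (map (map phi) cs); split.
  rewrite all_map; apply: sub_all h => c /and3P[h1 h2 h3].
  by rewrite /= /ecyc size_map h1 map_inj_uniq // h2 cedges_map par_map h3.
apply: perm_trans (perm_map (fun d : {set T1} => phi @: d) p).
rewrite map_flatten -!map_comp.
by rewrite (@eq_map _ _ (@cedges T2 \o map phi) _ cedges_map).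
Qed.

End Image.

Lemma uniq_KK (T : finType) (X M : seq T) : uniq X -> uniq M ->
  (forall x, x \in X -> x \notin M) -> uniq (KK X M).
Proof.
move=> uX uM; elim: X uX => // x X IH /= /andP[xX uX] dj.
have xM := dj x (mem_head _ _).
rewrite /KK /= cat_uniq -/(KK X M) IH // ?andbT; last by move=> y yX; apply: dj; rewrite inE yX orbT.
apply/andP; split.
  rewrite map_inj_in_uniq // => n m nM mM /set2_eq; case=> -[] // xm.
  by move: xM; rewrite xm mM.
apply/hasPn => d /flattenP[_ /mapP[y yX ->]] /mapP[n nM ->]; apply/mapP => -[m mM /set2_eq].
case=> -[] e1 e2; first by move: xX; rewrite -e1 yX.
by move: xM; rewrite -e2 nM.
Qed.

Lemma mem_KK (T : finType) (X M : seq T) d :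
  reflect (exists x n, [/\ x \in X, n \in M & d = [set x; n]]) (d \in KK X M).
Proof.
apply: (iffP flattenP) => [[_ /mapP[x xX ->] /mapP[n nM ->]]|[x [n [xX nM ->]]]].
  by exists x, n.
by exists (star x M); apply: map_f.
Qed.

Section TwinSubstitution.
Variables (G : sgraph) (u v : G) (H : sgraph).
Hypothesis hG : strongly_even_cycle_decomposable G.
Hypothesis huv : twins u v.
Hypothesis hnadj : ~~ sedge u v.

Let T := twin_substitution u v H.
Let V : finType := {x : G | (x != u) && (x != v)}.
Let Hs : pred T := fun a => if a is inr _ then true else false.
Let nbrs : seq T := [seq inl x : T | x <- enum V & sedge v (val x)].
(** These are the edges of $G-u-v$, which belong to every copy of $G$. *)
Let rest : seq {set T} := [seq d : {set T} <- enum (edges T) | [forall z in d, ~~ Hs z]].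
Let Hv : seq T := [seq inr h : T | h <- enum H].
Let Hedges : seq {set T} := [seq (inr : H -> T) @: (d : {set H}) | d <- enum (edges H)].

Let inrI : injective (inr : H -> T). Proof. by move=> x y []. Qed.

Let mem_nbrs (a : T) : reflect (exists2 x : V, sedge v (val x) & a = inl x) (a \in nbrs).
Proof.
apply: (iffP mapP) => [[x]|[x vx ->]]; first by rewrite mem_filter => /andP[vx _] ->; exists x.
by exists x => //; rewrite mem_filter vx mem_enum.
Qed.

Let uniq_nbrs : uniq nbrs.
Proof.
rewrite map_inj_uniq => [|x y []//]; by apply: filter_uniq; apply: enum_uniq.
Qed.

Let nbrs_Hs n : n \in nbrs -> ~~ Hs n.
Proof. by case/mem_nbrs => x _ ->. Qed.

Let size_nbrs : size nbrs = deg v.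
Proof.
rewrite /deg cardE size_map -(size_map val); apply: perm_size; apply: uniq_perm.
- by rewrite map_inj_uniq; [apply: filter_uniq; apply: enum_uniq|apply: val_inj].
- exact: enum_uniq.
move=> y; rewrite mem_enum inE; apply/mapP/idP => [[x + ->]|vy].
  by rewrite mem_filter => /andP[].
have yuv : (y != u) && (y != v).
  by apply/andP; split; apply: contraTneq vy => ->; rewrite ?sedge_irr // sedge_sym.
by exists (Sub y yuv); rewrite // mem_filter mem_enum /= vy.
Qed.

Let rest_Hs d : d \in rest -> forall z, z \in d -> ~~ Hs z.
Proof. by rewrite mem_filter => /andP[/forall_inP]. Qed.

Let edges_split : perm_eq (enum (edges T)) (rest ++ KK Hv nbrs ++ Hedges).
Proof.
have uHv : uniq Hv by rewrite map_inj_uniq ?enum_uniq.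
have dj x : x \in Hv -> x \notin nbrs.
  by case/mapP=> h _ ->; apply/negP => /nbrs_Hs.
rewrite -(perm_filterC (fun d : {set T} => [forall z in d, ~~ Hs z]) (enum (edges T))).
rewrite perm_cat2l; apply: uniq_perm.
- by rewrite filter_uniq ?enum_uniq.
- rewrite cat_uniq uniq_KK // map_inj_uniq ?enum_uniq; last exact: imset_inj.
  rewrite andbT; apply/hasPn => _ /mapP[d _ ->]; apply/mem_KK => -[x [n [xH nN e]]].
  have : n \in (inr : H -> T) @: d by rewrite e !inE eqxx orbT.
  by case/imsetP=> h _ en; move: (nbrs_Hs nN); rewrite en.
move=> d; rewrite mem_filter mem_enum mem_cat; apply/andP/orP.
  case=> hd /mem_edges[a [b [ab ed]]]; subst d.
  have nHs : Hs a || Hs b.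
    apply: contraR hd; rewrite negb_or => /andP[h1 h2].
    by apply/forall_inP => z; rewrite !inE => /orP[]/eqP->.
  case: a b ab nHs {hd} => [x|h] [y|k] //= ab _.
  - left; apply/mem_KK; exists (inr k), (inl x); split; last by rewrite setUC.
      by rewrite map_f ?mem_enum.
    by apply/mem_nbrs; exists x.
  - left; apply/mem_KK; exists (inr h), (inl y); split=> //.
      by rewrite map_f ?mem_enum.
    by apply/mem_nbrs; exists y.
  - right; apply/mapP; exists [set h; k]; first by rewrite mem_enum edgesP.
    by rewrite imset2P.
case=> [/mem_KK[_ [_ [/mapP[h _ ->] /mem_nbrs[x vx ->] ->]]]|/mapP[d' + ->]].
  split; last by apply: edgesP.
  by apply/forall_inP => /(_ (inr h)); rewrite !inE eqxx => /(_ isT).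
rewrite mem_enum => /mem_edges[h [k [hk ->]]]; rewrite imset2P; split; last exact: edgesP.
by apply/forall_inP => /(_ (inr h)); rewrite !inE eqxx => /(_ isT).
Qed.

(** The copy is the image of [phi], which sends [u], [v] to [a], [b] and fixes the other vertices.
    Both twins have neighbourhood [nbrs], and as they are not adjacent it does not matter whether
    [ab] is an edge of $H$. The signature is pulled back along [phi]. *)
Let embed sg (a b : T) : Hs a -> Hs b -> a != b ->
  par sg (rest ++ KK [:: a; b] nbrs) = false -> dec sg (rest ++ KK [:: a; b] nbrs).
Proof.
move=> ha hb nab.
pose phi x : T := if insub x is Some x' then inl (x' : V) else if x == u then a else b.
have [uv tw] := huv.
have phiu : phi u = a by rewrite /phi insubF ?eqxx.
have phiv : phi v = b by rewrite /phi insubF ?eqxx ?andbF // eq_sym (negPf uv).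
have phiV (x : V) : phi (val x) = inl x by rewrite /phi valK.
have caseV x : [\/ x = u, x = v | exists x' : V, x = val x'].
  have [->|xu] := eqVneq x u; first by constructor 1.
  have [->|xv] := eqVneq x v; first by constructor 2.
  have h : (x != u) && (x != v) by rewrite xu.
  by constructor 3; exists (Sub x h).
have Hinl z (x : V) : Hs z -> z = inl x -> False by move=> hz e; move: hz; rewrite e.
have phi_inj : injective phi.
  move=> x y; case: (caseV x) => [->|->|[x' ->]]; case: (caseV y) => [->|->|[y' ->]];
    rewrite ?phiu ?phiv ?phiV //.
  - by move=> e; rewrite e eqxx in nab.
  - by move/(Hinl _ _ ha).
  - by move=> e; rewrite e eqxx in nab.
  - by move/(Hinl _ _ hb).
  - by move/esym/(Hinl _ _ ha).
  - by move/esym/(Hinl _ _ hb).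
  - by case=> ->.
have pe : perm_eq [seq phi @: (d : {set G}) | d <- enum (edges G)] (rest ++ KK [:: a; b] nbrs).
  have aN z : Hs z -> z \notin nbrs by move=> hz; apply/negP => /nbrs_Hs; rewrite hz.
  apply: uniq_perm.
  - by rewrite map_inj_uniq ?enum_uniq; last exact: imset_inj.
  - rewrite cat_uniq filter_uniq ?enum_uniq // uniq_KK //=; last 2 first.
    + by rewrite inE nab.
    + by move=> z; rewrite !inE => /orP[]/eqP->; apply: aN.
    rewrite andbT; apply/hasPn => _ /mem_KK[x [n [xab _ ->]]]; apply/negP => /rest_Hs/(_ x).
    by rewrite !inE eqxx => /(_ isT); move: xab; rewrite !inE => /orP[]/eqP->; rewrite ?ha ?hb.
  have inKK z (x : V) : z \in [:: a; b] -> sedge v (val x) -> [set z; inl x] \in KK [:: a; b] nbrs.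
    by move=> zab vx; apply/mem_KK; exists z, (inl x); split=> //; apply/mem_nbrs; exists x.
  have ab1 : a \in [:: a; b] by rewrite mem_head.
  have ab2 : b \in [:: a; b] by rewrite !inE eqxx orbT.
  have twV (x : V) : sedge (val x) u = sedge (val x) v.
    by have /andP[h1 h2] := valP x; apply: tw.
  move=> d; rewrite mem_cat; apply/mapP/orP => [[d' + ->]|].
    rewrite mem_enum => /mem_edges[x [y [xy ->]]]; rewrite imset2P.
    case: (caseV x) xy => [->|->|[x' ->]]; case: (caseV y) => [->|->|[y' ->]];
      rewrite ?phiu ?phiv ?phiV ?sedge_irr // => xy.
    + by move: hnadj; rewrite xy.
    + by right; apply: inKK => //; rewrite sedge_sym -twV sedge_sym.
    + by move: hnadj; rewrite sedge_sym xy.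
    + by right; apply: inKK.
    + by right; rewrite setUC; apply: inKK => //; rewrite sedge_sym -twV.
    + by right; rewrite setUC; apply: inKK => //; rewrite sedge_sym.
    + left; rewrite mem_filter mem_enum edgesP // andbT.
      by apply/forall_inP => z; rewrite !inE => /orP[]/eqP->.
  case=> [dr|/mem_KK[z [_ [zab /mem_nbrs[x vx ->] ->]]]].
    move: (dr); rewrite mem_filter mem_enum => /andP[_ /mem_edges[p [q [pq ed]]]].
    have := rest_Hs dr; rewrite ed.
    case: p q pq {ed} => [x|h] [y|k] pq hz; last 3 first.
    + by have := hz (inr k); rewrite !inE eqxx orbT => /(_ isT).
    + by have := hz (inr h); rewrite !inE eqxx => /(_ isT).
    + by have := hz (inr h); rewrite !inE eqxx => /(_ isT).
    by exists [set val x; val y]; [rewrite mem_enum edgesP|rewrite imset2P !phiV].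
  move: zab; rewrite !inE => /orP[]/eqP->.
    exists [set u; val x]; last by rewrite imset2P phiu phiV.
    by rewrite mem_enum edgesP // sedge_sym twV sedge_sym.
  exists [set v; val x]; last by rewrite imset2P phiv phiV.
  by rewrite mem_enum edgesP.
rewrite -(par_perm _ pe) par_map => e; apply: dec_perm pe _.
by apply: dec_map => //; apply: signed_decomposable.
Qed.

Lemma signed_twin_substitution sg : 0 < deg v -> 0 < #|H| -> eulerian H ->
  ~~ odd #|H| -> ~ isomorphic H co_claw \/ 4 <= deg v ->
  par sg (enum (edges T)) = false -> dec sg (enum (edges T)).
Proof.
move=> hv hH0 hHeul hHeven hclaw.
have eG : even_graph Hedges.
  split.
  - by rewrite map_inj_uniq ?enum_uniq; last exact: imset_inj.
  - move=> _ /mapP[d /edges_set2[a [b [ab ->]]] ->]; exists (inr a), (inr b).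
    by rewrite imset2P (inj_eq inrI).
  case=> [x|h]; rewrite count_map.
    rewrite (eq_count (a2 := pred0)) ?count_pred0 // => d /=.
    by apply/negbTE/negP => /imsetP[].
  rewrite (eq_count (a2 := fun d : {set H} => h \in d)) ?count_deg //.
  by move=> d /=; apply: mem_imset.
have [R0 [F [pF dR cF]]] := even_graph_decomp sg eG.
(* The signature without odd edges yields a decomposition of $G$ itself into cycles, so [deg v] is
   even. *)
have dv : ~~ odd (size nbrs).
  by rewrite size_nbrs; apply: (dec_even_graph (sg := pred0)); apply: signed_decomposable; rewrite // /par count_pred0.
have N0 : nbrs != [::] by rewrite -size_eq0 size_nbrs -lt0n.
have oS : okS Hs Hv.
  apply/and3P; split.
  - by rewrite map_inj_uniq ?enum_uniq.
  - by apply/allP=> _ /mapP[h _ ->].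
  - by rewrite size_map -cardE.
have inHe d (z : T) : d \in Hedges -> z \in d -> z \in Hv.
  by case/mapP=> d' _ -> /imsetP[h _ ->]; rewrite map_f ?mem_enum.
have sF c : c \in F -> {subset c <= Hv}.
  move=> cF' z /cedges_vertex[d dc zd]; apply: inHe zd.
  by rewrite (perm_mem pF) mem_cat (mem_fedges cF' dc) orbT.
(* A triangle in an Eulerian graph on four vertices makes $H$ a co-claw, and then [hclaw] gives the
   bound on [deg v]. *)
have hb c : F = [:: c] -> size Hv = 4 -> size c = 3 -> 3 < size nbrs.
  move=> eF h4 h3; rewrite size_nbrs; case: hclaw => // nclaw; exfalso; apply: nclaw.
  have adj (h k : H) : [set inr h; inr k] \in fedges F -> sedge h k.
    move=> hk; have : [set inr h; inr k] \in Hedges by rewrite (perm_mem pF) mem_cat hk orbT.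
    case/mapP=> d; rewrite mem_enum => /mem_edges[p [q [pq ->]]]; rewrite imset2P.
    by case/set2_eq => -[-> ->] //; rewrite sedge_sym.
  have uc : uniq c by case: cF => /allP oF _ _; apply: ocyc_uniq (oF c _); rewrite eF mem_head.
  have cH : {subset c <= Hv} by apply: sF; rewrite eF mem_head.
  case: c eF h3 uc cH => [|a [|b [|e [|? ?]]]] // eF _ uc cH.
  have [/mapP[x _ ea] /mapP[y _ eb] /mapP[z _ ee]] : [/\ a \in Hv, b \in Hv & e \in Hv].
    by split; apply: cH; rewrite !inE eqxx ?orbT.
  move: eF uc; rewrite ea eb ee => eF uc.
  have u3 : uniq [:: x; y; z] by rewrite -(map_inj_uniq inrI).
  apply: (co_clawP hHeul _ u3).
  - by move: h4; rewrite size_map -cardE.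
  - by apply: adj; rewrite eF !inE eqxx.
  - by apply: adj; rewrite eF !inE eqxx ?orbT.
  - by apply: adj; rewrite eF !inE eqxx ?orbT.
have S0 : Hv != [::] by rewrite -size_eq0 size_map -cardE -lt0n.
have w := win_cactus uniq_nbrs dv nbrs_Hs N0 rest_Hs embed cF oS S0 sF hb.
have pe : perm_eq (R0 ++ (rest ++ KK Hv nbrs ++ fedges F)) (enum (edges T)).
  by rewrite perm_sym; apply: perm_trans edges_split _; clear -pF; move: (KK Hv nbrs) => K; permc.
rewrite -(par_perm _ pe) par_cat (dec_par dR) => /w dw.
exact: dec_perm pe (dec_cat dR dw).
Qed.

End TwinSubstitution.

Theorem theorem6p1 (G : sgraph) (u v : G) (H : sgraph)
  (hG : strongly_even_cycle_decomposable G)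
  (huv : twins u v)
  (hu : 0 < deg u) (hv : 0 < deg v)
  (hnadj : ~~ sedge u v)
  (hH0 : 0 < #|H|)
  (hHeul : eulerian H)
  (hHeven : ~~ odd #|H|)
  (hclaw : ~ isomorphic H co_claw \/ 4 <= deg v) :
  strongly_even_cycle_decomposable (twin_substitution u v H).
Proof.
by apply: signed_subdivisions => sg; apply: signed_twin_substitution.
Qed.
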